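(* Let $\{X_t\}_{t\ge 0}$ be the Ornstein-Uhlenbeck convenience dividend process, $\{\xi_t\}_{t\ge 0}$ the market information process, $\{\mathcal F_t\}_{t\ge0}$ the market filtration they jointly generate, and $\{\pi_t\}_{t\ge0}$ the deterministic discount factor, all as specified in the context. For $t>0$ define the commodity price by $$S_t=\frac{1}{\pi_t}\,\mathbb E\left[\left.\int_t^\infty \pi_u X_u\,\mathrm du\,\right|\,\mathcal F_t\right],$$ and set $$p_t=\int_t^\infty \pi_u\,\mathrm du,\qquad q_t=\int_t^\infty \pi_u\,e^{-\kappa(u-t)}\,\mathrm du,\qquad z_t=\frac{\sigma^2\psi^2 t\int_t^\infty q_s^2\,\mathrm ds}{1+\sigma^2\psi^2 t\int_t^\infty q_s^2\,\mathrm ds}.$$ Then for every $t>0$, almost surely, $$\pi_t S_t=(1-z_t)\left[\theta p_t+q_t\,(X_t-\theta)\right]+\frac{1}{\sigma t}\,z_t\,\xi_t .$$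
   Context: Work on a probability space $(\Omega,\mathcal F,\mathbb Q)$ ($\mathbb Q$ is the pricing measure; $\mathbb E$ denotes expectation under $\mathbb Q$) carrying two independent standard one-dimensional Brownian motions $\{\beta_t\}_{t\ge0}$ and $\{B_t\}_{t\ge 0}$. Discount factor: $\pi_t=\exp\left(-\int_0^t r_s\,\mathrm ds\right)$, where the short rate $\{r_t\}_{t\ge0}$ is deterministic, and $\int_0^\infty \pi_u\,\mathrm du<\infty$. Dividend process: $\{X_t\}_{t\ge0}$ is the Ornstein-Uhlenbeck process with constant (deterministic) initial value $X_0$ solving $$\mathrm dX_t=\kappa(\theta-X_t)\,\mathrm dt+\psi\,\mathrm d\beta_t,$$ with constants $\kappa>0$, $\theta\in\mathbb R$, $\psi>0$. Thus $\{X_t\}$ is independent of $\{B_t\}$. Information process: for a constant $\sigma>0$, $$\xi_t=\sigma t\int_t^\infty \pi_u X_u\,\mathrm du+B_t,\qquad t\ge0.$$ Market filtration: $\mathcal F_t$ is the $\sigma$-algebra generated by $\{\xi_s\}_{0\le s\le t}$ and $\{X_s\}_{0\le s\le t}$. *)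

(* Defs.v *)
From HB Require Import structures.
From mathcomp Require Import all_boot all_order all_algebra.
From mathcomp Require Import all_classical all_reals all_analysis.

Set Implicit Arguments.
Unset Strict Implicit.
Unset Printing Implicit Defensive.

Import Order.TTheory GRing.Theory Num.Theory.
Import numFieldNormedType.Exports.

Local Open Scope classical_set_scope.
Local Open Scope ring_scope.

Section Probability.
Context {d : measure_display} {Omega : measurableType d} {R : realType}.

Definition preimages_of (I : Type) (D : set I) (Y : I -> Omega -> R) :
    set_system Omega :=
  \bigcup_(i in D) preimage_set_system [set: Omega] (Y i) measurable.

Definition sigma_of (I : Type) (D : set I) (Y : I -> Omega -> R) :
    set_system Omega :=
  <<s preimages_of D Y >>.

Variable Q : probability Omega R.

Definition independent_systems (G H : set_system Omega) : Prop :=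
  forall A C, G A -> H C -> Q (A `&` C) = (Q A * Q C)%E.

(* Processes are indexed by R, but only the times t >= 0 are constrained.
   The second parameter of normal_prob is the standard deviation. *)
Record is_brownian_motion (W : R -> {RV Q >-> R}) : Prop := {
  bm_start : {ae Q, forall w, W 0 w = 0};
  bm_gaussian : forall s t, 0 <= s -> s < t ->
    forall U : set R, measurable U ->
      Q ((fun w => W t w - W s w) @^-1` U) = normal_prob 0 (Num.sqrt (t - s)) U;
  bm_indep : forall s t, 0 <= s -> s < t ->
    independent_systems
      (sigma_of `[0, s] W)
      (sigma_of [set: unit] (fun=> fun w => W t w - W s w));
  bm_continuous : {ae Q, forall w,
    {within `[0, +oo[, continuous (fun t => W t w)}}
}.

(* The noise being additive with constant coefficient, the stochastic integral
   of the equation dX = kappa (theta - X) dt + psi d beta is psi * beta.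
   Continuity holds on every path so that time integrals of X are random
   variables. *)
Record is_ornstein_uhlenbeck (kappa theta psi x0 : R)
    (beta X : R -> {RV Q >-> R}) : Prop := {
  ou_continuous : forall w, {within `[0, +oo[, continuous (fun t => X t w)};
  ou_sde : {ae Q, forall w, forall t, 0 <= t ->
    X t w = x0 + \int[lebesgue_measure]_(s in `[0, t]) (kappa * (theta - X s w))
            + psi * beta t w}
}.

Definition is_cond_exp (G : set_system Omega) (Z V : Omega -> R) : Prop :=
  [/\ Q.-integrable setT (EFin \o Z),
      Q.-integrable setT (EFin \o V),
      (forall U : set R, measurable U -> G (V @^-1` U)) &
      forall A, G A ->
        (\int[Q]_(w in A) (V w)%:E = \int[Q]_(w in A) (Z w)%:E)%E].

(* A chosen version of E[Z | G]; versions agree almost surely. The default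
   value 0 is used only if there is no version, e.g. if Z is not integrable. *)
Definition cond_exp (G : set_system Omega) (Z : Omega -> R) : Omega -> R :=
  xget (fun=> 0) (is_cond_exp G Z).

End Probability.

Section Deterministic.
Context {R : realType}.

Definition discount (r : R -> R) (t : R) : R :=
  expR (- \int[lebesgue_measure]_(s in `[0, t]) r s).

Definition p_coef (r : R -> R) (t : R) : R :=
  \int[lebesgue_measure]_(u in `[t, +oo[) discount r u.

Definition q_coef (r : R -> R) (kappa t : R) : R :=
  \int[lebesgue_measure]_(u in `[t, +oo[)
    (discount r u * expR (- kappa * (u - t))).

Definition z_coef (r : R -> R) (kappa psi sigma t : R) : R :=
  let a := sigma ^+ 2 * psi ^+ 2 * t *
           \int[lebesgue_measure]_(s in `[t, +oo[) (q_coef r kappa s ^+ 2) in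
  a / (1 + a).

End Deterministic.

Section Market.
Context {d : measure_display} {Omega : measurableType d} {R : realType}.
Variable Q : probability Omega R.
Variables (r : R -> R) (sigma : R) (X B : R -> {RV Q >-> R}).

Definition discounted_dividends (t : R) (w : Omega) : R :=
  \int[lebesgue_measure]_(u in `[t, +oo[) (discount r u * X u w).

Definition information (t : R) (w : Omega) : R :=
  sigma * t * discounted_dividends t w + B t w.

Definition market_filtration (t : R) : set_system Omega :=
  <<s preimages_of `[0, t] information `|` preimages_of `[0, t] X >>.

Definition commodity_price (t : R) (w : Omega) : R :=
  (discount r t)^-1 *
  cond_exp Q (market_filtration t) (discounted_dividends t) w.

End Market.

(* Main.v *)
Require Import Defs.
From HB Require Import structures.
From mathcomp Require Import all_boot all_order all_algebra.
From mathcomp Require Import all_classical all_reals all_analysis.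
From mathcomp Require Import real_interval measurable_realfun.
From mathcomp Require Import ring lra.

Set Implicit Arguments.
Unset Strict Implicit.
Unset Printing Implicit Defensive.

Import Order.TTheory GRing.Theory Num.Theory.
Import numFieldNormedType.Exports.

Local Open Scope classical_set_scope.
Local Open Scope ring_scope.

(** Put [D = \int_t^oo pi X]. Splitting off the part of [D] that is a function of
    [X_t] leaves a Gaussian [M], independent of the past of [beta], of variance
    [v = psi^2 \int_t^oo q^2], and the claimed formula says that the residual
    [N = (1 - z) M - c B_t], with [c = z / (sigma t)], is orthogonal to [F_t].
    A linear combination [L] of observations [xi_s], [X_s] with [s <= t] is
    [V + sigma a M + \sum_j l_j B_{s_j}] with [a = \sum_j l_j s_j] and [V]
    measurable with respect to the past of [beta], because
    [xi_s = sigma s (\int_s^t pi X + D) + B_s]. Integrating out [M] and the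
    increments of [B] shows that [E cos (L + p + e N)] is
    [E cos (V + p)] times a Gaussian factor whose exponent has cross term
    [e a ((1 - z) v sigma - c) = 0]; hence it is even in [e]. Comparing [e] with
    [- e] and letting [sin (e N) / e] tend to [N] gives [E (N cos (L + p)) = 0] for
    all linear phases. Bounded pointwise limits of polynomials in [sin] are
    indicators of half-lines, which turns this, one observation at a time, into
    [E (N 1_A) = 0] for cylinders [A], and a pi-lambda argument concludes. *)

(** * Gaussian integrals *)

(** The weight z is a filtering gain. Dividing xi_t by sigma t gives a reading of D with error B_t /
    (sigma t), of variance 1 / (sigma^2 t), while D has variance v given the past of beta; z = v /
    (v + 1 / (sigma^2 t)) is the share of the signal. The earlier xi_s bring no further correction
    because Cov (B_s, B_t) = s for s <= t is proportional to the coefficient sigma s of D in xi_s,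
    so one constant c serves all observation times at once. M is a Wiener integral of psi q against
    beta. It is reached pathwise: integration by parts turns it into an ordinary integral, the
    almost sure limit of finite sums of increments. The equation of X holds only off a null set, so
    X_s need not be measurable for the raw past of beta; it is an almost sure limit of such
    variables, which is enough under a bounded cosine. Transforms stay real: if two terms are
    independent and one has vanishing sine transform, the expected cosine of their sum factorises.
    As pi is merely integrable, the absolute convergence of D rests on a bound of E |X_u| that is
    uniform in u. *)

Lemma cvg_eq (T : Type) (F : set_system T) (R : realType) (f : T -> R) (l l' : R) :
  l = l' -> f @ F --> l -> f @ F --> l'.
Proof. by move=> ->. Qed.

Section dct.
Context d (T : measurableType d) (R : realType) (mu : {measure set T -> \bar R}).

Lemma Rintegral_dominated_cvg (D : set T) (f_ : (T -> R)^nat) (f g : T -> R) :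
  measurable D ->
  (forall n, measurable_fun D (f_ n)) -> measurable_fun D f ->
  {ae mu, forall x, D x -> f_ ^~ x @ \oo --> f x} ->
  mu.-integrable D (EFin \o g) ->
  {ae mu, forall x, D x -> forall n, `|f_ n x| <= g x} ->
  \int[mu]_(x in D) f_ n x @[n --> \oo] --> \int[mu]_(x in D) f x.
Proof.
move=> mD mf_ mf ff ig fg.
have [||||intf _ h] := @dominated_convergence _ _ _ mu D mD
    (fun n => EFin \o f_ n) (EFin \o f) (EFin \o g) _ _ _ ig _.
- by move=> n; exact/measurable_EFinP.
- exact/measurable_EFinP.
- apply: filterS ff => x h Dx; apply/fine_cvgP; split; first exact: nearW.
  exact: h Dx.
- by apply: filterS fg => x h n Dx; rewrite /= lee_fin h.
- apply: fine_cvg; rewrite fineK; last exact: integrable_fin_num.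
  exact: h.
Qed.

(** Dominated convergence for the restrictions of [h]. The sets [Dn] need not increase; each point
    only has to belong to them eventually. *)
Lemma Rintegral_exhaust_cvg (Dn : (set T)^nat) (D : set T) (h : T -> R) :
  measurable D -> (forall n, measurable (Dn n)) -> (forall n, Dn n `<=` D) ->
  (forall x, D x -> \forall n \near \oo, Dn n x) ->
  mu.-integrable D (EFin \o h) ->
  \int[mu]_(x in Dn n) h x @[n --> \oo] --> \int[mu]_(x in D) h x.
Proof.
move=> mD mDn DnD Dlim ih.
have -> : (fun n => \int[mu]_(x in Dn n) h x) =
    (fun n => \int[mu]_(x in D) (h \_ (Dn n)) x).
  by apply/funext => n; rewrite -Rintegral_mkcondr setIidr.
have mh : measurable_fun D h by exact/measurable_EFinP/(measurable_int _ ih).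
apply: (@Rintegral_dominated_cvg _ _ _ (fun x => `|h x|)) => //.
- move=> n; apply/(measurable_restrict _ (mDn n) mD).
  exact: measurable_funS mh.
- apply: aeW => x Dx; apply: cvg_near_cst; near do idtac.
  have := Dlim _ Dx; apply: filterS => n Dnx.
  by rewrite patchE mem_set.
- exact: integrable_norm.
- apply: aeW => x Dx n; rewrite patchE; case: ifPn => // _.
  by rewrite normr0.
Unshelve. all: by end_near. Qed.

Lemma dominated_integrableR (D : set T) (f g : T -> R) : measurable D ->
  measurable_fun D f -> mu.-integrable D (EFin \o g) ->
  (forall x, D x -> `|f x| <= g x) -> mu.-integrable D (EFin \o f).
Proof.
move=> mD mf ig fg; apply: le_integrable ig => //; first exact/measurable_EFinP.
by move=> x Dx; rewrite /= lee_fin (le_trans (fg _ Dx))// ler_norm.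
Qed.

End dct.

Section trig_measurable.
Context {R : realType}.

Lemma measurable_cos : measurable_fun [set: R] (@cos R).
Proof. exact: continuous_measurable_fun (@continuous_cos R). Qed.

Lemma measurable_sin : measurable_fun [set: R] (@sin R).
Proof. exact: continuous_measurable_fun (@continuous_sin R). Qed.

End trig_measurable.

Section normal_characteristic.
Context {R : realType}.
Variable s : R.
Hypothesis s0 : 0 < s.
Local Notation mu := (@lebesgue_measure R).
Let g := normal_pdf 0 s.

Let gE x : g x = normal_peak s * expR (- x ^+ 2 / (s ^+ 2 *+ 2)).
Proof. by rewrite /g normal_pdfE ?gt_eqF// /normal_fun subr0. Qed.

Let sn0 : s != 0. Proof. by rewrite gt_eqF. Qed.

Let cg : continuous g. Proof. exact: continuous_normal_pdf. Qed.

Let mg : measurable_fun setT g. Proof. exact: measurable_normal_pdf. Qed.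

Let g0 x : 0 <= g x. Proof. exact: normal_pdf_ge0. Qed.

Let ig : mu.-integrable setT (EFin \o g).
Proof. exact: (integrable_normal_pdf 0 s). Qed.

Let gN x : g (- x) = g x. Proof. by rewrite !gE sqrrN. Qed.

Let dg x : is_derive x (1:R) g (- (x / s ^+ 2) * g x).
Proof.
have -> : g = (fun x => normal_peak s * expR (- x ^+ 2 / (s ^+ 2 *+ 2))).
  by apply/funext => y; rewrite gE.
apply: is_derive_eq.
rewrite /= !scaler0 ?add0r ?addr0.
have scE (a b : R) : a *: b = a * b by [].
by rewrite !scE; field.
Qed.

(** The density of deviation [r2] has half the exponent of [g], so the other half of the exponent of
    [g] is free to absorb a factor [|x|]. *)
Let r2 := s * Num.sqrt 2.

Let r2_gt0 : 0 < r2. Proof. by rewrite mulr_gt0// sqrtr_gt0. Qed.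

Let r2E : r2 ^+ 2 = s ^+ 2 *+ 2.
Proof. by rewrite exprMn sqr_sqrtr// mulr_natr. Qed.

(* [u <= 1 + u^2 / 4 <= exp (u^2 / 4)] with [u = |x| / s] *)
Let abs_pdf_le x : `|x| * g x <= r2 * normal_pdf 0 r2 x.
Proof.
rewrite gE normal_pdfE ?gt_eqF// /normal_fun subr0.
have -> : normal_peak r2 = normal_peak s / Num.sqrt 2.
  rewrite /normal_peak r2E -invfM -sqrtrM; last first.
    by rewrite mulrn_wge0// mulr_ge0 ?sqr_ge0// pi_ge0.
  by congr (Num.sqrt _)^-1; ring.
rewrite r2E.
have -> : - x ^+ 2 / (s ^+ 2 *+ 2) =
    - x ^+ 2 / (s ^+ 2 *+ 2 *+ 2) - x ^+ 2 / (s ^+ 2 *+ 2 *+ 2) by field.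
rewrite expRD.
set e := expR (- x ^+ 2 / _).
have e0 : 0 < e by exact: expR_gt0.
have -> : r2 * (normal_peak s / Num.sqrt 2 * e) = normal_peak s * s * e.
  by rewrite /r2; field; rewrite gt_eqF// sqrtr_gt0.
have -> : `|x| * (normal_peak s * (e * expR (- (x ^+ 2 / (s ^+ 2 *+ 2 *+ 2))))) =
  normal_peak s * e * (`|x| * expR (- (x ^+ 2 / (s ^+ 2 *+ 2 *+ 2)))) by ring.
have -> : normal_peak s * s * e = normal_peak s * e * s by ring.
rewrite ler_pM2l; last first.
  by rewrite mulr_gt0// normal_peak_gt0.
rewrite expRN ler_pdivrMr ?expR_gt0//.
apply: (@le_trans _ _ (s * (1 + x ^+ 2 / (s ^+ 2 *+ 2 *+ 2)))); last first.
  by rewrite ler_pM2l// expR_ge1Dx.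
rewrite -subr_ge0 -real_normK ?num_real//.
have -> : s * (1 + `|x| ^+ 2 / (s ^+ 2 *+ 2 *+ 2)) - `|x| =
   s * (1 - `|x| / (2 * s)) ^+ 2 by field.
by rewrite mulr_ge0 ?sqr_ge0// ltW.
Qed.

Lemma integrable_abs_normal_pdf : mu.-integrable setT
  (EFin \o (fun x => `|x| * normal_pdf 0 s x)).
Proof.
apply: (@dominated_integrableR _ _ R mu setT _ (fun x => r2 * normal_pdf 0 r2 x)) => //.
- by apply: measurable_funM => //; exact: measurableT_comp.
- under [X in _.-integrable _ X]eq_fun do rewrite /= EFinM.
  by apply: integrableZl => //; exact: integrable_normal_pdf.
- move=> x _; rewrite ger0_norm; first exact: abs_pdf_le.
  by rewrite mulr_ge0.
Qed.

(** The constant comes from [r2 = s * sqrt 2 <= 2 * s]. It is not sharp; later only finiteness and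
    the linear order in [s] count. *)
Lemma Rintegral_abs_normal_pdf :
  \int[mu]_x (`|x| * normal_pdf 0 s x) <= 2 * s.
Proof.
apply: (@le_trans _ _ (\int[mu]_x (r2 * normal_pdf 0 r2 x))).
  apply: le_Rintegral => //.
  - exact: integrable_abs_normal_pdf.
  - under [X in _.-integrable _ X]eq_fun do rewrite /= EFinM.
    by apply: integrableZl => //; exact: integrable_normal_pdf.
rewrite RintegralZl//; last exact: integrable_normal_pdf.
rewrite /Rintegral integral_normal_pdf/= mulr1 /r2 [leRHS]mulrC ler_pM2l//.
by rewrite -ler_sqr ?nnegrE ?sqrtr_ge0// sqr_sqrtr// -natrX ler_nat.
Qed.


Let integrable_bounded_pdf (h : R -> R) : measurable_fun setT h ->
  (forall x, `|h x| <= 1) -> mu.-integrable setT (EFin \o (fun x => h x * g x)).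
Proof.
move=> mh h1; apply: (@dominated_integrableR _ _ R mu setT _ g) => //.
  exact: measurable_funM.
by move=> x _; rewrite normrM (ger0_norm (g0 x)) ler_piMl.
Qed.

Let integrable_bounded_xpdf (h : R -> R) : measurable_fun setT h ->
  (forall x, `|h x| <= 1) ->
  mu.-integrable setT (EFin \o (fun x => x * h x * g x)).
Proof.
move=> mh h1.
apply: (@dominated_integrableR _ _ R mu setT _ (fun x => `|x| * g x)) => //.
- by apply: measurable_funM => //; exact: measurable_funM.
- exact: integrable_abs_normal_pdf.
- by move=> x _; rewrite !normrM (ger0_norm (g0 x)) ler_wpM2r// ler_piMr.
Qed.

Let mcos (a : R) : measurable_fun setT (fun x : R => cos (a * x)).
Proof. by apply: measurableT_comp; [exact: measurable_cos|exact: measurable_funM]. Qed.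

Let msin (a : R) : measurable_fun setT (fun x : R => sin (a * x)).
Proof. by apply: measurableT_comp; [exact: measurable_sin|exact: measurable_funM]. Qed.

(** The integrand is odd. The substitution by the opposite is made on [[- n, n]], and these
    intervals exhaust the line. *)
Lemma Rintegral_sin_normal_pdf (a : R) :
  \int[mu]_x (sin (a * x) * normal_pdf 0 s x) = 0.
Proof.
have cf : continuous (fun x : R => sin (a * x) * g x).
  move=> x; apply: cvgM; last exact: cg.
  apply: (@continuous_comp _ _ _ (fun x : R => a * x)).
    exact: mulrl_continuous.
  exact: continuous_sin.
have is_ : mu.-integrable setT (EFin \o (fun x => sin (a * x) * g x)).
  apply: (integrable_bounded_pdf (msin a)) => x; exact: sin_max.
have lim : \int[mu]_(x in `[(- n%:R)%R, n%:R]) (sin (a * x) * g x)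
    @[n --> \oo] --> \int[mu]_x (sin (a * x) * g x).
  apply: Rintegral_exhaust_cvg => //.
  move=> x _; near=> n; rewrite /= in_itv/= -ler_norml.
  by near: n; exact: nbhs_infty_ger.
apply: (cvg_unique _ lim) => //; apply: cvg_near_cst; near=> n.
have nn : - n%:R <= n%:R :> R by rewrite lerNl (le_trans _ (ler0n _ _))// oppr_le0.
have := @integration_by_substitution_oppr R (fun x => sin (a * x) * g x) _ _ nn.
rewrite opprK => /(_ _)/(congr1 fine) => H.
have {H} : \int[mu]_(x in `[(- n%:R)%R, n%:R]) (sin (a * x) * g x) =
    \int[mu]_(x in `[(- n%:R)%R, n%:R]) (- (sin (a * x) * g x)).
  rewrite [LHS]H; last exact: continuous_subspaceT.
  by apply: eq_Rintegral => x _ /=; rewrite mulrN sinN gN mulNr.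
under [in RHS]eq_Rintegral do rewrite -mulN1r.
rewrite RintegralZl//; last exact: integrableS is_.
by rewrite mulN1r => /eqP; rewrite -addr_eq0 -mulr2n mulrn_eq0/= => /eqP.
Unshelve. all: by end_near. Qed.

Let pdf_cvg0 : g n%:R @[n --> \oo] --> (0:R).
Proof.
have gle n : g n.+1%:R <= r2 * normal_peak r2 / n.+1%:R.
  rewrite ler_pdivlMr// mulrC -[X in X * _](@ger0_norm _ n.+1%:R)//.
  by rewrite (le_trans (abs_pdf_le _))// ler_pM2l// normal_pdf_ub// gt_eqF.
rewrite -(cvg_shiftS (fun n => g n%:R)).
apply: (@squeeze_cvgr _ _ _ _ (cst 0) (fun n => r2 * normal_peak r2 / n.+1%:R)).
- by apply: nearW => n; rewrite g0/=; exact: gle.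
- exact: cvg_cst.
- rewrite -[X in _ --> X](mulr0 (r2 * normal_peak r2)).
  by apply: cvgMr; exact: cvg_harmonic.
Qed.

(** The integrand is the derivative of [s ^+ 2 * (sin (a * x) * g x)], because
    [g' = - x / s ^+ 2 * g], and the boundary values vanish at infinity. *)
Let stein_cvg (a : R) :
  \int[mu]_(x in `[(- n%:R)%R, n%:R]) (a * s ^+ 2 * (cos (a * x) * g x) -
     x * sin (a * x) * g x) @[n --> \oo] --> (0:R).
Proof.
pose F x := s ^+ 2 * (sin (a * x) * g x).
have dF x : is_derive x (1:R) F
    (a * s ^+ 2 * (cos (a * x) * g x) - x * sin (a * x) * g x).
  have dgx := dg x; rewrite /F; apply: is_derive_eq.
  have scE (u v : R) : u *: v = u * v by [].
  by rewrite !scE; field.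
have cF : continuous F.
  by move=> x; apply/differentiable_continuous/derivable1_diffP; have [] := dF x.
pose S n := \int[mu]_(x in `[(- n%:R)%R, n%:R])
    (a * s ^+ 2 * (cos (a * x) * g x) - x * sin (a * x) * g x).
(* The index is shifted because the fundamental theorem is applied on a nondegenerate interval, and
   [n = 0] gives a point. *)
have FE n : S n.+1 = F n.+1%:R - F (- n.+1%:R).
  rewrite /S /Rintegral (@continuous_FTC2 _ _ F)//.
  - by rewrite (lt_le_trans _ (ler0n _ _))// oppr_lt0.
  - apply: continuous_subspaceT => x; apply: cvgB; apply: cvgM; last 1 first.
    + exact: cg.
    + exact: cvg_cst.
    + apply: cvgM; last exact: cg.
      apply: (@continuous_comp _ _ _ (fun x : R => a * x)).
        exact: mulrl_continuous.
      exact: continuous_cos.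
    + apply: cvgM; first exact: cvg_id.
      apply: (@continuous_comp _ _ _ (fun x : R => a * x)).
        exact: mulrl_continuous.
      exact: continuous_sin.
  - split.
    + by move=> x _; have [] := dF x.
    + by apply: cvg_at_right_filter; exact: cF.
    + by apply: cvg_at_left_filter; exact: cF.
  - by move=> x _; rewrite derive1E; have [_ ->] := dF x.
rewrite -(cvg_shiftS S).
have -> : (fun n => S n.+1) = (fun n => F n.+1%:R - F (- n.+1%:R)) by exact/funext.
have Fle x : `|F x| <= s ^+ 2 * g x.
  rewrite /F !normrM !(ger0_norm (g0 _)) -!normrM -expr2 ger0_norm ?sqr_ge0//.
  by rewrite ler_wpM2l ?sqr_ge0// ler_piMl// sin_max.
have lim0 : s ^+ 2 * g n.+1%:R @[n --> \oo] --> (0:R).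
  rewrite -[X in _ --> X](mulr0 (s ^+ 2)); apply: cvgMr.
  by rewrite (cvg_shiftS (fun n => g n%:R)).
apply: (@cvg_trans _ (nbhs (0 - 0 : R))); last by rewrite subr0.
apply: cvgB; apply: norm_cvg0.
  apply: (@squeeze_cvgr _ _ _ _ (cst 0) _ _ _ _ _ lim0); last exact: cvg_cst.
  by apply: nearW => n; rewrite /= normr_ge0 Fle.
apply: (@squeeze_cvgr _ _ _ _ (cst 0) _ _ _ _ _ lim0); last exact: cvg_cst.
by apply: nearW => n; rewrite /= normr_ge0 (le_trans (Fle _))// gN.
Qed.

Let stein (a : R) : \int[mu]_x (x * sin (a * x) * g x) =
  a * s ^+ 2 * \int[mu]_x (cos (a * x) * g x).
Proof.
have i1 : mu.-integrable setT (EFin \o (fun x => a * s ^+ 2 * (cos (a * x) * g x))).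
  under [X in _.-integrable _ X]eq_fun do rewrite /= EFinM.
  apply: integrableZl => //; apply: (integrable_bounded_pdf (mcos a)) => x.
  exact: cos_max.
have i2 : mu.-integrable setT (EFin \o (fun x => x * sin (a * x) * g x)).
  apply: (integrable_bounded_xpdf (msin a)) => x.
  exact: sin_max.
have : \int[mu]_x (a * s ^+ 2 * (cos (a * x) * g x) - x * sin (a * x) * g x) = 0.
  apply: (cvg_unique _ _ (stein_cvg a)) => //.
  apply: Rintegral_exhaust_cvg => //.
    move=> x _; near=> n; rewrite /= in_itv/= -ler_norml.
    by near: n; exact: nbhs_infty_ger.
  under [X in _.-integrable _ X]eq_fun do rewrite /= EFinB.
  exact: integrableB.
rewrite RintegralB// RintegralZl//; last first.
  apply: (integrable_bounded_pdf (mcos a)) => x; exact: cos_max.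
by move/subr0_eq.
Unshelve. all: by end_near. Qed.

(** Differentiating under the integral and applying [stein] shows that the transform [F] solves
    [F' b = - b * s ^+ 2 * F b]; hence its product with [expR (b ^+ 2 * s ^+ 2 / 2)] is constant,
    with value 1 at 0. *)
Lemma Rintegral_cos_normal_pdf (a : R) :
  \int[mu]_x (cos (a * x) * normal_pdf 0 s x) = expR (- (a ^+ 2 * s ^+ 2 / 2)).
Proof.
pose f (a x : R) := cos (a * x) * g x.
pose F (a : R) := \int[mu]_x f a x.
have df (b x : R) : is_derive b (1:R) (f ^~ x) (- (x * sin (b * x) * g x)).
  rewrite /f; apply: is_derive_eq.
  have scE (u v : R) : u *: v = u * v by [].
  by rewrite !scE; ring.
have if_ b : mu.-integrable setT (EFin \o f b).
  apply: (integrable_bounded_pdf (mcos b)) => x; exact: cos_max.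
have pE b x : partial1of2 f b x = - (x * sin (b * x) * g x).
  by rewrite partial1of2E; have [_ ->] := df b x.
have pb b x : `|partial1of2 f b x| <= `|x| * g x.
  rewrite pE normrN !normrM (ger0_norm (g0 x)) ler_wpM2r// ler_piMr//.
  exact: sin_max.
have dF b : is_derive b (1:R) F (- (b * s ^+ 2 * F b)).
  (* The dominating function [|x| * g x] does not depend on [b], so any interval around [b] would
     do; the radius 1 is arbitrary. *)
  have bI : `](b - 1), (b + 1)[%classic b by rewrite /= in_itv/=; lra.
  have G0 (y : R) : 0 <= `|y| * g y by rewrite mulr_ge0.
  have d1 (x y : R) : `](b - 1), (b + 1)[%classic x -> setT y ->
      derivable (f ^~ y) x 1 by move=> _ _; have [] := df x y.
  have b1 (x y : R) : `](b - 1), (b + 1)[%classic x -> setT y ->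
      `|partial1of2 f x y| <= `|y| * g y by move=> _ _; exact: pb.
  apply: DeriveDef.
    exact: (derivable_under_integral measurableT bI (fun x _ => if_ x) d1 G0
      integrable_abs_normal_pdf b1).
  rewrite -derive1E (differentiation_under_integral measurableT bI
    (fun x _ => if_ x) d1 G0 integrable_abs_normal_pdf b1).
  under eq_Rintegral do rewrite pE -mulN1r.
  rewrite RintegralZl//; last first.
    apply: (integrable_bounded_xpdf (msin b)) => x; exact: sin_max.
  by rewrite stein mulN1r.
pose H b := F b * expR (b ^+ 2 * s ^+ 2 / 2).
have dH b : is_derive b (1:R) H 0.
  rewrite /H; apply: is_derive_eq.
  have scE (u v : R) : u *: v = u * v by [].
  by rewrite !scE; field.
have := is_derive_0_is_cst a 0 dH.
rewrite /H expr0n/= !mul0r expR0 mulr1.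
have -> : F 0 = 1.
  rewrite /F /f; under eq_Rintegral do rewrite mul0r cos0 mul1r.
  by rewrite /Rintegral integral_normal_pdf.
move=> /(congr1 (fun x => x * expR (- (a ^+ 2 * s ^+ 2 / 2)))).
by rewrite /= -(mulrA (F a)) expRxMexpNx_1 mulr1 mul1r.
Qed.

End normal_characteristic.

(** * Independence and Brownian increments *)

Section normal_expectation.
Context {R : realType}.
Variable s : R.
Local Notation mu := (@lebesgue_measure R).

(** A change of variables with the Radon-Nikodym derivative, which agrees almost everywhere with
    [normal_pdf] since both have the same integral over every measurable set. *)
Lemma ge0_integral_normal_prob (f : R -> R) : measurable_fun setT f ->
  (forall x, 0 <= f x) ->
  (\int[normal_prob 0 s]_x (f x)%:E = \int[mu]_x (f x * normal_pdf 0 s x)%:E)%E.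
Proof.
move=> mf f0.
have dom := normal_prob_dominates (0:R) s.
have mef : measurable_fun setT (EFin \o f) by exact/measurable_EFinP.
rewrite -(Radon_Nikodym_SigmaFinite.change_of_variables dom)//.
have mpdf : measurable_fun setT (EFin \o normal_pdf 0 s).
  by apply/measurable_EFinP; exact: measurable_normal_pdf.
apply: ae_eq_integral => //.
- apply: emeasurable_funM => //; apply: (measurable_int mu).
  exact: (Radon_Nikodym_SigmaFinite.f_integrable dom).
- apply/measurable_EFinP; apply: measurable_funM => //.
  exact: measurable_normal_pdf.
- under [X in ae_eq _ _ _ X]eq_fun do rewrite EFinM.
  apply: ae_eqe_mul2l; apply: integral_ae_eq => //.
  + exact: (Radon_Nikodym_SigmaFinite.f_integrable dom).
  + by move=> E _ mE; rewrite -(Radon_Nikodym_SigmaFinite.f_integral dom).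
Qed.

Lemma bounded_Rintegral_normal_prob (f : R -> R) : measurable_fun setT f ->
  (forall x, `|f x| <= 1) ->
  \int[normal_prob 0 s]_x f x = \int[mu]_x (f x * normal_pdf 0 s x).
Proof.
move=> mf f1.
have i1 : (normal_prob 0 s).-integrable setT (EFin \o f).
  apply: (@dominated_integrableR _ _ _ _ _ _ (cst 1)) => //.
  exact: finite_measure_integrable_cst.
have ip := integrable_normal_pdf (0:R) s.
have i2 : mu.-integrable setT (EFin \o (fun x => f x * normal_pdf 0 s x)).
  apply: (@dominated_integrableR _ _ R mu setT _ (normal_pdf 0 s)) => //.
    by apply: measurable_funM => //; exact: measurable_normal_pdf.
  move=> x _; rewrite normrM (ger0_norm (normal_pdf_ge0 _ _ _)).
  by rewrite ler_piMl// normal_pdf_ge0.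
(* Since [|f| <= 1], the function [f + 1] is nonnegative; the added constant contributes the total
   mass 1 on both sides and cancels. *)
have := ge0_integral_normal_prob (f := fun x => f x + 1) _ _.
move=> /(_ _ _)/(congr1 fine) H.
have {H} : \int[normal_prob 0 s]_x (f x + 1) =
    \int[mu]_x (f x * normal_pdf 0 s x + normal_pdf 0 s x).
  rewrite [LHS]H; first last.
  - by move=> x; have := f1 x; rewrite ler_norml; lra.
  - exact: measurable_funD.
  - by apply: eq_Rintegral => x _; rewrite mulrDl mul1r.
rewrite RintegralD//; last exact: finite_measure_integrable_cst.
rewrite RintegralD// Rintegral_cst// => /eqP.
rewrite [X in fine X](_ : _ = 1%E); last exact: integral_normal_pdf.
rewrite /= mul1r [\int[mu]_x normal_pdf 0 s x](_ : _ = 1).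
  by rewrite (inj_eq (addIr _)) => /eqP.
by rewrite /Rintegral integral_normal_pdf.
Qed.

End normal_expectation.

Section gaussian_rv.
Context d (Omega : measurableType d) (R : realType) (Q : probability Omega R).
Variables (G : Omega -> R) (s : R).
Hypotheses (mG : measurable_fun setT G) (s0 : 0 < s).
Let GR : Omega -> measurableTypeR R := G.

Let mGR : measurable_fun setT GR. Proof. exact: mG. Qed.

HB.instance Definition _ := isMeasurableFun.Build _ _ _ _ GR mGR.

Hypothesis lawG : forall U, measurable U -> Q (G @^-1` U) = normal_prob 0 s U.
Local Notation mu := (@lebesgue_measure R).

Let transfer (f : R -> R) : measurable_fun setT f -> (forall x, `|f x| <= 1) ->
  \int[Q]_w f (G w) = \int[mu]_x (f x * normal_pdf 0 s x).
Proof.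
move=> mf f1; rewrite -bounded_Rintegral_normal_prob//; congr fine.
have -> : (\int[normal_prob 0 s]_x (f x)%:E = \int[distribution Q GR]_x (f x)%:E)%E.
  by apply: (eq_measure_integral (distribution Q GR)) => A mA _; exact/esym/lawG.
rewrite integral_distribution//; first exact/measurable_EFinP.
apply: (@dominated_integrableR _ _ _ _ _ _ (cst 1)) => //.
  exact: measurableT_comp.
exact: finite_measure_integrable_cst.
Qed.

Lemma gaussian_cos (a : R) :
  \int[Q]_w cos (a * G w) = expR (- (a ^+ 2 * s ^+ 2 / 2)).
Proof.
rewrite -Rintegral_cos_normal_pdf// -transfer//.
  apply: measurableT_comp; [exact: measurable_cos|exact: measurable_funM].
by move=> x; exact: cos_max.
Qed.

Lemma gaussian_sin (a : R) : \int[Q]_w sin (a * G w) = 0.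
Proof.
rewrite -(Rintegral_sin_normal_pdf s0 a) -transfer//.
  apply: measurableT_comp; [exact: measurable_sin|exact: measurable_funM].
by move=> x; exact: sin_max.
Qed.

(** Kept in the extended reals so that the bound also yields integrability of [G]. *)
Lemma gaussian_abs : (\int[Q]_w `|G w|%:E <= (2 * s)%:E)%E.
Proof.
have -> : (\int[Q]_w `|G w|%:E = \int[mu]_x (`|x| * normal_pdf 0 s x)%:E)%E.
  rewrite -ge0_integral_normal_prob//.
  have -> : (\int[normal_prob 0 s]_x `|x|%:E = \int[distribution Q GR]_x `|x|%:E)%E.
    by apply: (eq_measure_integral (distribution Q GR)) => A mA _; exact/esym/lawG.
  rewrite ge0_integral_distribution//.
  by apply/measurable_EFinP; exact: normr_measurable.
rewrite -[X in (X <= _)%E]fineK; first by rewrite lee_fin; exact: Rintegral_abs_normal_pdf.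
exact/integrable_fin_num/integrable_abs_normal_pdf.
Qed.

End gaussian_rv.

Section independence.
Context d (Omega : measurableType d) (R : realType) (Q : probability Omega R).
Variables (V W : Omega -> R).
Hypotheses (mV : measurable_fun setT V) (mW : measurable_fun setT W).
Hypothesis ind : forall A C, measurable A -> measurable C ->
  Q (V @^-1` A `&` W @^-1` C) = (Q (V @^-1` A) * Q (W @^-1` C))%E.

HB.instance Definition _ := isMeasurableFun.Build _ _ _ _ V mV.
HB.instance Definition _ := isMeasurableFun.Build _ _ _ _ W mW.

(** Independence on rectangles identifies the joint law of [V] and [W] with the product of their
    laws, and Fubini splits the integral. *)
Lemma indep_Rintegral_mul (f g : R -> R) :
  measurable_fun setT f -> measurable_fun setT g ->
  (forall x, `|f x| <= 1) -> (forall x, `|g x| <= 1) ->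
  \int[Q]_w (f (V w) * g (W w)) = \int[Q]_w f (V w) * \int[Q]_w g (W w).
Proof.
move=> mf mg f1 g1.
pose VW w := (V w, W w).
have mVW : measurable_fun setT VW by exact: measurable_fun_pair.
pose F (z : R * R) := f z.1 * g z.2.
have mF : measurable_fun setT F.
  by apply: measurable_funM; apply: measurableT_comp.
have F1 z : `|F z| <= 1.
  by rewrite normrM -[leRHS]mulr1 ler_pM.
have bi d1 (T : measurableType d1) (P : probability T R) (h : T -> R) :
    measurable_fun setT h -> (forall x, `|h x| <= 1) ->
    P.-integrable setT (EFin \o h).
  move=> mh h1; apply: (@dominated_integrableR _ _ _ _ _ _ (cst 1)) => //.
  exact: finite_measure_integrable_cst.
pose PV : probability R R := distribution Q V.
pose PW : probability R R := distribution Q W.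
pose VWm : {RV Q >-> (R * R)%type} := mfun_Sub (mem_set mVW).
pose PVW : probability (R * R)%type R := distribution Q VWm.
have tr (T : {RV Q >-> R}) (h : R -> R) :
    measurable_fun setT h -> (forall x, `|h x| <= 1) ->
    (\int[Q]_w (h (T w))%:E = \int[distribution Q T]_x (h x)%:E)%E.
  move=> mh h1; rewrite integral_distribution//; first exact/measurable_EFinP.
  by apply: bi => //; exact: measurableT_comp.
have -> : \int[Q]_w (f (V w) * g (W w)) = fine (\int[PV \x PW]_z (F z)%:E)%E.
  congr fine.
  transitivity (\int[PVW]_z (F z)%:E)%E.
    rewrite /PVW integral_distribution//; first exact/measurable_EFinP.
    by apply: bi => //; exact: measurableT_comp.
  apply: eq_measure_integral => A mA _; apply/esym.
  by apply: (product_measure_unique (m' := PVW)) => //; exact: ind.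
rewrite -integral12_prod_meas1/=; last first.
  apply: measurable_bounded_integrable => //.
    have e : ((PV \x PW) ([set: R] `*` [set: R]) = 1)%E.
      transitivity (PV setT * PW setT)%E; first exact: product_measure1E.
      by rewrite !probability_setT mule1.
    by rewrite -setXTT [X in (X < _)%E]e ltry.
  exists 1; split=> // x x1 z _; exact: le_trans (F1 z) (ltW x1).
have iV : \int[Q]_w f (V w) = \int[PV]_x f x by congr fine; exact: tr.
have iW : \int[Q]_w g (W w) = \int[PW]_x g x by congr fine; exact: tr.
rewrite iV iW mulrC -RintegralZl//; last exact: bi.
congr fine; apply: eq_integral => x _ /=.
rewrite /fubini_F mulrC -RintegralZl//; last exact: bi.
rewrite /Rintegral fineK//; apply: integrable_fin_num => //.
under [X in _.-integrable _ X]eq_fun do rewrite EFinM.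
by apply: integrableZl => //; exact: bi.
Qed.

Let bnd (h : Omega -> R) : measurable_fun setT h -> (forall x, `|h x| <= 1) ->
  Q.-integrable setT (EFin \o h).
Proof.
move=> mh h1; apply: (@dominated_integrableR _ _ _ _ _ _ (cst 1)) => //.
exact: finite_measure_integrable_cst.
Qed.

(** The vanishing sine transform of [W] kills the product of sines in the addition formula, which
    makes the real cosine transform multiplicative. *)
Lemma indep_cosD : \int[Q]_w sin (W w) = 0 ->
  \int[Q]_w cos (V w + W w) = \int[Q]_w cos (V w) * \int[Q]_w cos (W w).
Proof.
move=> sW.
under eq_Rintegral do rewrite cosD.
have mc (Y : Omega -> R) : measurable_fun setT Y -> measurable_fun setT (cos \o Y).
  by move=> mY; apply: measurableT_comp => //; exact: measurable_cos.
have ms (Y : Omega -> R) : measurable_fun setT Y -> measurable_fun setT (sin \o Y).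
  by move=> mY; apply: measurableT_comp => //; exact: measurable_sin.
have n1 (x y : R) : `|x| <= 1 -> `|y| <= 1 -> `|x * y| <= 1.
  by move=> x1 y1; rewrite normrM -[leRHS]mulr1 ler_pM.
rewrite RintegralB//; last 2 first.
- apply: bnd; first by apply: measurable_funM; [exact: mc|exact: mc].
  by move=> x; apply: n1; exact: cos_max.
- apply: bnd; first by apply: measurable_funM; [exact: ms|exact: ms].
  by move=> x; apply: n1; exact: sin_max.
rewrite (indep_Rintegral_mul (f := cos) (g := cos)); [|exact: measurable_cos|
  exact: measurable_cos|exact: cos_max|exact: cos_max].
rewrite (indep_Rintegral_mul (f := sin) (g := sin)); [|exact: measurable_sin|
  exact: measurable_sin|exact: sin_max|exact: sin_max].
by rewrite sW mulr0 subr0.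
Qed.

End independence.

Section sigma_measurable.
Context d (Omega : measurableType d) (R : realType).
Implicit Types (P : set_system Omega) (V : Omega -> R).

(** Phrased as measurability on the type carrying the generated sigma-algebra, so that the closure
    lemmas for measurable functions apply to it directly. *)
Definition sigma_measurable P V :=
  @measurable_fun _ _ (g_sigma_algebraType P) R setT V.

Lemma sigma_measurableP P V : sigma_measurable P V <->
  forall U : set R, measurable U -> <<s P >> (V @^-1` U).
Proof.
split=> [mV U mU|mV _ U mU]; last by rewrite setTI; exact: mV.
by have := mV measurableT U mU; rewrite setTI.
Qed.

Lemma sigma_measurableW P P' V : P `<=` P' ->
  sigma_measurable P V -> sigma_measurable P' V.
Proof.
move=> PP' /sigma_measurableP mV; apply/sigma_measurableP => U mU.
by apply: sub_smallest2r (mV U mU) => // ; exact: sub_smallest.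
Qed.

Lemma sigma_measurable_fun P V : P `<=` measurable ->
  sigma_measurable P V -> measurable_fun setT V.
Proof.
move=> Pm /sigma_measurableP mV _ U mU; rewrite setTI.
move: (mV U mU); apply: smallest_sub => //; exact: sigma_algebra_measurable.
Qed.

Lemma preimages_ofS (I : Type) (D D' : set I) (Y : I -> Omega -> R) :
  D `<=` D' -> preimages_of D Y `<=` preimages_of D' Y.
Proof. by move=> DD' A [i Di iA]; exists i => //; exact: DD'. Qed.

Lemma preimages_of_measurable (I : Type) (D : set I) (Y : I -> Omega -> R) :
  (forall i, D i -> measurable_fun setT (Y i)) -> preimages_of D Y `<=` measurable.
Proof. by move=> mY A [i Di [U mU <-]]; exact: mY. Qed.

Lemma sigma_measurable_preimages_of (I : Type) (D : set I) (Y : I -> Omega -> R) i :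
  D i -> sigma_measurable (preimages_of D Y) (Y i).
Proof.
move=> Di; apply/sigma_measurableP => U mU; apply: sub_sigma_algebra.
by exists i => //; exists U => //; rewrite setTI.
Qed.

End sigma_measurable.

(** * Cosine transforms of Brownian increments *)

Section brownian.
Context d (Omega : measurableType d) (R : realType) (Q : probability Omega R).
Variable W : R -> {RV Q >-> R}.
Hypothesis hW : is_brownian_motion W.
Implicit Types (Y : Omega -> R) (a b c : R).

Let P a := preimages_of `[0, a]%classic W.

Lemma brownian_increment_indep a b Y c : 0 <= a -> a < b ->
  sigma_measurable (P a) Y ->
  forall A C, measurable A -> measurable C ->
  Q (Y @^-1` A `&` (fun w => c * (W b w - W a w)) @^-1` C) =
    (Q (Y @^-1` A) * Q ((fun w => (c * (W b w - W a w))%R) @^-1` C))%E.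
Proof.
move=> a0 ab /sigma_measurableP mY A C mA mC.
apply: (bm_indep hW a0 ab); first exact: mY.
apply: sub_sigma_algebra; exists tt => //.
exists ((fun x => c * x) @^-1` C); last by rewrite setTI.
have mc : measurable_fun setT (fun x : R => c * x) by exact: measurable_funM.
by have := mc measurableT C mC; rewrite setTI.
Qed.

Lemma brownian_sigma_measurable a s : 0 <= s -> s <= a ->
  sigma_measurable (P a) (W s).
Proof.
move=> s0 sa; apply: (sigma_measurable_preimages_of (i := s) (Y := W)).
by rewrite /= in_itv/= s0.
Qed.

Lemma brownian_sigmaW a b Y : a <= b -> sigma_measurable (P a) Y ->
  sigma_measurable (P b) Y.
Proof.
move=> ab; apply: sigma_measurableW; apply: preimages_ofS => x/=.
by rewrite !in_itv/= => /andP[-> /le_trans->].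
Qed.

Lemma brownian_sigma_fun a Y : sigma_measurable (P a) Y -> measurable_fun setT Y.
Proof. by apply: sigma_measurable_fun; apply: preimages_of_measurable. Qed.

Let law a b : 0 <= a -> a < b -> forall U, measurable U ->
  Q ((fun w => W b w - W a w) @^-1` U) = normal_prob 0 (Num.sqrt (b - a)) U.
Proof. by move=> a0 ab U mU; exact: (bm_gaussian hW). Qed.

Lemma brownian_cos_step a b Y c : 0 <= a -> a <= b ->
  sigma_measurable (P a) Y ->
  \int[Q]_w cos (Y w + c * (W b w - W a w)) =
  expR (- (c ^+ 2 * (b - a) / 2)) * \int[Q]_w cos (Y w).
Proof.
(* Equal times are treated apart: [bm_gaussian] and [bm_indep] speak only of [s < t]. *)
move=> a0; rewrite le_eqVlt => /predU1P[<- _|ab mY].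
  rewrite subrr mulr0 mul0r oppr0 expR0 mul1r.
  by apply: eq_Rintegral => w _; rewrite subrr mulr0 addr0.
have mG : measurable_fun setT (fun w => W b w - W a w) by exact: measurable_funB.
have s0 : 0 < Num.sqrt (b - a) by rewrite sqrtr_gt0 subr_gt0.
rewrite (indep_cosD (Q := Q) (V := Y) (W := fun w => c * (W b w - W a w))).
- rewrite (gaussian_cos mG s0 (law a0 ab)) sqr_sqrtr; last by rewrite subr_ge0 ltW.
  by rewrite mulrC.
- exact: brownian_sigma_fun mY.
- exact: measurable_funM.
- exact: brownian_increment_indep.
- exact: (gaussian_sin mG s0 (law a0 ab)).
Qed.

Lemma brownian_abs a b : 0 <= a -> a <= b ->
  (\int[Q]_w `|W b w - W a w|%:E <= (2 * Num.sqrt (b - a))%:E)%E.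
Proof.
move=> a0; rewrite le_eqVlt => /predU1P[<-|ab].
  under eq_integral do rewrite subrr normr0.
  by rewrite integral0 subrr sqrtr0 mulr0.
have mG : measurable_fun setT (fun w => W b w - W a w) by exact: measurable_funB.
have s0 : 0 < Num.sqrt (b - a) by rewrite sqrtr_gt0 subr_gt0.
exact: (gaussian_abs mG s0 (law a0 ab)).
Qed.

(** Each increment is independent of everything before it and contributes one Gaussian factor. The
    measurability of the partial sum is carried through the induction because it is what the next
    increment requires. *)
Lemma brownian_cos_sum (u : nat -> R) (c : nat -> R) n Y :
  0 <= u 0%N -> (forall k, u k <= u k.+1) -> sigma_measurable (P (u 0%N)) Y ->
  let S w := Y w + \sum_(k < n) c k * (W (u k.+1) w - W (u k) w) in
  sigma_measurable (P (u n)) S /\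
  \int[Q]_w cos (S w) =
    expR (- ((\sum_(k < n) c k ^+ 2 * (u k.+1 - u k)) / 2)) * \int[Q]_w cos (Y w).
Proof.
move=> u0 undec mY; have un k : 0 <= u k.
  by elim: k => // k IH; exact: le_trans (undec k).
elim: n => [|n [mS IH]] S.
  have SY : S = Y by apply/funext => w; rewrite /S big_ord0 addr0.
  by rewrite SY big_ord0 mul0r oppr0 expR0 mul1r.
have SE : S = (fun w => (Y w + \sum_(k < n) c k * (W (u k.+1) w - W (u k) w))
    + c n * (W (u n.+1) w - W (u n) w)).
  by apply/funext => w; rewrite /S big_ord_recr/= addrA.
split.
  rewrite SE; apply: measurable_funD; first exact: brownian_sigmaW mS.
  apply: measurable_funM => //; apply: measurable_funB.
    exact: brownian_sigma_measurable.
  exact: brownian_sigma_measurable.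
rewrite SE brownian_cos_step// IH big_ord_recr/= mulrA -expRD.
by congr (expR _ * _); field.
Qed.

(* [Var (\sum_j l_j (W s_j - W a))] for [a <= s_1 <= s_2 <= ...]. *)
Fixpoint brownian_var a (s : seq (R * R)) : R :=
  if s is p :: s' then
    (p.2 + \sum_(x <- s') x.2) ^+ 2 * (p.1 - a) + brownian_var p.1 s'
  else 0.

(** The variance of a sum, where the covariance of [W s_j - W a] with the last increment [W t - W a]
    is [s_j - a]. As an identity of polynomials it holds for unordered times too. *)
Lemma brownian_var_rcons a (s : seq (R * R)) t e :
  brownian_var a (rcons s (t, e)) = brownian_var a s +
    2 * e * (\sum_(x <- s) x.2 * (x.1 - a)) + e ^+ 2 * (t - a).
Proof.
elim: s a => [|[r l] s IH] a /=.
  by rewrite !big_nil; ring.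
rewrite IH -cats1 big_cat big_seq1/= !big_cons/=.
have -> : \sum_(x <- s) x.2 * (x.1 - a) =
    \sum_(x <- s) x.2 * (x.1 - r) + (\sum_(x <- s) x.2) * (r - a).
  by rewrite mulr_suml -big_split/=; apply: eq_bigr => x _; ring.
ring.
Qed.

(** Summation by parts: the increment from [a] to the first time [r] carries the total weight [L] of
    all terms. It is absorbed into [Y], and the remaining sum starts afresh from [r]. *)
Lemma brownian_cos_seq (s : seq (R * R)) a Y : 0 <= a ->
  path <=%O a (map fst s) -> sigma_measurable (P a) Y ->
  \int[Q]_w cos (Y w + \sum_(x <- s) x.2 * (W x.1 w - W a w)) =
  expR (- (brownian_var a s / 2)) * \int[Q]_w cos (Y w).
Proof.
elim: s a Y => [|[r l] s IH] a Y a0 /=.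
  move=> _ _; rewrite mul0r oppr0 expR0 mul1r.
  by apply: eq_Rintegral => w _; rewrite big_nil addr0.
move=> /andP[ar rs] mY.
pose L := l + \sum_(x <- s) x.2.
have mY' : sigma_measurable (P r) (fun w => Y w + L * (W r w - W a w)).
  apply: measurable_funD; first exact: brownian_sigmaW mY.
  apply: measurable_funM => //; apply: measurable_funB.
    by apply: brownian_sigma_measurable => //; exact: le_trans ar.
  exact: brownian_sigma_measurable.
transitivity (\int[Q]_w cos ((Y w + L * (W r w - W a w)) +
    \sum_(x <- s) x.2 * (W x.1 w - W r w))).
  apply: eq_Rintegral => w _; congr cos; rewrite big_cons/= -!addrA; congr (_ + _).
  rewrite /L mulrDl -addrA; congr (_ + _).
  by rewrite mulr_suml -big_split/=; apply: eq_bigr => x _; ring.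
rewrite IH//; last exact: le_trans ar.
rewrite brownian_cos_step// mulrA -expRD -/L.
by congr (expR _ * _); field.
Qed.

End brownian.

(** * Uniqueness for trigonometric transforms *)

Section steep_powers.
Context {R : realType}.
Implicit Types x h : R.

Lemma bernoulli_pow x m : 0 <= x <= 1 -> 1 - m%:R * x <= (1 - x) ^+ m.
Proof.
move=> /andP[x0 x1]; elim: m => [|m IH]; first by rewrite mul0r subr0 expr0.
rewrite exprS; apply: (@le_trans _ _ ((1 - x) * (1 - m%:R * x))); last first.
  by rewrite ler_wpM2l// subr_ge0.
have m0 : 0 <= m%:R * x ^+ 2 by rewrite mulr_ge0// sqr_ge0.
by rewrite -subr_ge0 -natr1; have -> : (1 - x) * (1 - m%:R * x) -
  (1 - (m%:R + 1) * x) = m%:R * x ^+ 2 by ring.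
Qed.

Lemma pow_le_expR h n : 0 <= 1 - h -> (1 - h) ^+ n <= expR (- (n%:R * h)).
Proof.
move=> h1; rewrite -mulrN expRM_natl lerXn2r ?nnegrE ?expR_ge0//.
exact: expR_ge1Dx.
Qed.

Lemma cvg_harmonicM (c : R) : c / n%:R @[n --> \oo] --> (0:R).
Proof.
rewrite -(cvg_shiftS (fun n => c / n%:R)); apply: (cvg_eq (mulr0 c)).
by apply: cvgMr; exact: cvg_harmonic.
Qed.

(* The exponent carries the factor [n] so that the limit at the threshold
   [x = 1/2] is also [0]. *)
Lemma cvg_steep_powers x : 0 <= x <= 1 ->
  (1 - x ^+ n) ^+ (n * 2 ^ n) @[n --> \oo] --> (if x < 2^-1 then 1 else 0 : R).
Proof.
move=> /andP[x0 x1].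
have xn n : 0 <= x ^+ n <= 1 by rewrite exprn_ge0// exprn_ile1.
have p0 n : 0 <= 1 - x ^+ n by rewrite subr_ge0; case/andP: (xn n).
case: ltP => x2.
  pose h := 1 - 2 * x; have h0 : 0 < h by rewrite /h; lra.
  (* With [2 * x = 1 - h], the power is at most [expR (- (n * h))], and [expR (n * h) >= (1 + n * h
     / 2) ^+ 2 >= n ^+ 2 * h ^+ 2 / 4]; this is the origin of [4 / h ^+ 2]. *)
  have key n : (n%:R * (2 * x) ^+ n) <= (4 / h ^+ 2) / n%:R.
    have [->|n0] := posnP n; first by rewrite mul0r invr0 mulr0.
    have nR : 0 < n%:R :> R by rewrite ltr0n.
    have -> : 2 * x = 1 - h by rewrite /h; lra.
    rewrite ler_pdivlMr// mulrC mulrA -expr2.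
    apply: (@le_trans _ _ (n%:R ^+ 2 * expR (- (n%:R * h)))).
      by rewrite ler_wpM2l ?sqr_ge0// pow_le_expR// /h; lra.
    rewrite expRN ler_pdivrMr ?expR_gt0// mulrC.
    have -> : n%:R * h = 2%:R * (n%:R * h / 2) by field.
    rewrite expRM_natl.
    apply: (@le_trans _ _ ((1 + n%:R * h / 2) ^+ 2 * (4 / h ^+ 2))); last first.
      rewrite ler_wpM2r//; first by rewrite divr_ge0// sqr_ge0.
      rewrite lerXn2r ?nnegrE ?expR_ge0 ?expR_ge1Dx//.
      by rewrite addr_ge0// divr_ge0// mulr_ge0// ltW.
    rewrite -subr_ge0.
    have -> : (1 + n%:R * h / 2) ^+ 2 * (4 / h ^+ 2) - n%:R ^+ 2 =
       4 / h ^+ 2 * (1 + n%:R * h) by field; rewrite gt_eqF.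
    by rewrite mulr_ge0 ?divr_ge0 ?sqr_ge0// addr_ge0// mulr_ge0// ltW.
  apply: (@squeeze_cvgr _ _ _ _ (fun n => 1 - (4 / h ^+ 2) / n%:R) (cst 1)).
  - apply: nearW => n; apply/andP; split; last first.
      rewrite exprn_ile1// ; case/andP: (xn n) => ? ?; lra.
    apply: le_trans (bernoulli_pow _ (xn n)).
    rewrite lerD2l lerN2; apply: le_trans (key n).
    by rewrite natrM natrX -mulrA -exprMn.
  - apply: (cvg_eq (subr0 1)); apply: cvgB; first exact: cvg_cst.
    exact: cvg_harmonicM.
  - exact: cvg_cst.
(* At or above the threshold [2 * x >= 1], so the power is at most [expR (- (n * (2 * x) ^+ n)) <=
   expR (- n) <= 1 / n]. *)
apply: (@squeeze_cvgr _ _ _ _ (cst 0) (fun n => 1 / n%:R)).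
- near=> n; rewrite exprn_ge0//=.
  have n0 : 0 < n%:R :> R by rewrite ltr0n; near: n; exact: nbhs_infty_gt.
  apply: (le_trans (pow_le_expR _ (p0 n))).
  rewrite expRN div1r lef_pV2 ?posrE ?expR_gt0//.
  apply: (@le_trans _ _ (expR n%:R)).
    by apply: le_trans (expR_ge1Dx _); rewrite lerDr.
  rewrite ler_expR natrM natrX -mulrA -exprMn ler_peMr//.
  by apply: exprn_ege1; lra.
- exact: cvg_cst.
- exact: (cvg_harmonicM 1).
Unshelve. all: by end_near. Qed.

End steep_powers.

Section trig_uniqueness.
Context d (T : measurableType d) (R : realType) (mu : {measure set T -> \bar R}).
Variables (K Y : T -> R).
Hypothesis iK : mu.-integrable setT (EFin \o K).
Hypothesis mY : measurable_fun setT Y.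

Let I (h : R -> R) := \int[mu]_w (K w * h (Y w)).

Let mK : measurable_fun setT K.
Proof. exact/measurable_EFinP/(measurable_int _ iK). Qed.

Let integrableI (h : R -> R) : measurable_fun setT h -> (forall x, `|h x| <= 1) ->
  mu.-integrable setT (EFin \o (fun w => K w * h (Y w))).
Proof.
move=> mh h1; apply: (@dominated_integrableR _ _ _ _ _ _ (fun w => `|K w|)) => //.
- by apply: measurable_funM => //; exact: measurableT_comp.
- exact: integrable_norm.
- by move=> w _; rewrite normrM ler_piMr.
Qed.

Let cvgI (h_ : (R -> R)^nat) (h : R -> R) : (forall n, measurable_fun setT (h_ n)) ->
  measurable_fun setT h -> (forall n x, `|h_ n x| <= 1) ->
  (forall x, h_ ^~ x @ \oo --> h x) -> I (h_ n) @[n --> \oo] --> I h.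
Proof.
move=> mh_ mh h1 hh.
apply: (@Rintegral_dominated_cvg _ _ _ _ _ _ _ (fun w => `|K w|)) => //.
- by move=> n; apply: measurable_funM => //; exact: measurableT_comp.
- by apply: measurable_funM => //; exact: measurableT_comp.
- by apply: aeW => w _; apply: cvgMr; exact: hh.
- exact: integrable_norm.
- by apply: aeW => w _ n; rewrite normrM ler_piMr.
Qed.

Hypothesis I0 : forall l p, \int[mu]_w (K w * cos (l * Y w + p)) = 0.

(** The factors that leave [K] orthogonal to every phase in [Y]. Demanding all frequencies at once
    makes the class stable under multiplication by a sine, which merely shifts frequencies; the
    range [[0, 1]] supplies integrability and domination. *)
Let trig0 (g : R -> R) := [/\ measurable_fun setT g, forall x, 0 <= g x <= 1 &
  forall l p, I (fun x => g x * cos (l * x + p)) = 0].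

Let mcos (l p : R) : measurable_fun setT (fun x : R => cos (l * x + p)).
Proof.
apply: measurableT_comp; first exact: measurable_cos.
by apply: measurable_funD => //; exact: measurable_funM.
Qed.

Let b1 (x y : R) : 0 <= x <= 1 -> `|y| <= 1 -> `|x * y| <= 1.
Proof.
by move=> /andP[x0 x1] y1; rewrite normrM -[leRHS]mulr1 ler_pM// ger0_norm.
Qed.

Let II (g : R -> R) : trig0 g -> forall l p, mu.-integrable setT
  (EFin \o (fun w => K w * (g (Y w) * cos (l * Y w + p)))).
Proof.
move=> [mg g01 _] l p.
apply: (integrableI (h := fun x => g x * cos (l * x + p))).
  exact: measurable_funM.
by move=> x; apply: b1 => //; exact: cos_max.
Qed.

Let trig01 : trig0 (cst 1).
Proof.
split => [//|x|l p]; first by rewrite ler01 lexx.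
by rewrite -(I0 l p); apply: eq_Rintegral => w _; rewrite mul1r.
Qed.

Section threshold.
Variables del y : R.
Let f (x : R) := (1 + sin (del * (x - y))) / 2.

Let mf : measurable_fun setT f.
Proof.
apply: measurable_funM => //; apply: measurable_funD => //.
apply: measurableT_comp; first exact: measurable_sin.
by apply: measurable_funM => //; exact: measurable_funB.
Qed.

Let f01 x : 0 <= f x <= 1.
Proof.
have := sin_geN1 (del * (x - y)); have := sin_le1 (del * (x - y)).
by rewrite /f => *; apply/andP; split; lra.
Qed.

Let trig0f g : trig0 g -> trig0 (fun x => g x * f x).
Proof.
move=> tg; have [mg g01 gI] := tg; split.
- exact: measurable_funM.
- move=> x; have /andP[g0 g1] := g01 x; have /andP[f0 f1] := f01 x.
  by rewrite mulr_ge0//= -[leRHS]mulr1 ler_pM.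
move=> l p.
(* Product to sum: the frequency [l] becomes [l + del] and [del - l], and the shift by [pi / 2]
   rewrites the resulting sines as cosines. *)
have E x : g x * f x * cos (l * x + p) = 2^-1 * (g x * cos (l * x + p)) +
    (4^-1 * (g x * cos ((l + del) * x + (p - del * y - pi / 2))) +
     4^-1 * (g x * cos ((del - l) * x + (- p - del * y - pi / 2)))).
  have -> : (l + del) * x + (p - del * y - pi / 2) =
    (del * (x - y) + (l * x + p)) - pi / 2 by ring.
  have -> : (del - l) * x + (- p - del * y - pi / 2) =
    (del * (x - y) - (l * x + p)) - pi / 2 by ring.
  rewrite /f; move: (del * (x - y)) (l * x + p) => u v.
  by rewrite !cosB sinB sinD cos_pihalf sin_pihalf; field.
transitivity (\int[mu]_w (2^-1 * (K w * (g (Y w) * cos (l * Y w + p))) +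
   (4^-1 * (K w * (g (Y w) * cos ((l + del) * Y w + (p - del * y - pi / 2)))) +
    4^-1 * (K w * (g (Y w) * cos ((del - l) * Y w + (- p - del * y - pi / 2))))))).
  by apply: eq_Rintegral => w _; rewrite E; ring.
have iZ (c : R) l' p' : mu.-integrable setT
    (EFin \o (fun w => c * (K w * (g (Y w) * cos (l' * Y w + p'))))).
  under [X in _.-integrable _ X]eq_fun do rewrite /= EFinM.
  by apply: integrableZl => //; exact: II.
rewrite RintegralD//; last first.
  under [X in _.-integrable _ X]eq_fun do rewrite /= EFinD.
  by apply: integrableD => //; exact: iZ.
rewrite RintegralD// !RintegralZl//; try exact: II.
by move: gI; rewrite /I => gI; rewrite !gI !mulr0 !addr0.
Qed.

Let trig0fX g n : trig0 g -> trig0 (fun x => g x * f x ^+ n).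
Proof.
elim: n g => [|n IH] g tg.
  by under eq_fun do rewrite expr0 mulr1.
under eq_fun do rewrite exprS mulrA.
exact/IH/trig0f.
Qed.

Let trig0B g n : trig0 g -> trig0 (fun x => g x * (1 - f x ^+ n)).
Proof.
move=> tg; have [mg g01 gI] := tg.
have tgf := trig0fX n tg; have [mgf gf01 gfI] := tgf.
split.
- apply: measurable_funM => //; apply: measurable_funB => //.
  exact: measurable_funX.
- move=> x; have /andP[g0 g1] := g01 x; have /andP[f0 f1] := f01 x.
  have fn : 0 <= f x ^+ n <= 1 by rewrite exprn_ge0// exprn_ile1.
  case/andP: fn => ? ?.
  by rewrite mulr_ge0//= ?subr_ge0// -[leRHS]mulr1 ler_pM// ?subr_ge0//; lra.
move=> l p.
transitivity (\int[mu]_w (K w * (g (Y w) * cos (l * Y w + p)) -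
    K w * (g (Y w) * f (Y w) ^+ n * cos (l * Y w + p)))).
  by apply: eq_Rintegral => w _; ring.
rewrite RintegralB//; try exact: II.
  by move: gI gfI; rewrite /I => gI gfI; rewrite gI gfI subr0.
exact: (II tgf).
Qed.

Let trig0BX n m : trig0 (fun x => (1 - f x ^+ n) ^+ m).
Proof.
elim: m => [|m IH].
  by under eq_fun do rewrite expr0; exact: trig01.
under eq_fun do rewrite exprSr.
exact: trig0B.
Qed.

(** The sine is negative exactly where [f < 1/2], so the steep powers of [f] tend to this indicator,
    dominated by [|K|]. Each of them lies in the class [trig0], used here at frequency and phase
    0. *)
Lemma trig_threshold0 :
  \int[mu]_w (K w * (if sin (del * (Y w - y)) < 0 then 1 else 0)) = 0.
Proof.
pose h x : R := if sin (del * (x - y)) < 0 then 1 else 0.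
have hE x : h x = if f x < 2^-1 then 1 else 0.
  by rewrite /h /f; congr (if _ then _ else _); apply/idP/idP => ?; lra.
have mh : measurable_fun setT h.
  apply: measurable_fun_ifT => //; apply: measurable_fun_ltr => //.
  apply: measurableT_comp; first exact: measurable_sin.
  by apply: measurable_funM => //; exact: measurable_funB.
pose h_ n x := (1 - f x ^+ n) ^+ (n * 2 ^ n).
have t_ n := trig0BX n (n * 2 ^ n).
have lim : I (h_ n) @[n --> \oo] --> I h.
  apply: cvgI => //.
  - by move=> n; have [] := t_ n.
  - move=> n x; have [_ /(_ x)/andP[? ?] _] := t_ n.
    by rewrite ger0_norm.
  - by move=> x; rewrite hE; exact: cvg_steep_powers.
apply: (cvg_unique _ lim) => //; apply: cvg_near_cst; apply: nearW => n.
have [_ _ /(_ 0 0)] := t_ n.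
by rewrite /I; under eq_Rintegral do rewrite mul0r addr0 cos0 mulr1.
Qed.

End threshold.

(** Let the frequency [1 / n.+1] tend to 0: as soon as [|x - y| / n.+1 < pi], the sign of the sine
    is the sign of [x - y]. *)
Lemma trig_halfline0 y : \int[mu]_w (K w * \1_(`]-oo, y[) (Y w)) = 0.
Proof.
pose h_ n x : R := if sin (n.+1%:R^-1 * (x - y)) < 0 then 1 else 0.
have lim : I (h_ n) @[n --> \oo] --> I (\1_(`]-oo, y[)).
  apply: cvgI => //.
  - move=> n; apply: measurable_fun_ifT => //; apply: measurable_fun_ltr => //.
    apply: measurableT_comp; first exact: measurable_sin.
    by apply: measurable_funM => //; exact: measurable_funB.
  - by move=> n x; rewrite /h_; case: ifPn => _; rewrite ?normr1 ?normr0.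
  - move=> x; apply: cvg_near_cst; near=> n.
    have nx : `|x - y| / n.+1%:R < pi.
      rewrite ltr_pdivrMr// mulrC -ltr_pdivrMr ?pi_gt0//.
      apply: (@lt_trans _ _ n%:R); last by rewrite ltr_nat.
      by near: n; exact: nbhs_infty_gtr.
    rewrite /h_ indicE mem_setE in_itv/=.
    case: (ltP x y) => xy.
      rewrite (_ : _ * _ = - ((y - x) / n.+1%:R)); last by rewrite mulrC -mulNr opprB.
      rewrite sinN oppr_lt0 sin_gt0_pi//.
      rewrite divr_gt0 ?subr_gt0//=.
      by rewrite distrC ger0_norm// ?subr_ge0 ?ltW in nx.
    rewrite ltNge sin_ge0_pi// mulr_ge0 ?subr_ge0//=.
    by move: nx; rewrite ger0_norm ?subr_ge0// mulrC => /ltW.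
apply: (cvg_unique _ lim) => //; apply: cvg_near_cst; apply: nearW => n.
exact: trig_threshold0.
Unshelve. all: by end_near. Qed.

(** Open left half-lines are stable under intersection and generate the Borel sets, while the sets
    with vanishing integral form a lambda-system. *)
Lemma trig_uniqueness (U : set R) : measurable U ->
  \int[mu]_w (K w * \1_U (Y w)) = 0.
Proof.
pose G := [set A | exists x : R, A = `]-oo, x[%classic].
pose H := [set A : set R | measurable A /\ I \1_A = 0].
have idx1 (A : set R) x : `|\1_A x : R| <= 1.
  by rewrite indicE; case: (x \in A); rewrite ?normr1 ?normr0.
have HT : H setT.
  split=> //; rewrite /I; under eq_Rintegral do rewrite indicT.
  by rewrite -(I0 0 0); apply: eq_Rintegral => w _; rewrite mul0r addr0 cos0.
have GI : setI_closed G.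
  move=> _ _ [x ->] [y ->]; exists (Num.min x y); apply/seteqP; split => z/=.
    by rewrite !in_itv/= lt_min => -[-> ->].
  by rewrite !in_itv/= lt_min => /andP[-> ->].
have LH : lambda_system setT H.
  split => //.
  - move=> A B BA [mA A0] [mB B0]; split; first exact: measurableD.
    have -> : I \1_(A `\` B) = \int[mu]_w (K w * \1_A (Y w) - K w * \1_B (Y w)).
      apply: eq_Rintegral => w _; rewrite -mulrBr; congr (_ * _).
      rewrite !indicE in_setD; case: (boolP (Y w \in B)) => YB /=.
        by rewrite andbF (mem_set (BA _ (set_mem YB))) subrr.
      by rewrite andbT subr0.
    rewrite RintegralB//; [|exact: integrableI..].
    by move: A0 B0; rewrite /I => -> ->; rewrite subr0.
  - move=> F ndF HF; split.
      by apply: bigcup_measurable => k _; have [] := HF k.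
    have mF k : measurable (F k) by have [] := HF k.
    have lim : I \1_(F n) @[n --> \oo] --> I (\1_(\bigcup_n F n)).
      apply: cvgI => //.
      - by apply: measurable_indic; exact: bigcup_measurable.
      - move=> x; apply: cvg_near_cst; have [[k _ Fkx]|nF] := pselect ((\bigcup_n F n) x).
          near=> n; rewrite !indicE !mem_set//; first by exists k.
          have kn : (k <= n)%N by near: n; exists k.
          by move/subsetPset : (ndF _ _ kn); exact.
        by apply: nearW => n; rewrite !indicE !memNset// => Fnx; apply: nF; exists n.
    apply: (cvg_unique _ lim) => //; apply: cvg_near_cst; apply: nearW => n.
    by have [] := HF n.
have GH : G `<=` H by move=> _ [x ->]; split => //; exact: trig_halfline0.
move=> mU.
have sU : <<s setT, G>> U.
  have : (@measurable _ (measurableTypeR R)) U by [].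
  by rewrite RGenInftyO.measurableE.
suff /(_ U sU)[] : <<s setT, G>> `<=` H by [].
apply: lambda_system_subset => //.
Unshelve. all: by end_near. Qed.

End trig_uniqueness.

(** * Conditional expectations *)

Section cylinders.
Context d (T : measurableType d) (R : realType) (Q : {measure set T -> \bar R}).
Context (I : Type) (D : pred I) (Y : I -> T -> R) (N : T -> R).
Hypothesis iN : Q.-integrable setT (EFin \o N).
Hypothesis mY : forall i, D i -> measurable_fun setT (Y i).

Let phase (S : seq (I * R)) (p : R) (w : T) := \sum_(x <- S) x.2 * Y x.1 w + p.

Let inD (U : Type) (S : seq (I * U)) := all (fun x => D x.1) S.

Hypothesis cosN0 : forall (S : seq (I * R)) p, inD S ->
  \int[Q]_w (N w * cos (phase S p w)) = 0.

Let box (C : seq (I * set R)) (w : T) : R := \prod_(x <- C) \1_(x.2) (Y x.1 w).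

Let mC (C : seq (I * set R)) := forall i, (i < size C)%N ->
  measurable (nth setT (map snd C) i).

Let mbox C : inD C -> mC C -> measurable_fun setT (box C).
Proof.
elim: C => [|[i U] C IH] /=.
  move=> _ _; have -> : box [::] = cst 1; last exact: measurable_cst.
  by apply/funext => w; rewrite /box big_nil.
move=> /andP[Di DC] mU.
have -> : box ((i, U) :: C) = (fun w => \1_U (Y i w) * box C w).
  by apply/funext => w; rewrite /box big_cons.
apply: measurable_funM.
  apply: measurableT_comp; last exact: mY.
  by apply: measurable_indic; exact: (mU 0%N).
by apply: IH => // k kC; exact: (mU k.+1).
Qed.

Let box01 C w : `|box C w| <= 1.
Proof.
rewrite /box; elim: C => [|[i U] C IH]; first by rewrite big_nil normr1.
rewrite big_cons normrM -[leRHS]mulr1 ler_pM//.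
by rewrite indicE; case: (_ \in _); rewrite ?normr1 ?normr0.
Qed.

Let mphase S p : inD S -> measurable_fun setT (phase S p).
Proof.
move=> DS; apply: measurable_funD => //; move: DS.
elim: S => [|[i l] S IH] /=; first by move=> _; under eq_fun do rewrite big_nil; exact: measurable_cst.
move=> /andP[Di DS]; under eq_fun do rewrite big_cons/=.
by apply: measurable_funD; [apply: measurable_funM => //; exact: mY|exact: IH].
Qed.

Let mN : measurable_fun setT N.
Proof. exact/measurable_EFinP/(measurable_int _ iN). Qed.

Let iNbox C S p : inD C -> mC C -> inD S ->
  Q.-integrable setT (EFin \o (fun w => N w * box C w * cos (phase S p w))).
Proof.
move=> DC mmC DS.
apply: (@dominated_integrableR _ _ _ _ _ _ (fun w => `|N w|)) => //.
- apply: measurable_funM; first by apply: measurable_funM => //; exact: mbox.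
  by apply: measurableT_comp; [exact: measurable_cos|exact: mphase].
- exact: integrable_norm.
- move=> w _; rewrite !normrM -mulrA ler_piMr// -[leRHS]mulr1 ler_pM//.
  exact: cos_max.
Qed.

(** Observations pass from the phase into the box one at a time. [trig_uniqueness] is applied to
    [Y i] with the box of the remaining ones as part of the weight; its hypothesis is the induction
    hypothesis for the phases enlarged by [(i, l)] and [(i, - l)], which is why [S] and [p] are
    general. *)
Let box_cos0 C S p : inD C -> mC C -> inD S ->
  \int[Q]_w (N w * box C w * cos (phase S p w)) = 0.
Proof.
elim: C S p => [|[i U] C IH] S p /=.
  move=> _ _ DS; rewrite -(cosN0 p DS); apply: eq_Rintegral => w _.
  by rewrite /box big_nil mulr1.
move=> /andP[Di DC] mUC DS.
have mU : measurable U by exact: (mUC 0%N).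
have mmC : mC C by move=> k kC; exact: (mUC k.+1).
rewrite -[RHS](@trig_uniqueness _ _ _ Q (fun w => N w * box C w * cos (phase S p w))
    (Y i) _ _ _ U)//.
- by apply: eq_Rintegral => w _; rewrite /box big_cons/=; ring.
- exact: iNbox.
- exact: mY.
move=> l q.
transitivity (\int[Q]_w (2^-1 * (N w * box C w * cos (phase ((i, l) :: S) (p + q) w)) +
    2^-1 * (N w * box C w * cos (phase ((i, - l) :: S) (p - q) w)))).
  apply: eq_Rintegral => w _; rewrite /phase !big_cons/=.
  move: (\sum_(j <- S) _) => s.
  have -> : l * Y i w + s + (p + q) = (s + p) + (l * Y i w + q) by ring.
  have -> : - l * Y i w + s + (p - q) = (s + p) - (l * Y i w + q) by ring.
  by rewrite [X in 2^-1 * (_ * X) + _]cosD [X in _ + 2^-1 * (_ * X)]cosB; field.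
have iZ l' q' : Q.-integrable setT (EFin \o (fun w =>
    2^-1 * (N w * box C w * cos (phase ((i, l') :: S) q' w)))).
  under [X in _.-integrable _ X]eq_fun do rewrite /= EFinM.
  apply: integrableZl => //; apply: iNbox => //; exact/andP.
have i0 l' : inD ((i, l') :: S) by exact/andP.
rewrite RintegralD// !RintegralZl//; try exact: iNbox.
by rewrite !IH// mulr0 addr0.
Qed.

Let Gen := [set A | exists2 i, D i & exists2 U, measurable U & Y i @^-1` U = A].

Lemma integral_sigma_eq0 A : <<s Gen >> A -> \int[Q]_(w in A) N w = 0.
Proof.
pose H := [set A : set T | measurable A /\ \int[Q]_(w in A) N w = 0].
(* A cylinder is the set where a product of indicators equals 1, so an intersection of cylinders is
   a concatenation of lists. *)
pose Cyl := [set A | exists C, [/\ inD C, mC C & A = [set w | box C w = 1]]].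
have box_dich C w : box C w = 0 \/ box C w = 1.
  rewrite /box; elim: C => [|[i U] C IH]; first by rewrite big_nil; right.
  rewrite big_cons/= indicE; case: (_ \in _); last by left; rewrite mul0r.
  by rewrite mul1r.
have boxE C : [set w | box C w = 1] = box C @^-1` [set 1] by [].
have mcyl C : inD C -> mC C -> measurable [set w | box C w = 1].
  by move=> DC mmC; rewrite boxE -[X in measurable X]setTI; apply: mbox.
have CylI : setI_closed Cyl.
  move=> _ _ [C [DC mmC ->]] [C' [DC' mmC' ->]]; exists (C ++ C'); split.
  - by rewrite /inD all_cat; exact/andP.
  - move=> k; rewrite size_cat map_cat nth_cat size_map => kCC; case: ltnP => kC.
      exact: (mmC _ kC).
    by apply: mmC'; rewrite ltn_subLR.
  - apply/seteqP; split => w /=; rewrite /box big_cat/= -/(box C w) -/(box C' w).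
      by move=> [-> ->]; rewrite mulr1.
    by have [->|->] := box_dich C w; have [->|->] := box_dich C' w;
      rewrite ?mulr0 ?mul0r// => /eqP; rewrite eq_sym oner_eq0.
have cylH : Cyl `<=` H.
  move=> _ [C [DC mmC ->]]; split; first exact: mcyl.
  rewrite -[RHS](box_cos0 0 DC mmC (S := [::]))// Rintegral_mkcond.
  apply: eq_Rintegral => w _; rewrite /phase big_nil addr0 cos0 mulr1 patchE.
  have [b0|b1] := box_dich C w.
    by rewrite memNset ?b0 ?mulr0//= b0 => /eqP; rewrite eq_sym oner_eq0.
  by rewrite mem_set//= b1 mulr1.
have LH : lambda_system setT H.
  split => //.
  - split=> //; have := box_cos0 0 (C := [::]) (S := [::]) isT _ isT.
    move=> <-//; apply: eq_Rintegral => w _.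
    by rewrite /phase /box !big_nil addr0 cos0 !mulr1.
  - move=> A1 A2 A21 [mA1 A10] [mA2 A20]; split; first exact: measurableD.
    have := Rintegral_setU (mu := Q) (f := N) (A := A2) (B := A1 `\` A2) mA2
       (measurableD mA1 mA2).
    rewrite setDUK// A10 A20 add0r => <-//.
      exact: integrableS iN.
    by apply/disj_setPS => x [? []].
  - move=> F ndF HF; have mF k : measurable (F k) by have [] := HF k.
    have mUF : measurable (\bigcup_n F n) by exact: bigcup_measurable.
    split => //.
    have lim : \int[Q]_(w in F n) N w @[n --> \oo] --> \int[Q]_(w in \bigcup_n F n) N w.
      apply: Rintegral_exhaust_cvg => //.
      - by move=> n x Fx; exists n.
      - move=> x [k _ Fkx]; near=> n.
        have kn : (k <= n)%N by near: n; exact: nbhs_infty_ge.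
        by move/subsetPset : (ndF _ _ kn); exact.
      - exact: integrableS iN.
    apply: (cvg_unique _ lim) => //; apply: cvg_near_cst; apply: nearW => n.
    by have [] := HF n.
have GC : Gen `<=` Cyl.
  move=> _ [i Di [U mU <-]]; exists [:: (i, U)]; split.
  - by rewrite /inD/= Di.
  - by case.
  - apply/seteqP; split => w /=; rewrite /box big_seq1/= indicE.
      by move=> Uw; rewrite mem_set.
    by case: (boolP (_ \in _)) => [/set_mem//|_ /eqP]; rewrite eq_sym oner_eq0.
move=> sA.
have sC : <<s Cyl >> A.
  by apply: sub_smallest2r sA => //; exact: smallest_sigma_algebra.
suff sub : <<s setT, Cyl >> `<=` H by have [] := sub _ sC.
by apply: lambda_system_subset => //.
Unshelve. all: by end_near. Qed.

End cylinders.

Section cond_exp_unique.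
Context d (Omega : measurableType d) (R : realType) (Q : probability Omega R).

(** The set where [V' < V] belongs to the sigma-algebra, so [V - V'] has integral zero on it; being
    positive there, it forces the set to be null. *)
Let half (P : set_system Omega) Z V V' : is_cond_exp Q <<s P >> Z V ->
  is_cond_exp Q <<s P >> Z V' -> {ae Q, forall w, V w <= V' w}.
Proof.
move=> [_ iV mV eV] [_ iV' mV' eV'].
have sV : sigma_measurable P V by apply/sigma_measurableP.
have sV' : sigma_measurable P V' by apply/sigma_measurableP.
pose A := [set w | V' w < V w].
have AE : A = (fun w => V' w < V w) @^-1` [set true] by [].
have PA : <<s P >> A.
  have := measurable_fun_ltr sV' sV measurableT (Y := [set true]) I.
  by rewrite setTI.
have m1 : measurable_fun setT V by exact/measurable_EFinP/(measurable_int _ iV).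
have m2 : measurable_fun setT V' by exact/measurable_EFinP/(measurable_int _ iV').
have mA : measurable A.
  by rewrite -[X in measurable X]setTI; exact: (measurable_fun_ltr m2 m1 measurableT (Y := [set true]) I).
have iA : Q.-integrable A (EFin \o V) by exact: integrableS iV.
have iA' : Q.-integrable A (EFin \o V') by exact: integrableS iV'.
have e0 : (\int[Q]_(w in A) (V w - V' w)%:E = 0)%E.
  under eq_integral do rewrite EFinB.
  rewrite integralB// [X in (X - _)%E]eV// [X in (_ - X)%E]eV'// subee//.
  by rewrite -eV//; exact: integrable_fin_num.
have mD : measurable_fun A (EFin \o (fun w => V w - V' w)).
  by apply/measurable_EFinP; apply: measurable_funB; exact: measurable_funTS.
have : ae_eq Q A (EFin \o (fun w => V w - V' w)) (cst 0%E).
  apply/(ae_eq_integral_abs Q mA mD); rewrite -[RHS]e0; apply: eq_integral => w.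
  by rewrite inE /A/= => wA; rewrite ger0_norm// subr_ge0 ltW.
apply: filterS => w /= h; rewrite leNgt; apply/negP => wA.
by have := h wA => -[] /eqP; rewrite subr_eq0 => /eqP e; rewrite /A/= e ltxx in wA.
Qed.

(** The existence of one version rules out the default value in [cond_exp]; the two one-sided
    comparisons then give equality. *)
Lemma cond_exp_unique (P : set_system Omega) Z V : is_cond_exp Q <<s P >> Z V ->
  {ae Q, forall w, cond_exp Q <<s P >> Z w = V w}.
Proof.
move=> hV; have h := xgetPex (fun=> 0) (ex_intro _ V hV).
rewrite -/(cond_exp Q <<s P >> Z) in h.
have := half h hV; have := half hV h.
by apply: filterS2 => w a b; apply/eqP; rewrite eq_le a b.
Qed.

End cond_exp_unique.

(** * Riemann-Stieltjes sums *)

Section calculus.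
Context {R : realType}.
Local Notation mu := (@lebesgue_measure R).
Implicit Types (f g F h : R -> R) (a b T x y : R).

(** Composition with this retraction onto [[a, b]] extends a function continuous within [[a, b]] to
    one continuous on the whole line. *)
Definition clamp a b x := Num.max a (Num.min x b).

Lemma clamp_itv a b x : a <= b -> a <= clamp a b x <= b.
Proof. by move=> ab; rewrite /clamp le_max lexx/= ge_max ab ge_min lexx orbT. Qed.

Lemma clamp_id a b x : a <= x <= b -> clamp a b x = x.
Proof. by move=> /andP[ax xb]; rewrite /clamp min_l// max_r. Qed.

Lemma continuous_clamp a b : continuous (clamp a b).
Proof.
move=> x; apply: (@continuous_max _ R (cst a) (fun x => Num.min x b)).
  exact: cvg_cst.
by apply: (@continuous_min _ R id (cst b)); [exact: cvg_id|exact: cvg_cst].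
Qed.

Lemma continuous_comp_clamp a b f : a <= b ->
  {within `[a, b], continuous f} -> continuous (f \o clamp a b).
Proof.
move=> ab /subspace_continuousP cf x.
have cx : `[a, b]%classic (clamp a b x) by rewrite /= in_itv/= clamp_itv.
move=> A /(cf _ cx) wA.
have wA' : nbhs (clamp a b x) [set y | `[a, b]%classic y -> A (f y)] by exact: wA.
have := @continuous_clamp a b x _ wA'; rewrite !nbhs_simpl/=.
apply: filterS => y /= yab; apply: yab; have := clamp_itv y ab.
by rewrite in_itv.
Qed.

(** Heine-Cantor, from compactness of [[a, b]] in its covering form. Only [x] is confined to the
    segment; [y] may leave it. *)
Lemma continuous_unif a b f e : continuous f -> 0 < e ->
  exists2 del, 0 < del & forall x y, a <= x <= b -> `|y - x| < del ->
    `|f y - f x| < e.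
Proof.
move=> cf e0.
pose P (del x : R) := forall y, `|y - x| < del -> `|f y - f x| < e.
have /compact_near_coveringP cpt := @segment_compact R a b.
have /= : \forall del \near (0:R)^'+, `[a, b] `<=` P del.
  apply: cpt => x _.
  have /cvgrPdist_lt /(_ (e / 2)) := cf x; rewrite divr_gt0// => /(_ isT).
  move=> /nbhs_ballP[d /= d0 hd].
  exists (ball x (d / 2), [set del : R | del < d / 2]).
    split => /=; first by apply: nbhsx_ballx; rewrite divr_gt0.
    by apply: nbhs_right_lt; rewrite divr_gt0.
  move=> [x' del] [/= xx' deld] y yx'.
  have h1 := hd x' _; have h2 := hd y _.
  rewrite -(subrKA (f x)) (le_lt_trans (ler_normD _ _))// (splitr e) ltrD//.
    rewrite distrC; apply: h2; rewrite /ball/= -(subrKA x').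
    rewrite (le_lt_trans (ler_normD _ _))// (splitr d) ltrD//.
    by rewrite distrC (lt_trans yx').
  apply: h1; rewrite /ball/=; rewrite /ball/= in xx'.
  by rewrite (lt_trans xx')// ltr_pdivrMr// ltr_pMr// ltr1n.
move=> nr; near (0:R)^'+ => del.
exists del; first by near: del; exact: nbhs_right_gt.
move=> x y axb; have : `[a, b] `<=` P del by near: del.
by move=> /(_ x); apply; rewrite /= in_itv.
Unshelve. all: by end_near. Qed.

Lemma integrable_sub_itv f a b x y : mu.-integrable `[a, b] (EFin \o f) ->
  a <= x -> y <= b -> mu.-integrable `[x, y] (EFin \o f).
Proof.
move=> if_ ax yb; apply: integrableS if_ => // z/=.
by rewrite !in_itv/= => /andP[xz zy]; rewrite (le_trans ax)// (le_trans zy).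
Qed.

Lemma Rintegral_itv_split f a b x : mu.-integrable `[a, b] (EFin \o f) ->
  a <= x <= b -> \int[mu]_(u in `[a, b]) f u =
    \int[mu]_(u in `[a, x]) f u + \int[mu]_(u in `[x, b]) f u.
Proof.
move=> if_ /andP[ax xb]; apply/eqP; rewrite addrC -subr_eq; apply/eqP.
rewrite Rintegral_itvB ?bnd_simp//.
rewrite Rintegral_itv_obnd_cbnd//; apply: integrableS if_ => // z/=.
by rewrite !in_itv/= => /andP[xz ->]; rewrite (le_trans ax)// ltW.
Qed.

Lemma within_continuous_integrable f a b : {within `[a, b], continuous f} ->
  mu.-integrable `[a, b] (EFin \o f).
Proof. by move=> cf; apply: continuous_compact_integrable => //; exact: segment_compact. Qed.

Lemma Rintegral_FTC2 f F a b : a <= b ->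
  {within `[a, b], continuous f} -> {within `[a, b], continuous F} ->
  (forall x, a < x < b -> is_derive x (1:R) F (f x)) ->
  \int[mu]_(x in `[a, b]) f x = F b - F a.
Proof.
rewrite le_eqVlt => /predU1P[<- _ _ _|ab cf /(continuous_within_itvP _ ab)[_ Fa Fb] dF].
  by rewrite set_itv1 Rintegral_set1 subrr.
rewrite /Rintegral (@continuous_FTC2 _ _ F)//.
  by split => // x; rewrite in_itv/= => xab; have [] := dF x xab.
by move=> x; rewrite in_itv/= => xab; rewrite derive1E; have [_ ->] := dF x xab.
Qed.

Lemma Rintegral_derive f a b x : {within `[a, b], continuous f} -> a < x < b ->
  is_derive x (1:R) (fun u => \int[mu]_(v in `[a, u]) f v) (f x).
Proof.
move=> cf /andP[ax xb]; have ab := lt_trans ax xb.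
have [] := continuous_FTC1_closed xb (within_continuous_integrable cf) ax _.
  by apply: (within_continuous_continuous ab cf); rewrite in_itv/= ax.
by move=> dF; rewrite derive1E => e; exact: DeriveDef.
Qed.

Definition grid a b n k : R := a + k%:R * ((b - a) / n.+1%:R).

Lemma grid0 a b n : grid a b n 0 = a. Proof. by rewrite /grid mul0r addr0. Qed.

Lemma gridn a b n : grid a b n n.+1 = b.
Proof. by rewrite /grid mulrC divfK// addrC subrK. Qed.

Lemma gridS a b n k : grid a b n k.+1 - grid a b n k = (b - a) / n.+1%:R.
Proof. by rewrite /grid -natr1; ring. Qed.

Lemma grid_nd a b n k : a <= b -> grid a b n k <= grid a b n k.+1.
Proof. by move=> ab; rewrite -subr_ge0 gridS divr_ge0// subr_ge0. Qed.

Lemma grid_ge a b n k : a <= b -> a <= grid a b n k.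
Proof. by move=> ab; rewrite lerDl mulr_ge0// divr_ge0// subr_ge0. Qed.

Lemma grid_le a b n k : a <= b -> (k <= n.+1)%N -> grid a b n k <= b.
Proof.
move=> ab kn; rewrite -[leRHS](gridn a b n) lerD2l ler_wpM2r ?ler_nat//.
by rewrite divr_ge0// subr_ge0.
Qed.

Lemma Rintegral_grid f a b n m : a <= b -> (m <= n.+1)%N ->
  mu.-integrable `[a, b] (EFin \o f) ->
  \int[mu]_(x in `[a, grid a b n m]) f x =
    \sum_(k < m) \int[mu]_(x in `[grid a b n k, grid a b n k.+1]) f x.
Proof.
move=> ab + if_; elim: m => [|m IH] mn.
  by rewrite grid0 set_itv1 Rintegral_set1 big_ord0.
rewrite big_ord_recr/= -IH; last exact: ltnW.
rewrite (Rintegral_itv_split (b := grid a b n m.+1) (x := grid a b n m))//.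
  by apply: (integrable_sub_itv if_) => //; exact: grid_le.
by rewrite grid_ge//= grid_nd.
Qed.

(** The weights are exact integrals of [g] over the cells, so the error is at most the oscillation
    of [f] on a cell times the integral of [|g|]; [g] itself need only be integrable. *)
Lemma stieltjes_sum_cvg f g a b (tag : nat -> nat -> R) : a <= b ->
  continuous f -> mu.-integrable `[a, b] (EFin \o g) ->
  (forall n k, grid a b n k <= tag n k <= grid a b n k.+1) ->
  \sum_(k < n.+1) f (tag n k) *
     \int[mu]_(x in `[grid a b n k, grid a b n k.+1]) g x @[n --> \oo] -->
  \int[mu]_(x in `[a, b]) (f x * g x).
Proof.
move=> ab cf ig htag.
have mg : measurable_fun `[a, b] g by case/integrableP: ig => /measurable_EFinP.
have mf : measurable_fun setT f by exact: continuous_measurable_fun.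
have ifg : mu.-integrable `[a, b] (EFin \o (fun x => f x * g x)).
  have cnf : {within `[a, b], continuous (fun x => `|f x|)}.
    apply: continuous_subspaceT => x; apply: continuous_comp; first exact: cf.
    exact: norm_continuous.
  have [c _ cub] := EVT_max ab cnf.
  apply: (@dominated_integrableR _ _ R mu _ _ (fun x => `|f c| * `|g x|)) => //.
  - by apply: measurable_funM => //; exact: measurable_funTS.
  - under [X in _.-integrable _ X]eq_fun do rewrite /= EFinM.
    by apply: integrableZl => //; exact: integrable_norm.
  - by move=> x xab; rewrite normrM ler_wpM2r//; exact: cub.
apply/cvgrPdist_le => e e0.
pose N := \int[mu]_(x in `[a, b]) `|g x|.
have N0 : 0 <= N by exact: Rintegral_ge0.
(* The added 1 covers the case where the integral [N] of [|g|] is 0. *)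
pose e' := e / (N + 1); have e'0 : 0 < e' by rewrite divr_gt0// ltr_wpDl.
have [del d0 hd] := continuous_unif a b cf e'0.
near=> n.
have mesh : (b - a) / n.+1%:R < del.
  rewrite ltr_pdivrMr// mulrC -ltr_pdivrMr//.
  apply: (@lt_trans _ _ n%:R); last by rewrite ltr_nat.
  by near: n; exact: nbhs_infty_gtr.
pose J k : set R := `[grid a b n k, grid a b n k.+1]%classic.
have Jab k : (k < n.+1)%N -> J k `<=` `[a, b]%classic.
  move=> kn x; rewrite /J /= !in_itv/= => /andP[x1 x2].
  by rewrite (le_trans (grid_ge _ _ ab) x1)/= (le_trans x2)// grid_le.
have mJ k : @measurable _ (measurableTypeR R) (J k) by exact: measurable_itv.
have iJ (h : R -> R) k : (k < n.+1)%N -> mu.-integrable `[a, b] (EFin \o h) ->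
    mu.-integrable (J k) (EFin \o h).
  by move=> kn ih; apply: integrableS ih; [exact: measurable_itv..|exact: Jab].
rewrite -{1}(gridn a b n) Rintegral_grid// -sumrB.
apply: (le_trans (ler_norm_sum _ _ _)).
apply: (@le_trans _ _ (\sum_(k < n.+1) e' * \int[mu]_(x in J k) `|g x|)); last first.
  rewrite -mulr_sumr -(Rintegral_grid (m := n.+1))//; last exact: integrable_norm.
  rewrite gridn -/N /e' mulrAC ler_pdivrMr ?ltr_wpDl//.
  by rewrite ler_wpM2l ?(ltW e0)// lerDl.
apply: ler_sum => -[k kn] _ /=.
rewrite -/(J k) -RintegralZl//; last exact: iJ.
have ifg' : mu.-integrable (J k) (EFin \o (fun x => f (tag n k) * g x)).
  under [X in _.-integrable _ X]eq_fun do rewrite /= EFinM.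
  by apply: integrableZl => //; exact: iJ.
rewrite -RintegralB//; last exact: iJ.
have ifB : mu.-integrable (J k) (EFin \o (fun x => f x * g x - f (tag n k) * g x)).
  under [X in _.-integrable _ X]eq_fun do rewrite /= EFinB.
  by apply: integrableB => //; exact: iJ.
apply: (le_trans (le_normr_Rintegral _ ifB)) => //.
rewrite -RintegralZl//; last by apply: iJ => //; exact: integrable_norm.
apply: le_Rintegral => //.
- exact: integrable_norm.
- under [X in _.-integrable _ X]eq_fun do rewrite /= EFinM.
  by apply: integrableZl => //; apply: iJ => //; exact: integrable_norm.
move=> x Jx; rewrite -mulrBl normrM ler_wpM2r// distrC ltW//.
have xab := Jab _ kn _ Jx; rewrite /= in_itv/= in xab.
apply: hd => //; apply: le_lt_trans mesh.
rewrite -(gridS a b n k) ler_norml; move: (htag n k) Jx; rewrite /J/= in_itv/=.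
by move=> /andP[? ?] /andP[? ?]; apply/andP; split; lra.
Unshelve. all: by end_near. Qed.

(** Abel summation moves the differences from [c] to [q], where they are integrals of [- g]; both
    boundary terms vanish, by [c a = 0] and [q b = 0]. No bounded variation of [c] is involved, so
    [c] may be a Brownian path, and the left side is then a discretised Wiener integral. *)
Lemma stieltjes_by_parts_cvg (q g c : R -> R) a b : a <= b ->
  {within `[a, b], continuous q} -> {within `[a, b], continuous g} ->
  (forall x, a < x < b -> is_derive x (1:R) q (- g x)) ->
  {within `[a, b], continuous c} -> c a = 0 -> q b = 0 ->
  \sum_(k < n.+1) q (grid a b n k.+1) *
     (c (grid a b n k.+1) - c (grid a b n k)) @[n --> \oo] -->
  \int[mu]_(x in `[a, b]) (c x * g x).
Proof.
move=> ab cq cg dq cc ca qb.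
have tagP n k : grid a b n k <= grid a b n k <= grid a b n k.+1.
  by rewrite lexx grid_nd.
have lim := stieltjes_sum_cvg ab (continuous_comp_clamp ab cc)
  (within_continuous_integrable cg) tagP.
have -> : \int[mu]_(x in `[a, b]) (c x * g x) =
    \int[mu]_(x in `[a, b]) ((c \o clamp a b) x * g x).
  by apply: eq_Rintegral => x; rewrite inE/= in_itv/= => xab; rewrite clamp_id.
apply: cvg_trans lim; apply: near_eq_cvg; apply: nearW => n.
have gI k : (k < n.+1)%N -> \int[mu]_(x in `[grid a b n k, grid a b n k.+1]) g x =
    - (q (grid a b n k.+1) - q (grid a b n k)).
  move=> kn; have s : `[grid a b n k, grid a b n k.+1]%classic `<=` `[a, b]%classic.
    move=> x /=; rewrite !in_itv/= => /andP[x1 x2].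
    by rewrite (le_trans (grid_ge _ _ ab) x1)/= (le_trans x2)// grid_le.
  transitivity (- q (grid a b n k.+1) - - q (grid a b n k)); last by ring.
  apply: (@Rintegral_FTC2 _ (fun x => - q x)).
  - exact: grid_nd.
  - exact: continuous_subspaceW cg.
  - move=> x; apply: cvgN; exact: (continuous_subspaceW s cq).
  - move=> x /andP[x1 x2]; rewrite -[g x]opprK; apply: is_deriveN; apply: dq.
    by rewrite (le_lt_trans (grid_ge _ _ ab) x1)/= (lt_le_trans x2)// grid_le.
have E m : (m <= n.+1)%N -> \sum_(k < m) q (grid a b n k.+1) *
     (c (grid a b n k.+1) - c (grid a b n k)) = q (grid a b n m) * c (grid a b n m) +
  \sum_(k < m) (c \o clamp a b) (grid a b n k) *
     \int[mu]_(x in `[grid a b n k, grid a b n k.+1]) g x.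
  elim: m => [|m IH] mn; first by rewrite !big_ord0 grid0 ca mulr0 addr0.
  rewrite !big_ord_recr/= IH ?(ltnW mn)// gI// clamp_id; first by ring.
  by rewrite grid_ge//= grid_le// ltnW.
by rewrite E// gridn qb mul0r add0r.
Qed.

End calculus.

(** * Paths of the Ornstein-Uhlenbeck process and discounting *)

Section within_continuity.
Context {R : realType}.
Implicit Types (D : set R) (f g : R -> R).

Lemma within_continuous_mul D f g : {within D, continuous f} ->
  {within D, continuous g} -> {within D, continuous (fun x => f x * g x)}.
Proof. by move=> cf cg x; apply: cvgM; [exact: cf|exact: cg]. Qed.

Lemma within_continuous_sub D f g : {within D, continuous f} ->
  {within D, continuous g} -> {within D, continuous (fun x => f x - g x)}.
Proof. by move=> cf cg x; apply: cvgB; [exact: cf|exact: cg]. Qed.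

Lemma within_continuous_add D f g : {within D, continuous f} ->
  {within D, continuous g} -> {within D, continuous (fun x => f x + g x)}.
Proof. by move=> cf cg x; apply: cvgD; [exact: cf|exact: cg]. Qed.

Lemma within_continuous_cst D (c : R) : {within D, continuous (fun=> c)}.
Proof. by move=> x; exact: cvg_cst. Qed.

Lemma continuous_expRM (c : R) : continuous (fun x : R => expR (c * x)).
Proof.
move=> x; apply: (@continuous_comp _ _ _ (fun x : R => c * x)).
  exact: mulrl_continuous.
exact: continuous_expR.
Qed.

Lemma within_continuous_expRM D (c : R) :
  {within D, continuous (fun x : R => expR (c * x))}.
Proof. exact/continuous_subspaceT/continuous_expRM. Qed.

End within_continuity.


Section ou_path.
Context {R : realType}.
Local Notation mu := (@lebesgue_measure R).
Variables (kappa theta psi x0 : R) (X b : R -> R).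
Hypothesis cX : {within `[0, +oo[, continuous X}.
Hypothesis sde : forall t, 0 <= t ->
  X t = x0 + \int[mu]_(s in `[0, t]) (kappa * (theta - X s)) + psi * b t.

Let F u := x0 + \int[mu]_(s in `[0, u]) (kappa * (theta - X s)).

Lemma within_continuous_itvW (f : R -> R) (a T : R) : 0 <= a ->
  {within `[0, +oo[, continuous f} -> {within `[a, T], continuous f}.
Proof.
move=> a0; apply: continuous_subspaceW => x /=.
by rewrite !in_itv/= andbT => /andP[ax _]; exact: le_trans ax.
Qed.

Let cdrift (a T : R) : 0 <= a ->
  {within `[a, T], continuous (fun s => kappa * (theta - X s))}.
Proof.
move=> a0; apply: within_continuous_mul; first exact: within_continuous_cst.
apply: within_continuous_sub; first exact: within_continuous_cst.
exact: within_continuous_itvW.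
Qed.

Lemma ou_smooth_part t : 0 <= t ->
  X t - psi * b t = x0 + \int[mu]_(s in `[0, t]) (kappa * (theta - X s)).
Proof. by move=> t0; rewrite sde// addrK. Qed.

(** The product rule for [h * (X - psi * b)]: removing the noise leaves a path that is an integral
    of a continuous function, hence differentiable although [X] and [b] are not. *)
Lemma ou_integrating_factor (a T : R) (h dh : R -> R) : 0 <= a -> a <= T ->
  {within `[a, T], continuous h} -> {within `[a, T], continuous dh} ->
  (forall u, a < u < T -> is_derive u (1:R) h (dh u)) ->
  \int[mu]_(u in `[a, T])
    (dh u * (X u - psi * b u) + h u * (kappa * (theta - X u))) =
  h T * (X T - psi * b T) - h a * (X a - psi * b a).
Proof.
move=> a0 aT ch cdh dh'; have T0 := le_trans a0 aT.
rewrite !ou_smooth_part// -/(F T) -/(F a).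
have cF : {within `[a, T], continuous F}.
  apply: within_continuous_add; first exact: within_continuous_cst.
  apply: (@continuous_subspaceW _ _ _ `[0, T]%classic).
    by move=> x /=; rewrite !in_itv/= => /andP[ax ->]; rewrite (le_trans a0).
  apply: (parameterized_integral_continuous T0).
  by apply: within_continuous_integrable; exact: cdrift.
transitivity (\int[mu]_(u in `[a, T]) (dh u * F u + h u * (kappa * (theta - X u)))).
  apply: eq_Rintegral => u; rewrite inE/= in_itv/= => /andP[au _].
  by rewrite ou_smooth_part// (le_trans a0).
apply: (@Rintegral_FTC2 _ _ (fun u => h u * F u)) => //.
- apply: within_continuous_add; apply: within_continuous_mul => //.
  exact: cdrift.
- exact: within_continuous_mul.
move=> u auT; have /andP[au uT] := auT.
have dhu := dh' u auT.
have dF : is_derive u (1:R) (fun u => \int[mu]_(v in `[0, u]) (kappa * (theta - X v)))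
    (kappa * (theta - X u)).
  by apply: (Rintegral_derive (cdrift (T := T) (lexx 0))); rewrite (le_lt_trans a0).
rewrite /F; apply: is_derive_eq.
have scE (x y : R) : x *: y = x * y by [].
by rewrite !scE; ring.
Qed.

(** The integrating factor is [expR (kappa * u)]. The stochastic convolution appears after
    integration by parts, so that only values of the path [b] occur. *)
Lemma ou_explicit s : {within `[0, +oo[, continuous b} -> 0 <= s ->
  X s = expR (- kappa * s) * (x0 +
    \int[mu]_(u in `[0, s]) ((theta - psi * b u) * (kappa * expR (kappa * u)))) +
    psi * b s.
Proof.
move=> cb s0.
have d u : is_derive u (1:R) (fun u : R => expR (kappa * u)) (kappa * expR (kappa * u)).
  apply: is_derive_eq; have scE (x y : R) : x *: y = x * y by [].
  by rewrite !scE; ring.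
have ce := @within_continuous_expRM R `[0, s]%classic kappa.
have H := @ou_integrating_factor 0 s (fun u => expR (kappa * u))
  (fun u => kappa * expR (kappa * u)) (lexx _) s0 ce
  (within_continuous_mul (@within_continuous_cst R _ kappa) ce) (fun u _ => d u).
have {H} : \int[mu]_(u in `[0, s]) ((theta - psi * b u) * (kappa * expR (kappa * u))) =
    expR (kappa * s) * (X s - psi * b s) - x0.
  rewrite -[X in _ - X](_ : expR (kappa * 0) * (X 0 - psi * b 0) = _); last first.
    by rewrite mulr0 expR0 mul1r ou_smooth_part// set_itv1 Rintegral_set1 addr0.
  by rewrite -H; apply: eq_Rintegral => u _; ring.
move=> ->; rewrite (addrC x0) subrK mulrA mulNr -expRD addNr expR0 mul1r.
by rewrite subrK.
Qed.

End ou_path.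

Section discount_factor.
Context {R : realType}.
Local Notation mu := (@lebesgue_measure R).
Variables (r : R -> R) (kappa : R).
Hypothesis hr : forall t, 0 <= t -> mu.-integrable `[0, t] (EFin \o r).
Hypothesis hpi : (\int[mu]_(u in `[0%R, +oo[) (discount r u)%:E < +oo)%E.
Hypothesis hk : 0 < kappa.
Local Notation D := (discount r).

Lemma discount_gt0 t : 0 < D t. Proof. exact: expR_gt0. Qed.

Lemma within_continuous_discount (a b : R) : 0 <= a -> {within `[a, b], continuous D}.
Proof.
move=> a0; have [ab|ba] := leP a b; last first.
  by rewrite set_itv_ge ?bnd_simp -?ltNge//; exact: continuous_subspace0.
have b0 := le_trans a0 ab.
apply: (@continuous_subspaceW _ _ _ `[0, b]%classic).
  by move=> x /=; rewrite !in_itv/= => /andP[ax ->]; rewrite (le_trans a0).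
have c := parameterized_integral_continuous b0 (hr b0).
by move=> x; apply: (cvg_comp _ expR (cvgN (c x))); exact: continuous_expR.
Qed.

Lemma measurable_discount (a : R) : 0 <= a -> measurable_fun `[a, +oo[ D.
Proof.
move=> a0; rewrite itv_bndy_bigcup_BRight; apply/measurable_fun_bigcup => n.
  exact: measurable_itv.
apply: subspace_continuous_measurable_fun; first exact: measurable_itv.
exact: within_continuous_discount.
Qed.

Lemma integrable_discount (a : R) : 0 <= a -> mu.-integrable `[a, +oo[ (EFin \o D).
Proof.
move=> a0; apply: (@integrableS _ _ _ mu `[0, +oo[) => //.
  by move=> x /=; rewrite !in_itv/= !andbT; exact: le_trans.
apply/integrableP; split; first by apply/measurable_EFinP; exact: measurable_discount.
under eq_integral do rewrite /= ger0_norm ?(ltW (discount_gt0 _))//.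
exact: hpi.
Qed.

Definition q_trunc (T u : R) : R :=
  \int[mu]_(w in `[u, T]) (D w * expR (- kappa * (w - u))).

Let h w := D w * expR (- kappa * w).

Let ch (a b : R) : 0 <= a -> {within `[a, b], continuous h}.
Proof.
move=> a0; apply: within_continuous_mul; first exact: within_continuous_discount.
exact: within_continuous_expRM.
Qed.

(* [q_trunc T] on [[a, T]], in a form that is differentiable in [u]. *)
Definition q_smooth (a T u : R) : R :=
  expR (kappa * u) * (\int[mu]_(w in `[a, T]) h w - \int[mu]_(w in `[a, u]) h w).

Variables (a T : R).
Hypotheses (a0 : 0 <= a) (aT : a <= T).

Lemma q_truncE u : a <= u <= T -> q_trunc T u = q_smooth a T u.
Proof.
move=> auT; have /andP[au uT] := auT; have u0 := le_trans a0 au.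
rewrite /q_smooth (Rintegral_itv_split (x := u))//; last first.
  exact/within_continuous_integrable/ch.
rewrite addrAC subrr add0r -RintegralZl//; last first.
  exact/within_continuous_integrable/ch.
apply: eq_Rintegral => w _; rewrite /h [RHS]mulrCA.
by congr (_ * _); rewrite -expRD; congr expR; ring.
Qed.

Lemma q_smooth_end : q_smooth a T T = 0.
Proof. by rewrite /q_smooth subrr mulr0. Qed.

Lemma within_continuous_q : {within `[a, T], continuous (q_smooth a T)}.
Proof.
apply: within_continuous_mul; first exact: within_continuous_expRM.
apply: within_continuous_sub; first exact: within_continuous_cst.
apply: (parameterized_integral_continuous aT).
exact/within_continuous_integrable/ch.
Qed.

Lemma q_smooth_derive u : a < u < T ->
  is_derive u (1:R) (q_smooth a T) (- (D u - kappa * q_smooth a T u)).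
Proof.
move=> auT; have dH := Rintegral_derive (@ch a T a0) auT.
rewrite {1}/q_smooth; apply: is_derive_eq.
have scE (x y : R) : x *: y = x * y by [].
rewrite !scE /q_smooth /h.
set I1 := \int[mu]_(w in `[a, T]) _; set I2 := \int[mu]_(w in `[a, u]) _.
have e : expR (kappa * u) * expR (- kappa * u) = 1 by rewrite mulNr expRxMexpNx_1.
transitivity (- (expR (kappa * u) * expR (- kappa * u) * D u -
  kappa * (expR (kappa * u) * (I1 - I2)))); last by rewrite e mul1r.
ring.
Qed.

Lemma within_continuous_dq :
  {within `[a, T], continuous (fun u => D u - kappa * q_smooth a T u)}.
Proof.
apply: within_continuous_sub; first exact: within_continuous_discount.
apply: within_continuous_mul; first exact: within_continuous_cst.
exact: within_continuous_q.
Qed.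

Lemma Rintegral_dq :
  \int[mu]_(u in `[a, T]) (D u - kappa * q_smooth a T u) = q_smooth a T a.
Proof.
transitivity (- q_smooth a T T - - q_smooth a T a); last first.
  by rewrite q_smooth_end; ring.
apply: (@Rintegral_FTC2 _ _ (fun u => - q_smooth a T u)) => //.
- exact: within_continuous_dq.
- by move=> x; apply: cvgN; exact: within_continuous_q.
- by move=> x axT; rewrite -[X in is_derive _ _ _ X]opprK; apply: is_deriveN;
    exact: q_smooth_derive.
Qed.

(** The linear equation [q' = kappa * q - D] integrated over [[a, T]], at whose right end [q]
    vanishes. *)
Lemma kappa_Rintegral_q : kappa * \int[mu]_(u in `[a, T]) q_smooth a T u =
  \int[mu]_(u in `[a, T]) D u - q_smooth a T a.
Proof.
have iq := within_continuous_integrable within_continuous_q.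
have iD := within_continuous_integrable (@within_continuous_discount a T a0).
have ikq : mu.-integrable `[a, T] (EFin \o (fun u => kappa * q_smooth a T u)).
  under [X in _.-integrable _ X]eq_fun do rewrite /= EFinM.
  exact: integrableZl.
rewrite -[X in _ - X]Rintegral_dq RintegralB// RintegralZl//; ring.
Qed.

(* Integrating [q A] by parts, where [A = X - psi b] is the smooth part of the path. *)
Lemma ou_discounted_path (X b : R -> R) (theta psi x0 : R) :
  {within `[0, +oo[, continuous X} -> {within `[0, +oo[, continuous b} ->
  (forall t, 0 <= t -> X t = x0 + \int[mu]_(s in `[0, t]) (kappa * (theta - X s))
    + psi * b t) ->
  \int[mu]_(u in `[a, T]) (D u * X u) =
    q_smooth a T a * X a + theta * (\int[mu]_(u in `[a, T]) D u - q_smooth a T a) +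
    psi * \int[mu]_(u in `[a, T]) ((b u - b a) * (D u - kappa * q_smooth a T u)).
Proof.
move=> cX cb sde.
have iq := within_continuous_integrable within_continuous_q.
have cD := @within_continuous_discount a T a0.
have cdq := within_continuous_dq.
have cX' := within_continuous_itvW (T := T) a0 cX; have cb' := within_continuous_itvW (T := T) a0 cb.
have cNdq : {within `[a, T], continuous (fun u => - (D u - kappa * q_smooth a T u))}.
  by move=> x; apply: cvgN; exact: cdq.
have := ou_integrating_factor (psi := psi) (b := b) cX sde a0 aT within_continuous_q
  cNdq q_smooth_derive.
rewrite q_smooth_end mul0r sub0r => H.
have {H} : \int[mu]_(u in `[a, T]) ((psi * (b u * (D u - kappa * q_smooth a T u)) +
    (theta * kappa) * q_smooth a T u) - D u * X u) =
    - (q_smooth a T a * (X a - psi * b a)).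
  by rewrite -H; apply: eq_Rintegral => u _; ring.
have iDX : mu.-integrable `[a, T] (EFin \o (fun u => D u * X u)).
  exact/within_continuous_integrable/within_continuous_mul.
have ibdq : mu.-integrable `[a, T]
    (EFin \o (fun u => b u * (D u - kappa * q_smooth a T u))).
  exact/within_continuous_integrable/within_continuous_mul.
have i1 : mu.-integrable `[a, T]
    (EFin \o (fun u => psi * (b u * (D u - kappa * q_smooth a T u)))).
  apply/within_continuous_integrable/within_continuous_mul.
    exact: within_continuous_cst.
  exact: within_continuous_mul.
have i2 : mu.-integrable `[a, T] (EFin \o (fun u => (theta * kappa) * q_smooth a T u)).
  apply/within_continuous_integrable/within_continuous_mul.
    exact: within_continuous_cst.
  exact: within_continuous_q.
rewrite RintegralB//; last first.
  apply/within_continuous_integrable/within_continuous_add.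
    apply: within_continuous_mul; first exact: within_continuous_cst.
    exact: within_continuous_mul.
  apply: within_continuous_mul; first exact: within_continuous_cst.
  exact: within_continuous_q.
rewrite RintegralD// !RintegralZl// -mulrA kappa_Rintegral_q => E.
have -> : \int[mu]_(u in `[a, T]) ((b u - b a) * (D u - kappa * q_smooth a T u)) =
  \int[mu]_(u in `[a, T]) (b u * (D u - kappa * q_smooth a T u)) - b a * q_smooth a T a.
  rewrite -[q_smooth a T a]Rintegral_dq -RintegralZl//; last first.
    exact/within_continuous_integrable.
  rewrite -RintegralB//.
    by apply: eq_Rintegral => u _; rewrite mulrBl.
  apply/within_continuous_integrable/within_continuous_mul => //.
  exact: within_continuous_cst.
move/eqP: E; rewrite subr_eq => /eqP E.
move: E; set IX := \int[mu]_(u in `[a, T]) (D u * X u) => E.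
have -> : IX = - (q_smooth a T a * (X a - psi * b a)) + IX +
   q_smooth a T a * (X a - psi * b a) by ring.
rewrite -E; ring.
Qed.

End discount_factor.

(** * Coefficients as the horizon tends to infinity *)

Section discount_limits.
Context {R : realType}.
Local Notation mu := (@lebesgue_measure R).
Variables (r : R -> R) (kappa : R).
Hypothesis hr : forall t, 0 <= t -> mu.-integrable `[0, t] (EFin \o r).
Hypothesis hpi : (\int[mu]_(u in `[0%R, +oo[) (discount r u)%:E < +oo)%E.
Hypothesis hk : 0 < kappa.
Local Notation D := (discount r).
Variable a : R.
Hypothesis a0 : 0 <= a.

Lemma Rintegral_itvy_cvg (u : R) (h : R -> R) : a <= u ->
  mu.-integrable `[u, +oo[ (EFin \o h) ->
  \int[mu]_(w in `[u, a + n%:R]) h w @[n --> \oo] --> \int[mu]_(w in `[u, +oo[) h w.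
Proof.
move=> au ih; apply: Rintegral_exhaust_cvg => //.
- by move=> n x /=; rewrite !in_itv/= andbT => /andP[].
move=> x /=; rewrite in_itv/= andbT => ux; near=> n.
rewrite in_itv/= ux/= -lerBlDl; near: n; exact: nbhs_infty_ger.
Unshelve. all: by end_near. Qed.

Lemma integrable_q_coef u : 0 <= u ->
  mu.-integrable `[u, +oo[ (EFin \o (fun w => D w * expR (- kappa * (w - u)))).
Proof.
move=> u0; have mD := measurable_discount hr u0.
apply: (@dominated_integrableR _ _ R mu _ _ D) => //.
- apply: measurable_funM => //; apply: measurable_funTS.
  by apply: measurableT_comp => //; apply: measurable_funM => //; exact: measurable_funB.
- exact: integrable_discount.
- move=> w /=; rewrite in_itv/= andbT => uw.
  rewrite normrM ger0_norm ?(ltW (discount_gt0 _ _))// ger0_norm ?expR_ge0//.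
  rewrite ler_piMr ?(ltW (discount_gt0 _ _))// -expR0 ler_expR mulNr oppr_le0.
  by rewrite mulr_ge0 ?(ltW hk)// subr_ge0.
Qed.

Lemma q_trunc_cvg u : a <= u ->
  q_trunc r kappa (a + n%:R) u @[n --> \oo] --> q_coef r kappa u.
Proof.
by move=> au; apply: Rintegral_itvy_cvg => //; apply: integrable_q_coef; exact: le_trans au.
Qed.

Lemma q_trunc_ge0 (T u : R) : 0 <= q_trunc r kappa T u.
Proof. by apply: Rintegral_ge0 => w _; rewrite mulr_ge0 ?expR_ge0// ltW// discount_gt0. Qed.

Lemma q_trunc_nd (T T' u : R) : 0 <= u -> T <= T' -> q_trunc r kappa T u <= q_trunc r kappa T' u.
Proof.
move=> u0 TT'; have iu := integrable_q_coef u0.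
have i (S : R) : mu.-integrable `[u, S] (EFin \o (fun w => D w * expR (- kappa * (w - u)))).
  apply: integrableS iu => //.
  by move=> x /=; rewrite !in_itv/= andbT => /andP[].
have i0 (S w : R) : `[u, S]%classic w -> (0 <= (D w * expR (- kappa * (w - u)))%:E)%E.
  by move=> _; rewrite lee_fin mulr_ge0 ?expR_ge0// ltW// discount_gt0.
rewrite /q_trunc /Rintegral fine_le//.
- by apply: integrable_fin_num => //.
- by apply: integrable_fin_num => //.
apply: ge0_subset_integral => //; try exact: measurable_itv.
  by case/integrableP: (i T').
  exact: i0.
by move=> x /=; rewrite !in_itv/= => /andP[-> xT]; exact: le_trans TT'.
Qed.

Let T n : R := a + n%:R.

Let aT n : a <= T n. Proof. by rewrite lerDl. Qed.

Let P := \int[mu]_(w in `[a, +oo[) D w.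

Let iD := integrable_discount hr hpi a0.

Let P0 : 0 <= P.
Proof. by apply: Rintegral_ge0 => w _; rewrite ltW// discount_gt0. Qed.

Let sub_le_P (b c : R) : a <= b -> \int[mu]_(w in `[b, c]) D w <= P.
Proof.
move=> ab.
have s : `[b, c]%classic `<=` `[a, +oo[%classic.
  by move=> x /=; rewrite !in_itv/= andbT => /andP[/(le_trans ab)].
have ibc : mu.-integrable `[b, c] (EFin \o D).
  by apply: integrableS iD => //.
rewrite /P /Rintegral fine_le//.
- by apply: integrable_fin_num => //.
- by apply: integrable_fin_num => //.
apply: ge0_subset_integral => //; try exact: measurable_itv.
  by case/integrableP: iD.
by move=> x _; rewrite lee_fin ltW// discount_gt0.
Qed.

Let q_trunc_leP (S u : R) : a <= u -> q_trunc r kappa S u <= P.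
Proof.
move=> au; have u0 := le_trans a0 au; apply: le_trans (sub_le_P S au).
apply: le_Rintegral => //.
- apply: integrableS (integrable_q_coef u0) => //.
  by move=> x /=; rewrite !in_itv/= andbT => /andP[].
- apply: integrableS iD => //.
  by move=> x /=; rewrite !in_itv/= andbT => /andP[/(le_trans au)].
move=> w /=; rewrite in_itv/= => /andP[uw _].
rewrite ler_piMr ?(ltW (discount_gt0 _ _))// -expR0 ler_expR mulNr oppr_le0.
by rewrite mulr_ge0 ?(ltW hk)// subr_ge0.
Qed.

Let q n := q_smooth r kappa a (T n).

Let qE n u : a <= u <= T n -> q_trunc r kappa (T n) u = q n u.
Proof. exact: q_truncE. Qed.

Let cq n : {within `[a, T n], continuous (q n)}.
Proof. exact: within_continuous_q. Qed.

Let cq2 n : {within `[a, T n], continuous (fun u => q n u ^+ 2)}.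
Proof. by apply: within_continuous_mul; exact: cq. Qed.

(** One factor [q] is at most [P], and [kappa] times the integral of the other is at most [P] by
    [kappa_Rintegral_q]. The bound is uniform in the horizon, so the limiting variance is finite and
    [fine] does not collapse it to 0. *)
Let q2_bound n : \int[mu]_(u in `[a, T n]) (q n u ^+ 2) <= P * (P / kappa).
Proof.
have iq := within_continuous_integrable (@cq n).
apply: (@le_trans _ _ (\int[mu]_(u in `[a, T n]) (P * q n u))).
  apply: le_Rintegral => //.
  - exact/within_continuous_integrable/cq2.
  - under [X in _.-integrable _ X]eq_fun do rewrite /= EFinM.
    by apply: integrableZl => //.
  move=> u /=; rewrite in_itv/= => aun; have /andP[au _] := aun.
  by rewrite expr2 ler_wpM2r// -qE// ?q_trunc_ge0// q_trunc_leP.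
rewrite RintegralZl//.
rewrite ler_wpM2l// ler_pdivlMr// mulrC kappa_Rintegral_q//.
have q0 : 0 <= q n a by rewrite -qE ?lexx ?aT// q_trunc_ge0.
by rewrite lerBlDr (le_trans (sub_le_P (T n) (lexx a)))// lerDl; exact: q0.
Qed.

(** Integrand and domain both depend on [n]. Extended by zero beyond the horizon, the integrands
    increase with [n], and monotone convergence applies. *)
Lemma Rintegral_q_sqr_cvg :
  \int[mu]_(u in `[a, a + n%:R]) (q_smooth r kappa a (a + n%:R) u ^+ 2) @[n --> \oo]
    --> \int[mu]_(u in `[a, +oo[) (q_coef r kappa u ^+ 2).
Proof.
pose f n : R -> R := (fun u => q n u ^+ 2) \_ `[a, T n].
have fE n u : a <= u -> f n u = if u <= T n then q_trunc r kappa (T n) u ^+ 2 else 0.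
  move=> au; rewrite /f patchE; case: ifPn; rewrite ?inE ?notin_setE/= in_itv/= au/=.
    by move=> uT; rewrite uT qE// au.
  by move=> /negP/negbTE ->.
have mf n : measurable_fun `[a, +oo[ (f n).
  apply/(measurable_restrict _ _ _).1; try exact: measurable_itv.
  rewrite (_ : _ `&` _ = `[a, T n]%classic).
    apply: subspace_continuous_measurable_fun; first exact: measurable_itv.
    exact: cq2.
  apply/seteqP; split=> x /=; rewrite !in_itv/= ?andbT; first by case.
  by move=> /andP[ax xT]; rewrite ax.
have f0 n u : a <= u -> 0 <= f n u.
  by move=> au; rewrite fE//; case: ifP => // _; rewrite sqr_ge0.
have fnd u : a <= u -> {homo f ^~ u : n m / (n <= m)%N >-> n <= m}.
  move=> au n m nm; have TT : T n <= T m by rewrite lerD2l ler_nat.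
  rewrite !fE//; case: ifPn => [un|_]; last by case: ifPn => _ //; rewrite sqr_ge0.
  rewrite (le_trans un TT) lerXn2r ?nnegrE ?q_trunc_ge0// q_trunc_nd//.
  exact: le_trans au.
have fcvg u : a <= u -> f n u @[n --> \oo] --> q_coef r kappa u ^+ 2.
  move=> au; have c := q_trunc_cvg au.
  have c2 : q_trunc r kappa (a + n%:R) u * q_trunc r kappa (a + n%:R) u
      @[n --> \oo] --> q_coef r kappa u ^+ 2 by exact: (cvgM c c).
  apply: cvg_trans c2; apply: near_eq_cvg; near=> n; rewrite fE// ifT// /T.
  by rewrite -lerBlDl; near: n; exact: nbhs_infty_ger.
have mcv : (\int[mu]_(u in `[a, +oo[) (f n u)%:E @[n --> \oo] -->
    \int[mu]_(u in `[a, +oo[) (q_coef r kappa u ^+ 2)%:E)%E.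
  rewrite (_ : (\int[mu]_(u in `[a, +oo[) (q_coef r kappa u ^+ 2)%:E =
    \int[mu]_(u in `[a, +oo[) limn (fun n => (f n u)%:E))%E); last first.
    apply: eq_integral => u; rewrite inE/= in_itv/= andbT => au.
    apply/esym/cvg_lim => //; apply/fine_cvgP; split; first exact: nearW.
    exact: fcvg.
  apply: cvg_monotone_convergence => //.
  - by move=> n; apply/measurable_EFinP; exact: mf.
  - by move=> n u /=; rewrite in_itv/= andbT => au; rewrite lee_fin f0.
  - move=> u /=; rewrite in_itv/= andbT => au n m nm.
    by rewrite lee_fin fnd.
have fI n : (\int[mu]_(u in `[a, +oo[) (f n u)%:E =
    (\int[mu]_(u in `[a, T n]) (q n u ^+ 2))%:E)%E.
  rewrite fineK; last first.
    apply: integrable_fin_num => //; exact/within_continuous_integrable/cq2.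
  rewrite (_ : `[a, T n]%classic = `[a, +oo[%classic `&` `[a, T n]%classic).
    by rewrite integral_mkcondr; apply: eq_integral => u _; rewrite restrict_EFin.
  apply/seteqP; split=> x /=; rewrite !in_itv/= ?andbT; last by case.
  by move=> /andP[ax xT]; rewrite ax.
have fin : (\int[mu]_(u in `[a, +oo[) (q_coef r kappa u ^+ 2)%:E \is a fin_num)%E.
  rewrite ge0_fin_numE; last by apply: integral_ge0 => u _; rewrite lee_fin sqr_ge0.
  apply: (@le_lt_trans _ _ (P * (P / kappa))%:E); last by rewrite ltry.
  move/cvg_lim : (mcv) => <-//; apply: lime_le; first by apply/cvg_ex; eexists; exact: mcv.
  by apply: nearW => n; rewrite fI lee_fin q2_bound.
move: mcv; rewrite -[X in _ --> X -> _](fineK fin) => /fine_cvg.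
by apply: cvg_trans; apply: near_eq_cvg; apply: nearW => n /=; rewrite fI.
Unshelve. all: by end_near. Qed.

End discount_limits.

(** * Moments of the dividend process *)

Section joint_measurability.
Context d (Omega : measurableType d) (R : realType).
Variable Y : R -> Omega -> R.
Hypothesis mY : forall u, measurable_fun setT (Y u).
Hypothesis cY : forall w, {within `[0, +oo[, continuous (Y ^~ w)}.

Let cell n (u : R) := Num.truncn (n.+1%:R * Num.max 0 u).

Let cell_itv n u :
  (cell n u)%:R <= n.+1%:R * Num.max 0 u < (cell n u).+1%:R.
Proof. by apply: truncn_itv; rewrite mulr_ge0// le_max lexx. Qed.

Let tau n (u : R) : R := (cell n u)%:R / n.+1%:R.

Let tau_cvg u : tau n u @[n --> \oo] --> Num.max 0 u.
Proof.
apply: (@squeeze_cvgr _ _ _ _ (fun n => Num.max 0 u - n.+1%:R^-1)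
  (fun=> Num.max 0 u)); last exact: cvg_cst.
- apply: nearW => n; have /andP[h1 h2] := cell_itv n u.
  rewrite /tau ler_pdivrMr// ler_pdivlMr// mulrBl mulVf ?pnatr_eq0//.
  move: h1 h2; rewrite mulrC -[in X in _ < X]natr1 => h1 h2.
  by apply/andP; split => //; lra.
- apply: (cvg_eq (subr0 _)); apply: cvgB; first exact: cvg_cst.
  exact: cvg_harmonic.
Qed.

(** Round the time down to a multiple of [1 / n.+1]: preimages become countable unions of
    rectangles, and continuity of every path gives the pointwise limit. The maximum with 0 is there
    because paths are continuous only on nonnegative times. *)
Lemma measurable_process :
  measurable_fun setT (fun z : R * Omega => Y (Num.max 0 z.1) z.2).
Proof.
apply: (@measurable_fun_cvg _ _ _ _ (fun n z => Y (tau n z.1) z.2)) => //.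
- move=> n _ U mU; rewrite setTI.
  have -> : (fun z : R * Omega => Y (tau n z.1) z.2) @^-1` U =
     \bigcup_k ([set u | cell n u = k] `*` (Y (k%:R / n.+1%:R) @^-1` U)).
    apply/seteqP; split => [[u w] /= Uw|[u w] [k _ [/= <-]]//].
    by exists (cell n u).
  apply: bigcup_measurable => k _; apply: measurableX; last first.
    by rewrite -[X in measurable X]setTI; exact: mY.
  have -> : [set u | cell n u = k] =
      (fun u : R => n.+1%:R * Num.max 0 u) @^-1` `[k%:R, k.+1%:R[%classic.
    apply/seteqP; split => u /=; rewrite in_itv/=.
      by move=> <-; exact: cell_itv.
    by move=> h; exact: truncn_def.
  rewrite -[X in measurable X]setTI.
  have mh : measurable_fun setT (fun u : R => n.+1%:R * Num.max 0 u).
    by apply: measurable_funM => //; exact: measurable_maxr.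
  by apply: mh => //; exact: measurable_itv.
- move=> [u w] _ /=.
  have x0 : `[0, +oo[%classic (Num.max 0 u) by rewrite /= in_itv/= andbT le_max lexx.
  have c : Y x w @[x --> within `[0, +oo[ (nbhs (Num.max 0 u))] --> Y (Num.max 0 u) w.
    by have /subspace_continuousP := @cY w; exact.
  apply: cvg_trans c => A /= wA.
  have wA' : nbhs (Num.max 0 u) [set x | `[0, +oo[%classic x -> A (Y x w)] by [].
  have near_tau : \forall n \near \oo, `[0, +oo[%classic (tau n u) -> A (Y (tau n u) w).
    exact: (tau_cvg wA').
  apply: filterS near_tau => n /=; apply.
  by rewrite in_itv/= andbT divr_ge0.
Qed.

End joint_measurability.

Section Rintegral_sum.
Context d (T : measurableType d) (R : realType) (mu : {measure set T -> \bar R}).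

Lemma integrable_sumR (D : set T) (F : nat -> T -> R) n : measurable D ->
  (forall k, mu.-integrable D (EFin \o F k)) ->
  mu.-integrable D (EFin \o (fun w => \sum_(k < n) F k w)).
Proof.
move=> mD iF; elim: n => [|n IH].
  rewrite (_ : _ \o _ = cst 0%E); first exact: integrable0.
  by apply/funext => w /=; rewrite big_ord0.
rewrite (_ : _ \o _ = (EFin \o (fun w => \sum_(k < n) F k w)) \+ (EFin \o F n)).
  exact: integrableD.
by apply/funext => w /=; rewrite big_ord_recr.
Qed.

Lemma Rintegral_sum (D : set T) (F : nat -> T -> R) n : measurable D ->
  (forall k, mu.-integrable D (EFin \o F k)) ->
  \int[mu]_(w in D) (\sum_(k < n) F k w) = \sum_(k < n) \int[mu]_(w in D) F k w.
Proof.
move=> mD iF; elim: n => [|n IH].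
  rewrite big_ord0; under eq_Rintegral do rewrite big_ord0.
  by rewrite /Rintegral integral0.
rewrite big_ord_recr/= -IH -RintegralD//; last exact: integrable_sumR.
by apply: eq_Rintegral => w _; rewrite big_ord_recr.
Qed.

End Rintegral_sum.

Section ou_moment.
Context {R : realType}.
Local Notation mu := (@lebesgue_measure R).
Variables (kappa theta psi x0 : R).
Hypotheses (hk : 0 < kappa) (hpsi : 0 < psi).

Let kern v := kappa * expR (kappa * v).

Let ckern D : {within D, continuous kern}.
Proof.
apply: within_continuous_mul; first exact: within_continuous_cst.
exact: within_continuous_expRM.
Qed.

Let kern_ge0 v : 0 <= kern v.
Proof. by rewrite mulr_ge0 ?expR_ge0// ltW. Qed.

Let dexp u : is_derive u (1:R) (fun u : R => expR (kappa * u)) (kern u).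
Proof.
apply: is_derive_eq; have scE (x y : R) : x *: y = x * y by [].
by rewrite !scE /kern; ring.
Qed.

Lemma Rintegral_expR_kernel u : 0 <= u ->
  \int[mu]_(v in `[0, u]) kern v = expR (kappa * u) - 1.
Proof.
move=> u0; transitivity (expR (kappa * u) - expR (kappa * 0)).
  2: by rewrite mulr0 expR0.
apply: (@Rintegral_FTC2 _ _ (fun v => expR (kappa * v))) => //.
exact: within_continuous_expRM.
Qed.

Lemma Rintegral_kernel_bound u : 0 <= u ->
  expR (- kappa * u) * \int[mu]_(v in `[0, u]) ((1 + (u - v)) * kern v) <= 1 + kappa^-1.
Proof.
(* A primitive of the integrand; at [v = u], after the factor [expR (- kappa * u)], it leaves
   exactly [1 + kappa^-1], and its value at 0 is nonnegative. *)
move=> u0; pose F v := expR (kappa * v) * (1 + kappa^-1 + u - v).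
have cpoly (c : R) : {within `[0, u], continuous (fun v => c - v)}.
  by apply: continuous_subspaceT => x; apply: cvgB; [exact: cvg_cst|exact: cvg_id].
have -> : \int[mu]_(v in `[0, u]) ((1 + (u - v)) * kern v) = F u - F 0.
  apply: Rintegral_FTC2 => //.
  - apply: within_continuous_mul => //.
    by apply: within_continuous_add; [exact: within_continuous_cst|exact: cpoly].
  - apply: within_continuous_mul; first exact: within_continuous_expRM.
    exact: cpoly.
  - move=> v _; have dv := dexp v; rewrite /F; apply: is_derive_eq.
    have scE (x y : R) : x *: y = x * y by [].
    by rewrite !scE /kern; field; rewrite gt_eqF.
rewrite /F mulrBr mulrA mulNr -expRD addNr expR0 mul1r mulr0 expR0 mul1r.
rewrite subr0 addrK gerBl mulr_ge0 ?expR_ge0//.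
by rewrite !addr_ge0// invr_ge0 ltW.
Qed.

Lemma expR_linear_bound u : 0 <= u -> expR (- kappa * u) * (1 + u) <= 1 + kappa^-1.
Proof.
move=> u0; rewrite mulNr expRN mulrC ler_pdivrMr ?expR_gt0//.
apply: (@le_trans _ _ ((1 + kappa^-1) * (1 + kappa * u))); last first.
  by rewrite ler_wpM2l ?expR_ge1Dx// addr_ge0// invr_ge0 ltW.
rewrite -subr_ge0.
have -> : (1 + kappa^-1) * (1 + kappa * u) - (1 + u) = kappa^-1 + kappa * u.
  by field; rewrite gt_eqF.
by rewrite addr_ge0 ?mulr_ge0 ?invr_ge0// ltW.
Qed.

(** The explicit solution is recentred at [b u]: increments over [[v, u]] weighted by a kernel
    concentrated near [u] have a mean bounded uniformly in [u], whereas [b u] itself survives only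
    with the factor [expR (- kappa * u)]. *)
Lemma ou_abs_le (X b : R -> R) u : {within `[0, +oo[, continuous X} ->
  {within `[0, +oo[, continuous b} ->
  (forall t, 0 <= t -> X t = x0 + \int[mu]_(s in `[0, t]) (kappa * (theta - X s))
    + psi * b t) -> 0 <= u ->
  `|X u| <= `|x0| + `|theta| + psi * (expR (- kappa * u) *
    (`|b u| + \int[mu]_(v in `[0, u]) (`|b u - b v| * kern v))).
Proof.
move=> cX cb sde u0.
have cb' := within_continuous_itvW (T := u) (lexx 0) cb.
have e01 : 0 <= expR (- kappa * u) <= 1.
  by rewrite expR_ge0 -expR0 ler_expR mulNr oppr_le0 mulr_ge0// ltW.
have /andP[e0 e1] := e01.
pose J := \int[mu]_(v in `[0, u]) ((b u - b v) * kern v).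
have cJ : {within `[0, u], continuous (fun v => (b u - b v) * kern v)}.
  apply: within_continuous_mul => //.
  by apply: within_continuous_sub => //; exact: within_continuous_cst.
have XE : X u = expR (- kappa * u) * x0 + theta * (1 - expR (- kappa * u)) +
    psi * (expR (- kappa * u) * (b u + J)).
  rewrite (ou_explicit cX sde cb u0).
  have -> : \int[mu]_(v in `[0, u]) ((theta - psi * b v) * (kappa * expR (kappa * v))) =
      (theta - psi * b u) * \int[mu]_(v in `[0, u]) kern v + psi * J.
    rewrite -!RintegralZl//; try exact: within_continuous_integrable.
    rewrite -RintegralD//.
    - by apply: eq_Rintegral => v _; rewrite /kern; ring.
    - apply/within_continuous_integrable/within_continuous_mul => //.
      exact: within_continuous_cst.
    - apply/within_continuous_integrable/within_continuous_mul => //.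
      exact: within_continuous_cst.
  rewrite Rintegral_expR_kernel//.
  have e : expR (- kappa * u) * expR (kappa * u) = 1 by rewrite mulNr -expRD addNr expR0.
  transitivity (expR (- kappa * u) * x0 + (theta - psi * b u) *
     (expR (- kappa * u) * expR (kappa * u) - expR (- kappa * u)) +
     psi * (expR (- kappa * u) * J) + psi * b u); first by ring.
  by rewrite e; ring.
have Jle : `|J| <= \int[mu]_(v in `[0, u]) (`|b u - b v| * kern v).
  have := @le_normr_Rintegral _ _ _ mu `[0, u]%classic _ _ (within_continuous_integrable cJ).
  move=> /(_ _)/le_trans; apply => //.
  rewrite le_eqVlt; apply/orP; left; apply/eqP; apply: eq_Rintegral => v _.
  by rewrite normrM (ger0_norm (kern_ge0 v)).
rewrite XE (le_trans (ler_normD _ _))// lerD//.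
  rewrite (le_trans (ler_normD _ _))// lerD//.
    by rewrite normrM ger0_norm// ler_piMl.
  by rewrite normrM ler_piMr// ger0_norm ?subr_ge0// gerBl.
rewrite normrM (gtr0_norm hpsi) ler_pM2l// normrM (ger0_norm e0) ler_wpM2l//.
by rewrite (le_trans (ler_normD _ _))// lerD2l.
Qed.

End ou_moment.

Lemma lee_limn_einf (R : realType) (u v : (\bar R)^nat) :
  (forall n, (u n <= v n)%E) -> (limn_einf u <= limn_einf v)%E.
Proof.
move=> uv; rewrite !limn_einf_lim.
apply: lee_lim; [exact: is_cvg_einfs|exact: is_cvg_einfs|].
apply: nearW => n; apply: le_ereal_inf_tmp => _ [k /= nk <-].
by apply: le_trans (uv k); apply: ereal_inf_lbound; exists k.
Qed.

Section ou_process.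
Context d (Omega : measurableType d) (R : realType) (Q : probability Omega R).
Local Notation mu := (@lebesgue_measure R).
Variables (r : R -> R) (kappa theta psi x0 : R) (beta X : R -> {RV Q >-> R}).
Hypothesis hr : forall t, 0 <= t -> mu.-integrable `[0, t] (EFin \o r).
Hypothesis hpi : (\int[mu]_(u in `[0%R, +oo[) (discount r u)%:E < +oo)%E.
Hypotheses (hk : 0 < kappa) (hpsi : 0 < psi).
Hypothesis hbeta : is_brownian_motion beta.
Hypothesis hX : is_ornstein_uhlenbeck kappa theta psi x0 beta X.
Local Notation D := (discount r).

Lemma ou_ae_path : {ae Q, forall w, [/\ beta 0 w = 0,
  {within `[0, +oo[, continuous (beta ^~ w)} &
  forall t, 0 <= t -> X t w = x0 + \int[mu]_(s in `[0, t]) (kappa * (theta - X s w))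
            + psi * beta t w]}.
Proof.
by apply: filterS3 (bm_start hbeta) (bm_continuous hbeta) (ou_sde hX) => w ? ? ?; split.
Qed.

Lemma brownian_increment_integrable (W : R -> {RV Q >-> R}) (a b : R) :
  is_brownian_motion W -> 0 <= a -> a <= b ->
  Q.-integrable setT (EFin \o (fun w => W b w - W a w)).
Proof.
move=> hW a0 ab; apply/integrableP; split.
  by apply/measurable_EFinP; exact: measurable_funB.
by apply: le_lt_trans (brownian_abs hW a0 ab) _; rewrite ltry.
Qed.

(** The inequality [2 * sqrt x <= 1 + x] trades the square root for a polynomial, which integrates
    in closed form against the exponential kernel. *)
Lemma brownian_increment_abs (W : R -> {RV Q >-> R}) (a b : R) :
  is_brownian_motion W -> 0 <= a -> a <= b ->
  \int[Q]_w `|W b w - W a w| <= 1 + (b - a).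
Proof.
move=> hW a0 ab.
have iW := brownian_increment_integrable hW a0 ab.
rewrite -lee_fin fineK; last first.
  by apply: integrable_fin_num => //; exact: integrable_norm.
apply: le_trans (brownian_abs hW a0 ab) _; rewrite lee_fin.
have ba : 0 <= b - a by rewrite subr_ge0.
have := sqr_ge0 (1 - Num.sqrt (b - a)); rewrite sqrrB expr1n mul1r sqr_sqrtr//.
by rewrite -mulr_natl; lra.
Qed.

(** Independent of [u]; the two copies of [1 + kappa^-1] come from [expR_linear_bound] and
    [Rintegral_kernel_bound]. *)
Let C := `|x0| + `|theta| + psi * (1 + kappa^-1 + (1 + kappa^-1)).

(** The pathwise bound [ou_abs_le] contains a time integral of [|beta u - beta v|]. As [beta] is
    continuous only almost surely, this integral is handled as a limit of the finite sums in [Z n],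
    whose expectations are bounded termwise by [K n], and Fatou passes to the limit. *)
Lemma ou_first_moment u : 0 <= u -> (\int[Q]_w `|X u w|%:E <= C%:E)%E.
Proof.
move=> u0.
pose kern v := kappa * expR (kappa * v).
pose g n k := grid 0 u n k.
pose c n k := \int[mu]_(v in `[g n k, g n k.+1]) kern v.
pose e := expR (- kappa * u).
have e0 : 0 <= e by exact: expR_ge0.
have kern0 v : 0 <= kern v by rewrite mulr_ge0 ?expR_ge0// ltW.
have c0 n k : 0 <= c n k by exact: Rintegral_ge0.
have ik : mu.-integrable `[0, u] (EFin \o kern).
  apply/within_continuous_integrable/within_continuous_mul.
    exact: within_continuous_cst.
  exact: within_continuous_expRM.
(* The minimum with [u] changes nothing for the indices of the sum; it keeps the time in [[0, u]]
   for every natural [k], as the lemmas on sums ask. *)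
pose S n w := \sum_(k < n.+1) `|beta u w - beta (Num.min (g n k) u) w| * c n k.
pose Z n w := `|x0| + `|theta| + psi * (e * (`|beta u w - beta 0 w| + S n w)).
have tagP n k : grid 0 u n k <= grid 0 u n k <= grid 0 u n k.+1.
  by rewrite lexx grid_nd.
have mB s : measurable_fun setT (beta s) by exact: measurable_funP.
have mX : measurable_fun setT (fun w => `|X u w|) by exact: measurableT_comp.
have iB s : 0 <= s <= u -> Q.-integrable setT (EFin \o (fun w => `|beta u w - beta s w|)).
  by move=> /andP[s0 su]; apply: integrable_norm => //; exact: brownian_increment_integrable.
have gmin n k : 0 <= Num.min (g n k) u <= u.
  by rewrite ge_min lexx orbT andbT le_min u0 grid_ge.
have iBc n k : Q.-integrable setT
    (EFin \o (fun w => `|beta u w - beta (Num.min (g n k) u) w| * c n k)).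
  under [X in _.-integrable _ X]eq_fun do rewrite /= EFinM.
  by apply: integrableZr => //; exact: iB.
have iS n : Q.-integrable setT (EFin \o S n).
  exact: (integrable_sumR (F := fun k w => `|beta u w - beta (Num.min (g n k) u) w| * c n k)).
have iB0 : Q.-integrable setT (EFin \o (fun w => `|beta u w - beta 0 w|)).
  by apply: iB; rewrite lexx.
have iBS n : Q.-integrable setT (EFin \o (fun w => `|beta u w - beta 0 w| + S n w)).
  exact: (integrableD measurableT iB0 (iS n)).
have ieBS n : Q.-integrable setT (EFin \o (fun w => e * (`|beta u w - beta 0 w| + S n w))).
  under [X in _.-integrable _ X]eq_fun do rewrite /= EFinM.
  exact: (integrableZl measurableT e (iBS n)).
have ipBS n : Q.-integrable setT
    (EFin \o (fun w => psi * (e * (`|beta u w - beta 0 w| + S n w)))).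
  under [X in _.-integrable _ X]eq_fun do rewrite /= EFinM.
  exact: (integrableZl measurableT psi (ieBS n)).
have icst : Q.-integrable setT (EFin \o cst (`|x0| + `|theta|)).
  exact: finite_measure_integrable_cst.
have iZ n : Q.-integrable setT (EFin \o Z n).
  exact: (integrableD measurableT icst (ipBS n)).
have Z0 n w : 0 <= Z n w.
  rewrite addr_ge0// mulr_ge0 ?(ltW hpsi)// mulr_ge0// addr_ge0//.
  by apply: sumr_ge0 => k _; rewrite mulr_ge0.
pose K n := `|x0| + `|theta| + psi * (e * ((1 + u) +
  \sum_(k < n.+1) (1 + (u - g n k)) * c n k)).
have ES n : \int[Q]_w S n w <= \sum_(k < n.+1) (1 + (u - g n k)) * c n k.
  rewrite (Rintegral_sum (F := fun k w => `|beta u w - beta (Num.min (g n k) u) w| * c n k))//.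
  apply: ler_sum => k _; have /andP[g0 gu] := gmin n k.
  rewrite RintegralZr//; last exact: iB.
  apply: ler_wpM2r => //; apply: le_trans (brownian_increment_abs hbeta g0 gu) _.
  by rewrite min_l// grid_le// ltnW.
have EZ n : \int[Q]_w Z n w <= K n.
  rewrite RintegralD//.
  rewrite Rintegral_cst// [X in fine X](_ : _ = 1%E); last exact: probability_setT.
  rewrite mulr1 /K lerD2l.
  rewrite !RintegralZl// ler_pM2l// ler_wpM2l// RintegralD// lerD//.
  by have := brownian_increment_abs hbeta (lexx 0) u0; rewrite subr0.
pose L := `|x0| + `|theta| + psi * (e * ((1 + u) +
  \int[mu]_(v in `[0, u]) ((1 + (u - v)) * kern v))).
have KL : K n @[n --> \oo] --> L.
  apply: cvgD; first exact: cvg_cst.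
  apply: cvgMr; apply: cvgMr; apply: cvgD; first exact: cvg_cst.
  apply: (stieltjes_sum_cvg (f := fun v => 1 + (u - v)) u0 _ ik tagP).
  move=> v; apply: cvgD; first exact: cvg_cst.
  by apply: cvgB; [exact: cvg_cst|exact: cvg_id].
have LC : L <= C.
  rewrite /L /C lerD2l ler_pM2l// mulrDr lerD//; first exact: expR_linear_bound.
  exact: Rintegral_kernel_bound.
apply: (@le_trans _ _ (\int[Q]_w limn_einf (fun n => (Z n w)%:E))%E).
  apply: ae_ge0_le_integral => //.
  - exact/measurable_EFinP.
  - move=> w _; apply: (@le_trans _ _ (limn_einf (fun=> 0%E))).
      by rewrite (cvg_limn_einf_sup (cvg_cst 0%E)).1.
    by apply: lee_limn_einf => n; rewrite lee_fin.
  - rewrite (_ : (fun w => _) =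
        (fun w => - limn_esup (-%E \o (fun n => (Z n w)%:E)))%E); last first.
      by apply/funext => w; rewrite limn_esupN oppeK.
    apply: measurableT_comp => //.
    apply: (measurable_fun_limn_esup (f := fun n w => (- (Z n w)%:E)%E)) => // n.
    by apply: measurableT_comp => //; exact: (measurable_int _ (iZ n)).
  - apply: filterS ou_ae_path => w [b0 cb sde] _.
    have ZW : Z n w @[n --> \oo] --> `|x0| + `|theta| + psi * (e *
       (`|beta u w| + \int[mu]_(v in `[0, u]) (`|beta u w - beta v w| * kern v))).
      rewrite /Z b0; apply: cvgD; first exact: cvg_cst.
      apply: cvgMr; apply: cvgMr; rewrite subr0; apply: cvgD; first exact: cvg_cst.
      have cb' := within_continuous_itvW (T := u) (lexx 0) cb.
      have cc : continuous (fun v => `|beta u w - (beta^~ w \o clamp 0 u) v|).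
        move=> v; apply: (cvg_comp _ (fun x : R => `|x|)); last exact: norm_continuous.
        by apply: cvgB; [exact: cvg_cst|exact: continuous_comp_clamp].
      have := stieltjes_sum_cvg u0 cc ik tagP.
      rewrite (_ : \int[mu]_(v in `[0, u]) (`|beta u w - (beta^~ w \o clamp 0 u) v| * kern v) =
        \int[mu]_(v in `[0, u]) (`|beta u w - beta v w| * kern v)); last first.
        by apply: eq_Rintegral => v; rewrite inE/= in_itv/= => vu; rewrite clamp_id.
      apply: cvg_trans; apply: near_eq_cvg; apply: nearW => n; rewrite /S.
      apply: eq_bigr => k _; rewrite /= clamp_id ?min_l//.
        by rewrite grid_le// ltnW.
      by rewrite grid_ge//= grid_le// ltnW.
    rewrite (_ : limn_einf _ = (`|x0| + `|theta| + psi * (e *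
       (`|beta u w| + \int[mu]_(v in `[0, u]) (`|beta u w - beta v w| * kern v))))%:E).
      rewrite lee_fin; apply: (ou_abs_le hk hpsi (X := X ^~ w) (b := beta ^~ w)) => //.
      exact: (ou_continuous hX).
    apply: (@cvg_limn_einf_sup _ _ _ _).1; apply/fine_cvgP; split; first exact: nearW.
    exact: ZW.
apply: (le_trans (fatou _ _ _ _)) => //.
- by move=> n; exact: (measurable_int _ (iZ n)).
- by move=> n w _; rewrite lee_fin.
apply: (@le_trans _ _ (limn_einf (fun n => (K n)%:E))).
  apply: lee_limn_einf => n; rewrite -[leLHS]fineK ?lee_fin ?EZ//.
  by apply: integrable_fin_num => //; exact: iZ.
rewrite (@cvg_limn_einf_sup _ _ L%:E _).1 ?lee_fin//.
by apply/fine_cvgP; split; [exact: nearW|exact: KL].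
Qed.

End ou_process.

(** * Integrability of the discounted dividends *)

Section discounted_dividends.
Context d (Omega : measurableType d) (R : realType) (Q : probability Omega R).
Local Notation mu := (@lebesgue_measure R).
Variables (r : R -> R) (kappa theta psi x0 : R) (beta X : R -> {RV Q >-> R}).
Hypothesis hr : forall t, 0 <= t -> mu.-integrable `[0, t] (EFin \o r).
Hypothesis hpi : (\int[mu]_(u in `[0%R, +oo[) (discount r u)%:E < +oo)%E.
Hypotheses (hk : 0 < kappa) (hpsi : 0 < psi).
Hypothesis hbeta : is_brownian_motion beta.
Hypothesis hX : is_ornstein_uhlenbeck kappa theta psi x0 beta X.
Local Notation D := (discount r).

Lemma ou_integrable u : 0 <= u -> Q.-integrable setT (EFin \o X u).
Proof.
move=> u0; apply/integrableP; split; first exact/measurable_EFinP.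
by apply: le_lt_trans (ou_first_moment hk hpsi hbeta hX u0) _; rewrite ltry.
Qed.

Variable a : R.
Hypothesis a0 : 0 <= a.

Let g (z : R * Omega) : R := (D \_ `[a, +oo[) z.1 * X (Num.max 0 z.1) z.2.

Let mD : measurable_fun setT (D \_ `[a, +oo[).
Proof. by apply/(measurable_restrictT _ _).1 => //; exact: measurable_discount. Qed.

Let mg : measurable_fun setT g.
Proof.
apply: measurable_funM; first exact: measurableT_comp.
by apply: (measurable_process (Y := fun u => X u)) => //; exact: (ou_continuous hX).
Qed.

Let gE w : (fun u => g (u, w)) = (fun u => D u * X u w) \_ `[a, +oo[.
Proof.
apply/funext => u; rewrite /g /= !patchE; case: ifPn => [|_]; last by rewrite mul0r.
by rewrite inE/= in_itv/= andbT => au; rewrite max_r// (le_trans a0).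
Qed.

(** Tonelli: the inner expectation is at most [D u * C] with [C] independent of [u], and [D] is
    integrable. *)
Let ig : (mu \x Q)%E.-integrable setT (EFin \o g).
Proof.
apply/integrable12ltyP; first exact/measurable_EFinP.
pose C := `|x0| + `|theta| + psi * (1 + kappa^-1 + (1 + kappa^-1)).
have iD : mu.-integrable setT (EFin \o (D \_ `[a, +oo[)).
  rewrite -restrict_EFin; apply/integrable_restrict => //; rewrite setTI.
  exact: (integrable_discount hr hpi).
have D0 u : 0 <= (D \_ `[a, +oo[) u.
  by rewrite patchE; case: ifP => // _; rewrite ltW// discount_gt0.
apply: (@le_lt_trans _ _ (\int[mu]_u ((D \_ `[a, +oo[) u * C)%:E)%E).
  apply: ge0_le_integral => //.
  - by move=> u _; exact: integral_ge0.
  - apply: (measurable_fun_fubini_tonelli_F (abse \o (EFin \o g))) => //=.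
    by apply: measurableT_comp => //; exact/measurable_EFinP.
  - by apply/measurable_EFinP; exact: measurable_funM.
  - move=> u _ /=; under eq_integral do rewrite /g/= normrM ger0_norm// EFinM.
    rewrite ge0_integralZl//; last 2 first.
      by apply/measurable_EFinP; exact: measurableT_comp.
      by rewrite lee_fin.
    rewrite EFinM lee_wpmul2l ?lee_fin//.
    by apply: (ou_first_moment hk hpsi hbeta hX); rewrite le_max lexx.
have iDC : mu.-integrable setT (EFin \o (fun u => (D \_ `[a, +oo[) u * C)).
  under [X in _.-integrable _ X]eq_fun do rewrite /= EFinM.
  by apply: integrableZr.
by have := integrable_fin_num measurableT iDC; rewrite fin_numElt => /andP[].
Qed.

Lemma ae_integrable_dividends :
  {ae Q, forall w, mu.-integrable `[a, +oo[ (EFin \o (fun u => D u * X u w))}.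
Proof.
apply: filterS (ae_integrable2 ig) => w /=.
have -> : (fun u => (g (u, w))%:E) = (EFin \o (fun u => D u * X u w)) \_ `[a, +oo[.
  by rewrite restrict_EFin -gE.
by move=> /integrable_restrict; rewrite setTI; apply.
Qed.

Let ddE w : discounted_dividends r X a w = fine (\int[mu]_u (g (u, w))%:E)%E.
Proof.
by rewrite /discounted_dividends Rintegral_mkcond -gE.
Qed.

Lemma measurable_discounted_dividends :
  measurable_fun setT (discounted_dividends r X a).
Proof.
rewrite (_ : discounted_dividends r X a = fine \o fubini_G mu (EFin \o g)).
  by apply: measurableT_comp => //; exact: measurable_fubini_G ig.
by apply/funext => w; rewrite ddE.
Qed.

Lemma integrable_discounted_dividends :
  Q.-integrable setT (EFin \o discounted_dividends r X a).
Proof.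
have mdd := measurable_discounted_dividends.
apply/integrableP; split; first exact/measurable_EFinP.
have meg : measurable_fun setT (EFin \o g) by exact/measurable_EFinP.
have := (integrable21ltyP mu Q meg).1 ig; apply: le_lt_trans.
apply: ge0_le_integral => //.
- by apply/measurable_EFinP; exact: measurableT_comp.
- have mag : measurable_fun setT (abse \o (EFin \o g)) by exact: measurableT_comp.
  exact: (@measurable_fun_fubini_tonelli_G _ _ (measurableTypeR R) Omega R mu
    (abse \o (EFin \o g)) mag (fun=> abse_ge0 _)).
move=> w _; rewrite /= ddE.
apply: (@le_trans _ _ `|\int[mu]_u (g (u, w))%:E|%E).
  (* [fine] sends an infinite integral to 0, so the bound also covers the exceptional paths. *)
  by case: (\int[mu]_u (g (u, w))%:E)%E => [x| |] //=; rewrite normr0 leey.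
apply: le_abse_integral => //.
exact: (measurableT_comp meg (measurable_pair2 w)).
Qed.

End discounted_dividends.

(** * The price and its residual *)

Lemma cvg_same_limit (R : realType) (u v : R^nat) (a b : R) :
  (forall n, u n = v n) -> u n @[n --> \oo] --> a -> v n @[n --> \oo] --> b -> a = b.
Proof. by move=> /funext -> h1 h2; exact: (cvg_unique _ h1 h2). Qed.

Section bounded_expectations.
Context d (Omega : measurableType d) (R : realType) (Q : probability Omega R).

Lemma measurable_cosT (f : Omega -> R) : measurable_fun setT f ->
  measurable_fun setT (fun w => cos (f w)).
Proof. by move=> mf; apply: measurableT_comp => //; exact: measurable_cos. Qed.

Lemma Rintegral_cos_cvg (f_ : (Omega -> R)^nat) (f : Omega -> R) :
  (forall n, measurable_fun setT (f_ n)) -> measurable_fun setT f ->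
  {ae Q, forall w, f_ n w @[n --> \oo] --> f w} ->
  \int[Q]_w cos (f_ n w) @[n --> \oo] --> \int[Q]_w cos (f w).
Proof.
move=> mf_ mf ff.
apply: (@Rintegral_dominated_cvg _ _ _ _ _ _ _ (cst 1)) => //.
- by move=> n; exact: measurable_cosT.
- exact: measurable_cosT.
- apply: filterS ff => w h _; apply: (cvg_comp _ cos h); exact: continuous_cos.
- exact: finite_measure_integrable_cst.
- by apply: aeW => w _ n; exact: cos_max.
Qed.

Lemma ae_eq_Rintegral_cos (f g : Omega -> R) :
  measurable_fun setT f -> measurable_fun setT g ->
  {ae Q, forall w, f w = g w} -> \int[Q]_w cos (f w) = \int[Q]_w cos (g w).
Proof.
move=> mf mg fg; congr fine; apply: ae_eq_integral => //.
- by apply/measurable_EFinP; exact: measurable_cosT.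
- by apply/measurable_EFinP; exact: measurable_cosT.
- by apply: filterS fg => w fgw _; rewrite fgw.
Qed.

End bounded_expectations.

(** * Joint cosine transform of the past, the dividend noise and the information noise *)

Section characteristic_function.
Context d (Omega : measurableType d) (R : realType) (Q : probability Omega R).
Local Notation mu := (@lebesgue_measure R).
Variables (r : R -> R) (kappa theta psi x0 : R) (beta B X : R -> {RV Q >-> R}).
Hypothesis hr : forall t, 0 <= t -> mu.-integrable `[0, t] (EFin \o r).
Hypothesis hpi : (\int[mu]_(u in `[0%R, +oo[) (discount r u)%:E < +oo)%E.
Hypotheses (hk : 0 < kappa) (hpsi : 0 < psi).
Hypotheses (hbeta : is_brownian_motion beta) (hB : is_brownian_motion B).
Hypothesis hbetaB : independent_systems Q
  (sigma_of `[0, +oo[ beta) (sigma_of `[0, +oo[ B).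
Hypothesis hX : is_ornstein_uhlenbeck kappa theta psi x0 beta X.
Local Notation D := (discount r).
Variable t : R.
Hypothesis t0 : 0 <= t.

Let dd := discounted_dividends r X.

(** Increments from [B 0] rather than values of [B], since [B 0] vanishes only almost surely while
    the increment formulas hold exactly. *)
Definition noise_sum (s : seq (R * R)) (w : Omega) : R :=
  \sum_(x <- s) x.2 * (B x.1 w - B 0 w).

Definition nonneg_times (s : seq (R * R)) := path <=%O (0:R) (map fst s).

Let times_ge0 s : nonneg_times s -> all (fun x : R * R => 0 <= x.1) s.
Proof.
rewrite /nonneg_times => p; rewrite -(all_map fst (fun y => 0 <= y)).
by apply: order_path_min p; exact: le_trans.
Qed.

Lemma measurable_noise_sum s : measurable_fun setT (noise_sum s).
Proof.
elim: s => [|x s IH]; rewrite /noise_sum.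
  by under eq_fun do rewrite big_nil; exact: measurable_cst.
under eq_fun do rewrite big_cons; apply: measurable_funD; last exact: IH.
by apply: measurable_funM => //; exact: measurable_funB.
Qed.

Let PB := preimages_of `[0, +oo[%classic B.
Let Pbeta := preimages_of `[0, +oo[%classic beta.

Let sigma_noise_sum s : nonneg_times s -> sigma_measurable PB (noise_sum s).
Proof.
have mB u : 0 <= u -> sigma_measurable PB (B u).
  move=> u0; apply: (sigma_measurable_preimages_of (i := u) (Y := B)).
  by rewrite /= in_itv/= andbT.
move=> /times_ge0; elim: s => [|x s IH] /=.
  move=> _; rewrite (_ : noise_sum _ = cst 0); first exact: measurable_cst.
  by apply/funext => w; rewrite /noise_sum big_nil.
move=> /andP[x0' s0].
rewrite (_ : noise_sum _ = fun w => x.2 * (B x.1 w - B 0 w) + noise_sum s w).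
  apply: measurable_funD; last exact: IH.
  by apply: measurable_funM => //; apply: measurable_funB; exact: mB.
by apply/funext => w; rewrite /noise_sum big_cons.
Qed.

(** A constant phase [- (pi / 2)] turns the sine into a cosine, and the transform then contains the
    factor [cos (pi / 2)]. *)
Lemma noise_sum_sin s : nonneg_times s -> \int[Q]_w sin (noise_sum s w) = 0.
Proof.
move=> s0; transitivity (\int[Q]_w cos (cst (- (pi / 2)) w + noise_sum s w)).
  apply: eq_Rintegral => w _; rewrite addrC cosB cos_pihalf sin_pihalf.
  by rewrite mulr0 add0r mulr1.
rewrite (brownian_cos_seq hB (lexx 0) s0) /=; last exact: measurable_cst.
rewrite Rintegral_cst// cosN cos_pihalf mul0r mulr0//.
Qed.

Lemma noise_sum_cos s : nonneg_times s ->
  \int[Q]_w cos (noise_sum s w) = expR (- (brownian_var 0 s / 2)).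
Proof.
move=> s0; transitivity (\int[Q]_w cos (cst 0 w + noise_sum s w)).
  by apply: eq_Rintegral => w _; rewrite add0r.
rewrite (brownian_cos_seq hB (lexx 0) s0) /=; last exact: measurable_cst.
rewrite Rintegral_cst// cos0 mul1r [X in fine X](_ : _ = 1%E) ?mulr1//.
exact: probability_setT.
Qed.

Lemma cos_noise_sum V s : nonneg_times s -> sigma_measurable Pbeta V ->
  \int[Q]_w cos (V w + noise_sum s w) =
  expR (- (brownian_var 0 s / 2)) * \int[Q]_w cos (V w).
Proof.
move=> s0 mV; rewrite indep_cosD.
- by rewrite noise_sum_cos// mulrC.
- by apply: sigma_measurable_fun mV; exact: preimages_of_measurable.
- exact: measurable_noise_sum.
- move=> A C mA mC; apply: hbetaB.
    by move/sigma_measurableP : mV; exact.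
  by have /sigma_measurableP := sigma_noise_sum s0; exact.
- exact: noise_sum_sin.
Qed.

Definition past_measurable := @sigma_measurable _ Omega R (preimages_of `[0, t]%classic beta).

Let q T := q_smooth r kappa t T.

(** A discretised Wiener integral of [psi * q] against [beta] on [[t, T]]; its variance is
    [mart_var]. The right-end tags are those of [stieltjes_by_parts_cvg]. *)
Let mart_sum (T : R) n (w : Omega) : R := \sum_(k < n.+1)
  psi * q T (grid t T n k.+1) * (beta (grid t T n k.+1) w - beta (grid t T n k) w).

Let mart_var (T : R) n : R := \sum_(k < n.+1)
  (psi * q T (grid t T n k.+1)) ^+ 2 * (grid t T n k.+1 - grid t T n k).

Let cos_mart_sum T n V l s : t <= T -> past_measurable V -> nonneg_times s ->
  \int[Q]_w cos (V w + l * mart_sum T n w + noise_sum s w) =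
  expR (- (l ^+ 2 * mart_var T n / 2)) * expR (- (brownian_var 0 s / 2)) *
  \int[Q]_w cos (V w).
Proof.
move=> tT mV s0.
have u0 : 0 <= grid t T n 0 by rewrite grid0.
have mV' : sigma_measurable (preimages_of `[0, grid t T n 0]%classic beta) V.
  by rewrite grid0.
have [mS ES] := brownian_cos_sum hbeta (fun k => l * (psi * q T (grid t T n k.+1)))
  n.+1 u0 (fun k => grid_nd n k tT) mV'.
have E w : V w + l * mart_sum T n w = V w + \sum_(k < n.+1)
    l * (psi * q T (grid t T n k.+1)) * (beta (grid t T n k.+1) w - beta (grid t T n k) w).
  by congr (_ + _); rewrite /mart_sum mulr_sumr; apply: eq_bigr => k _; rewrite !mulrA.
under eq_Rintegral do rewrite E.
rewrite cos_noise_sum//; last first.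
  apply: sigma_measurableW mS; apply: preimages_ofS => x /=.
  by rewrite !in_itv/= andbT => /andP[].
rewrite ES mulrA; congr (_ * _); rewrite mulrC; congr (expR (- (_ / 2)) * _).
by rewrite /mart_var mulr_sumr; apply: eq_bigr => k _; rewrite exprMn mulrA.
Qed.

Let measurable_mart_sum T n : measurable_fun setT (mart_sum T n).
Proof.
rewrite /mart_sum; elim: n.+1 => [|m IH].
  by under eq_fun do rewrite big_ord0; exact: measurable_cst.
under eq_fun do rewrite big_ord_recr/=.
by apply: measurable_funD; [exact: IH|apply: measurable_funM => //; exact: measurable_funB].
Qed.

Let vT T := psi ^+ 2 * \int[mu]_(u in `[t, T]) (q T u ^+ 2).

Let mart_var_cvg T : t <= T -> mart_var T n @[n --> \oo] --> vT T.
Proof.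
move=> tT; pose f u := (psi * (q T \o clamp t T) u) ^+ 2.
have cq := @within_continuous_q _ r kappa hr t T t0 tT.
have cf : continuous f.
  move=> u; have c : {for u, continuous (fun u => psi * (q T \o clamp t T) u)}.
    by apply: cvgMr; exact: continuous_comp_clamp.
  exact: (cvgM c c).
have tagP n k : grid t T n k <= grid t T n k.+1 <= grid t T n k.+1.
  by rewrite lexx grid_nd.
have i1 : mu.-integrable `[t, T] (EFin \o cst (1:R)).
  exact/within_continuous_integrable/within_continuous_cst.
have := stieltjes_sum_cvg tT cf i1 tagP.
have -> : \int[mu]_(u in `[t, T]) (f u * cst 1 u) = vT T.
  rewrite /vT -RintegralZl//; last first.
    by apply/within_continuous_integrable/within_continuous_mul.
  apply: eq_Rintegral => u; rewrite inE/= in_itv/= => tu.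
  by rewrite /f mulr1 /= clamp_id// exprMn.
apply: cvg_trans; apply: near_eq_cvg; apply: nearW => n.
apply: eq_bigr => k _; rewrite /f/= clamp_id; last first.
  by rewrite grid_ge//= grid_le.
congr (_ * _); rewrite Rintegral_cst// mul1r [X in fine X]lebesgue_measure_itv/= lte_fin.
case: ltP => [_|] //=.
by move=> h; apply/eqP; rewrite eq_sym subr_eq0 eq_le h grid_nd.
Qed.

(** The dividends over [[t, T]] minus their affine prediction from [X t]: the noise [M] with the
    horizon cut at [T]. *)
Let MT (T : R) w := dd t w - dd T w -
  (q T t * X t w + theta * (\int[mu]_(u in `[t, T]) D u - q T t)).

Let measurable_dd a : 0 <= a -> measurable_fun setT (dd a).
Proof. exact: (measurable_discounted_dividends hr hpi hk hpsi hbeta hX). Qed.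

Let measurable_MT T : t <= T -> measurable_fun setT (MT T).
Proof.
move=> tT; apply: measurable_funB.
  by apply: measurable_funB; apply: measurable_dd => //; exact: le_trans tT.
by apply: measurable_funD => //; exact: measurable_funM.
Qed.

(** Almost sure only: the tails may be subtracted on those paths where the discounted dividends are
    integrable up to infinity. *)
Lemma discounted_dividends_split a T : 0 <= a -> a <= T -> {ae Q, forall w,
  dd a w - dd T w = \int[mu]_(u in `[a, T]) (D u * X u w)}.
Proof.
move=> a0 aT.
apply: filterS (ae_integrable_dividends hr hpi hk hpsi hbeta hX a0) => w iw.
have iT : mu.-integrable `]T, +oo[ (EFin \o (fun u => D u * X u w)).
  apply: integrableS iw => // u /=; rewrite !in_itv/= !andbT => /ltW; exact: le_trans.
rewrite /dd /discounted_dividends -[X in _ - X]Rintegral_itv_obnd_cbnd//.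
by rewrite -(Rintegral_itvB (x := T) iw) ?bnd_simp//; ring.
Qed.

(** By [ou_discounted_path], [MT] is an ordinary integral of the path of [beta], and
    [stieltjes_by_parts_cvg] recognises it as the limit of the sums, path by path. *)
Let mart_sum_cvg T : t <= T ->
  {ae Q, forall w, mart_sum T n w @[n --> \oo] --> MT T w}.
Proof.
move=> tT; apply: filterS2 (discounted_dividends_split t0 tT) (ou_ae_path hbeta hX).
move=> w ddE [b0 cb sde].
have cX : {within `[0, +oo[, continuous (X ^~ w)} by exact: (ou_continuous hX).
have := ou_discounted_path hr t0 tT cX cb sde => pathE.
have -> : MT T w = psi * \int[mu]_(u in `[t, T])
    ((beta u w - beta t w) * (D u - kappa * q T u)).
  by rewrite /MT ddE pathE -/(q T); ring.
have cb' : {within `[t, T], continuous (fun u => beta u w - beta t w)}.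
  apply: within_continuous_sub; last exact: within_continuous_cst.
  exact: within_continuous_itvW cb.
have lim := stieltjes_by_parts_cvg tT (within_continuous_q hr t0 tT)
  (within_continuous_dq hr t0 tT)
  (fun u h => @q_smooth_derive _ r kappa hr t T t0 u h) cb'
  (subrr _) (q_smooth_end _ _ _ _).
have : psi * \sum_(k < n.+1) q T (grid t T n k.+1) *
    ((beta (grid t T n k.+1) w - beta t w) - (beta (grid t T n k) w - beta t w))
    @[n --> \oo] --> psi * \int[mu]_(u in `[t, T])
      ((beta u w - beta t w) * (D u - kappa * q T u)) by apply: cvgMr; exact: lim.
apply: cvg_trans; apply: near_eq_cvg; apply: nearW => n.
by rewrite /mart_sum mulr_sumr; apply: eq_bigr => k _; rewrite mulrA; congr (_ * _); ring.
Qed.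

Let cvg_expRN (u_ : R^nat) (l c : R) : u_ n @[n --> \oo] --> l ->
  expR (- (c * u_ n / 2)) @[n --> \oo] --> expR (- (c * l / 2)).
Proof.
move=> ul; apply: (cvg_comp (fun n => - (c * u_ n / 2)) expR); last exact: continuous_expR.
by apply: cvgN; apply: cvgMl; apply: cvgMr.
Qed.

Let cos_MT T V l s : t <= T -> past_measurable V -> nonneg_times s ->
  \int[Q]_w cos (V w + l * MT T w + noise_sum s w) =
  expR (- (l ^+ 2 * vT T / 2)) * expR (- (brownian_var 0 s / 2)) *
  \int[Q]_w cos (V w).
Proof.
move=> tT mV s0.
have mV' : measurable_fun setT V.
  by apply: sigma_measurable_fun mV; exact: preimages_of_measurable.
have lim : \int[Q]_w cos (V w + l * mart_sum T n w + noise_sum s w) @[n --> \oo] -->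
    \int[Q]_w cos (V w + l * MT T w + noise_sum s w).
  apply: Rintegral_cos_cvg.
  - move=> n; apply: measurable_funD; last exact: measurable_noise_sum.
    by apply: measurable_funD => //; exact: measurable_funM.
  - apply: measurable_funD; last exact: measurable_noise_sum.
    by apply: measurable_funD => //; apply: measurable_funM => //; exact: measurable_MT.
  - apply: filterS (mart_sum_cvg tT) => w h; apply: cvgD; last exact: cvg_cst.
    by apply: cvgD; [exact: cvg_cst|apply: cvgMr].
apply: (cvg_same_limit (fun n => cos_mart_sum n l tT mV s0) lim).
by apply: cvgMl; apply: cvgMl; apply: cvg_expRN; exact: mart_var_cvg.
Qed.

(** The prediction of the discounted dividends from [X t] alone; [price_noise] is the [M], and
    [price_var] the [v], of the overview. *)
Definition price_drift (w : Omega) : R :=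
  theta * p_coef r t + q_coef r kappa t * (X t w - theta).

Definition price_noise (w : Omega) : R := dd t w - price_drift w.

Definition price_var : R :=
  psi ^+ 2 * \int[mu]_(u in `[t, +oo[) (q_coef r kappa u ^+ 2).

Lemma measurable_price_drift : measurable_fun setT price_drift.
Proof.
apply: measurable_funD => //; apply: measurable_funM => //.
exact: measurable_funB.
Qed.

Lemma measurable_price_noise : measurable_fun setT price_noise.
Proof.
by apply: measurable_funB; [exact: measurable_dd|exact: measurable_price_drift].
Qed.

Let T_ n : R := t + n%:R.

Let tT_ n : t <= T_ n. Proof. by rewrite lerDl. Qed.

Let q_cvg : q (T_ n) t @[n --> \oo] --> q_coef r kappa t.
Proof.
have := q_trunc_cvg hr hpi hk t0 (lexx t).
apply: cvg_trans; apply: near_eq_cvg; apply: nearW => n.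
by rewrite (q_truncE kappa hr t0 (T := T_ n))// lexx tT_.
Qed.

Let MT_cvg : {ae Q, forall w, MT (T_ n) w @[n --> \oo] --> price_noise w}.
Proof.
have h1 := ae_integrable_dividends hr hpi hk hpsi hbeta hX t0.
have h2 n := discounted_dividends_split t0 (tT_ n).
apply: filterS2 h1 (ae_foralln h2) => w iw sw.
have Elim : dd t w - dd (T_ n) w @[n --> \oo] --> dd t w.
  have := Rintegral_itvy_cvg (lexx t) iw.
  by apply: cvg_trans; apply: near_eq_cvg; apply: nearW => n; rewrite sw.
rewrite /MT /price_noise /price_drift; apply: cvgB; first exact: Elim.
rewrite (_ : theta * p_coef r t + q_coef r kappa t * (X t w - theta) =
   q_coef r kappa t * X t w + theta * (p_coef r t - q_coef r kappa t)); last by ring.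
apply: cvgD; first by apply: cvgMl; exact: q_cvg.
apply: cvgMr; apply: cvgB; last exact: q_cvg.
exact: Rintegral_itvy_cvg (lexx t) (integrable_discount hr hpi t0).
Qed.

(** Both sides are limits of the identity with horizon [t + n]: the cosines by dominated
    convergence, the variances by [Rintegral_q_sqr_cvg]. *)
Lemma cos_price_noise_past V l s : past_measurable V -> nonneg_times s ->
  \int[Q]_w cos (V w + l * price_noise w + noise_sum s w) =
  expR (- (l ^+ 2 * price_var / 2)) * expR (- (brownian_var 0 s / 2)) *
  \int[Q]_w cos (V w).
Proof.
move=> mV s0.
have mV' : measurable_fun setT V.
  by apply: sigma_measurable_fun mV; exact: preimages_of_measurable.
have lim : \int[Q]_w cos (V w + l * MT (T_ n) w + noise_sum s w) @[n --> \oo] -->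
    \int[Q]_w cos (V w + l * price_noise w + noise_sum s w).
  apply: Rintegral_cos_cvg.
  - move=> n; apply: measurable_funD; last exact: measurable_noise_sum.
    by apply: measurable_funD => //; apply: measurable_funM => //; exact: measurable_MT.
  - apply: measurable_funD; last exact: measurable_noise_sum.
    apply: measurable_funD => //; apply: measurable_funM => //.
    exact: measurable_price_noise.
  - apply: filterS MT_cvg => w h; apply: cvgD; last exact: cvg_cst.
    by apply: cvgD; [exact: cvg_cst|apply: cvgMr].
apply: (cvg_same_limit (fun n => cos_MT l (tT_ n) mV s0) lim).
apply: cvgMl; apply: cvgMl; apply: cvg_expRN; apply: cvgMr.
exact: Rintegral_q_sqr_cvg.
Qed.

(** An almost sure limit replaces measurability for the raw past of [beta], whose sigma-algebra is
    not completed. Measurability on the whole space is a separate clause because such a limit leaves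
    [V] free on a null set. *)
Definition past_limit (V : Omega -> R) := measurable_fun setT V /\
  exists V_ : (Omega -> R)^nat, (forall n, past_measurable (V_ n)) /\
    {ae Q, forall w, V_ n w @[n --> \oo] --> V w}.

Lemma past_measurable_limit V : past_measurable V -> past_limit V.
Proof.
move=> mV; split.
  by apply: sigma_measurable_fun mV; exact: preimages_of_measurable.
by exists (fun=> V); split => //; apply: aeW => w; exact: cvg_cst.
Qed.

Lemma past_limitD V W : past_limit V -> past_limit W ->
  past_limit (fun w => V w + W w).
Proof.
move=> [mV [V_ [pV cV]]] [mW [W_ [pW cW]]]; split; first exact: measurable_funD.
exists (fun n w => V_ n w + W_ n w); split.
  by move=> n; apply: measurable_funD; [exact: pV|exact: pW].
by apply: filterS2 cV cW => w h1 h2; exact: cvgD.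
Qed.

Lemma past_limitZ c V : past_limit V -> past_limit (fun w => c * V w).
Proof.
move=> [mV [V_ [pV cV]]]; split; first exact: measurable_funM.
exists (fun n w => c * V_ n w); split.
  by move=> n; apply: measurable_funM => //; exact: pV.
by apply: filterS cV => w h1; exact: cvgMr.
Qed.

Lemma cos_price_noise V l s : past_limit V -> nonneg_times s ->
  \int[Q]_w cos (V w + l * price_noise w + noise_sum s w) =
  expR (- (l ^+ 2 * price_var / 2)) * expR (- (brownian_var 0 s / 2)) *
  \int[Q]_w cos (V w).
Proof.
move=> [mV [V_ [pV cV]]] s0.
have mV_ n : measurable_fun setT (V_ n).
  by apply: sigma_measurable_fun (pV n); exact: preimages_of_measurable.
have lim : \int[Q]_w cos (V_ n w + l * price_noise w + noise_sum s w) @[n --> \oo] -->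
    \int[Q]_w cos (V w + l * price_noise w + noise_sum s w).
  have m (Y : Omega -> R) : measurable_fun setT Y ->
      measurable_fun setT (fun w => Y w + l * price_noise w + noise_sum s w).
    move=> mY; apply: measurable_funD; last exact: measurable_noise_sum.
    apply: measurable_funD => //; apply: measurable_funM => //.
    exact: measurable_price_noise.
  apply: Rintegral_cos_cvg => [n||]; [exact: m|exact: m|].
  apply: filterS cV => w h; apply: cvgD; last exact: cvg_cst.
  by apply: cvgD; last exact: cvg_cst.
apply: (cvg_same_limit (fun n => cos_price_noise_past l (pV n) s0) lim).
by apply: cvgMr; exact: Rintegral_cos_cvg.
Qed.

(** The time integral in [ou_explicit] is replaced by sums over a grid of [[0, u]], which involve
    [beta] at finitely many times before [t]. *)
Lemma past_limit_X u : 0 <= u -> u <= t -> past_limit (X u).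
Proof.
move=> u0 ut.
pose kern v := kappa * expR (kappa * v).
have ik : mu.-integrable `[0, u] (EFin \o kern).
  apply/within_continuous_integrable/within_continuous_mul.
    exact: within_continuous_cst.
  exact: within_continuous_expRM.
have tagP n k : grid 0 u n k <= grid 0 u n k <= grid 0 u n k.+1.
  by rewrite lexx grid_nd.
pose tag n k := Num.min (grid 0 u n k) u.
pose V_ n w := expR (- kappa * u) * (x0 + \sum_(k < n.+1)
  (theta - psi * beta (tag n k) w) *
    \int[mu]_(v in `[grid 0 u n k, grid 0 u n k.+1]) kern v) + psi * beta u w.
split; first exact: measurable_funP.
have mb v : 0 <= v -> v <= u -> past_measurable (beta v).
  move=> v0 vu; apply: brownian_sigma_measurable => //; exact: le_trans ut.
exists V_; split.
  move=> n; apply: measurable_funD; last first.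
    by apply: measurable_funM => //; exact: mb.
  apply: measurable_funM => //; apply: measurable_funD => //.
  apply: measurable_sum => k.
  apply: measurable_funM => //; apply: measurable_funB => //.
  apply: measurable_funM => //; apply: mb; last by rewrite ge_min lexx orbT.
  by rewrite le_min u0 grid_ge.
apply: filterS (ou_ae_path hbeta hX) => w [b0 cb sde].
have cX : {within `[0, +oo[, continuous (X ^~ w)} by exact: (ou_continuous hX).
rewrite (ou_explicit cX sde cb u0); apply: cvgD; last exact: cvg_cst.
apply: cvgMr; apply: cvgD; first exact: cvg_cst.
have cb' := within_continuous_itvW (T := u) (lexx 0) cb.
have cf : continuous (fun v => theta - psi * (beta^~ w \o clamp 0 u) v).
  move=> v; apply: cvgB; first exact: cvg_cst.
  by apply: cvgMr; exact: continuous_comp_clamp.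
have := stieltjes_sum_cvg u0 cf ik tagP.
have -> : \int[mu]_(v in `[0, u]) ((theta - psi * (beta^~ w \o clamp 0 u) v) * kern v) =
    \int[mu]_(v in `[0, u]) ((theta - psi * beta v w) * (kappa * expR (kappa * v))).
  by apply: eq_Rintegral => v; rewrite inE/= in_itv/= => vu; rewrite clamp_id.
apply: cvg_trans; apply: near_eq_cvg; apply: nearW => n.
apply: eq_bigr => k _; rewrite /tag /= clamp_id ?min_l//.
  by rewrite grid_le// ltnW.
by rewrite grid_ge//= grid_le// ltnW.
Qed.

End characteristic_function.

(** * From an even cosine transform to orthogonality *)

Section sine_quotient.
Context {R : realType}.

Lemma sin_mean_value (x : R) : exists2 c, `|c| <= `|x| & sin x = cos c * x.
Proof.
wlog x0 : x / 0 <= x => [h|].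
  have [/h//|/ltW xn] := leP 0 x.
  have [|c cx sx] := h (- x); first by rewrite oppr_ge0.
  exists c; first by rewrite -(normrN x).
  by rewrite -{1}[x]opprK sinN sx mulrN opprK.
have [|c] := @MVT_segment R sin cos 0 x x0 (fun y _ => is_derive_sin y).
  by apply: continuous_subspaceT; exact: continuous_sin.
rewrite in_itv/= sin0 !subr0 => /andP[c0 cx] E; exists c => //.
by rewrite !ger0_norm.
Qed.

Lemma normr_sin_le (x : R) : `|sin x| <= `|x|.
Proof.
by have [c _ ->] := sin_mean_value x; rewrite normrM ler_piMl// cos_max.
Qed.

Lemma sin_quotient_cvg (x : R) : n.+1%:R * sin (n.+1%:R^-1 * x) @[n --> \oo] --> x.
Proof.
have /choice[c hc] n : exists c, `|c| <= `|n.+1%:R^-1 * x| /\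
    n.+1%:R * sin (n.+1%:R^-1 * x) = cos c * x.
  have [c cx sx] := sin_mean_value (n.+1%:R^-1 * x); exists c; split => //.
  by rewrite sx mulrCA mulVKf// pnatr_eq0.
have c0 : c n @[n --> \oo] --> (0:R).
  apply: norm_cvg0.
  apply: (@squeeze_cvgr _ _ _ _ (cst 0) (fun n => `|x| * n.+1%:R^-1)).
  - apply: nearW => n; have [h _] := hc n; rewrite normr_ge0/=.
    by apply: le_trans h _; rewrite normrM mulrC (@ger0_norm _ n.+1%:R^-1).
  - exact: cvg_cst.
  - by apply: (cvg_eq (mulr0 `|x|)); apply: cvgMr; exact: cvg_harmonic.
have -> : (fun n => n.+1%:R * sin (n.+1%:R^-1 * x)) = (fun n => cos (c n) * x).
  by apply/funext => n; have [_ ->] := hc n.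
apply: (cvg_eq (mul1r x)); apply: cvgMl; rewrite -cos0.
exact: (cvg_comp _ cos c0 (@continuous_cos R 0)).
Qed.

End sine_quotient.

Section symmetric_noise.
Context d (Omega : measurableType d) (R : realType) (Q : probability Omega R).
Variables (L N : Omega -> R).
Hypotheses (mL : measurable_fun setT L) (iN : Q.-integrable setT (EFin \o N)).

Let mN : measurable_fun setT N.
Proof. exact/measurable_EFinP/(measurable_int _ iN). Qed.

(* [cos (L - e N) - cos (L + e N) = 2 sin L sin (e N)], and [sin (e N) / e] tends to [N]. *)
Lemma symmetric_Rintegral_sin0 :
  (forall e, \int[Q]_w cos (L w + e * N w) = \int[Q]_w cos (L w - e * N w)) ->
  \int[Q]_w (N w * sin (L w)) = 0.
Proof.
move=> sym.
have bi (h : Omega -> R) : measurable_fun setT h -> (forall w, `|h w| <= 1) ->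
    Q.-integrable setT (EFin \o h).
  move=> mh h1; apply: (@dominated_integrableR _ _ _ _ _ _ (cst 1)) => //.
  exact: finite_measure_integrable_cst.
have mc (f : Omega -> R) : measurable_fun setT f -> measurable_fun setT (fun w => cos (f w)).
  exact: measurable_cosT.
have ms (f : Omega -> R) : measurable_fun setT f -> measurable_fun setT (fun w => sin (f w)).
  by move=> mf; apply: measurableT_comp => //; exact: measurable_sin.
have meN e : measurable_fun setT (fun w => e * N w) by exact: measurable_funM.
have S0 e : \int[Q]_w (sin (L w) * sin (e * N w)) = 0.
  have i1 : Q.-integrable setT (EFin \o (fun w => cos (L w - e * N w))).
    by apply: bi => [|w]; [apply: mc; exact: measurable_funB|exact: cos_max].
  have i2 : Q.-integrable setT (EFin \o (fun w => cos (L w + e * N w))).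
    by apply: bi => [|w]; [apply: mc; exact: measurable_funD|exact: cos_max].
  have i3 : Q.-integrable setT (EFin \o (fun w => cos (L w - e * N w) - cos (L w + e * N w))).
    exact: (integrableB measurableT i1 i2).
  transitivity (\int[Q]_w (2^-1 * (cos (L w - e * N w) - cos (L w + e * N w)))).
    by apply: eq_Rintegral => w _; rewrite cosB cosD; field.
  by rewrite RintegralZl// RintegralB// sym subrr mulr0.
pose f_ n w := sin (L w) * (n.+1%:R * sin (n.+1%:R^-1 * N w)).
have lim : \int[Q]_w f_ n w @[n --> \oo] --> \int[Q]_w (sin (L w) * N w).
  apply: (@Rintegral_dominated_cvg _ _ _ _ _ _ _ (fun w => `|N w|)) => //.
  - move=> n; apply: measurable_funM; first exact: ms.
    by apply: measurable_funM => //; exact: ms.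
  - by apply: measurable_funM => //; exact: ms.
  - by apply: aeW => w _; apply: cvgMr; exact: sin_quotient_cvg.
  - exact: integrable_norm.
  - apply: aeW => w _ n; rewrite /f_ normrM -[leRHS]mul1r ler_pM ?sin_max//.
    rewrite normrM ger0_norm// mulrC -ler_pdivlMr//.
    by rewrite (le_trans (normr_sin_le _))// normrM ger0_norm// mulrC.
under eq_Rintegral do rewrite mulrC.
apply: (cvg_unique _ lim) => //; apply: cvg_near_cst; apply: nearW => n.
rewrite /f_; under eq_Rintegral do rewrite mulrCA.
rewrite RintegralZl// ?S0 ?mulr0//; apply: bi.
  by apply: measurable_funM; exact: ms.
by move=> w; rewrite normrM -[leRHS]mulr1 ler_pM ?sin_max.
Qed.

End symmetric_noise.

(** * Orthogonality of the pricing error and the conditional expectation *)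

Section projection.
Context d (Omega : measurableType d) (R : realType) (Q : probability Omega R).
Local Notation mu := (@lebesgue_measure R).
Variables (r : R -> R) (kappa theta psi x0 sigma : R) (beta B X : R -> {RV Q >-> R}).
Hypothesis hr : forall t, 0 <= t -> mu.-integrable `[0, t] (EFin \o r).
Hypothesis hpi : (\int[mu]_(u in `[0%R, +oo[) (discount r u)%:E < +oo)%E.
Hypotheses (hk : 0 < kappa) (hpsi : 0 < psi) (hsigma : 0 < sigma).
Hypotheses (hbeta : is_brownian_motion beta) (hB : is_brownian_motion B).
Hypothesis hbetaB : independent_systems Q
  (sigma_of `[0, +oo[ beta) (sigma_of `[0, +oo[ B).
Hypothesis hX : is_ornstein_uhlenbeck kappa theta psi x0 beta X.
Local Notation D := (discount r).
Variable t : R.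
Hypothesis t_gt0 : 0 < t.

Let t0 : 0 <= t. Proof. exact: ltW. Qed.

Local Notation dd := (discounted_dividends r X).
Local Notation past_limit := (past_limit beta t).
Local Notation drift := (price_drift r kappa theta X t).
Local Notation noise := (price_noise r kappa theta X t).

Let measurable_dd a : 0 <= a -> measurable_fun setT (dd a).
Proof. exact: (measurable_discounted_dividends hr hpi hk hpsi hbeta hX). Qed.

Let past_limit_cst c : past_limit (fun=> c).
Proof. by apply: past_measurable_limit; exact: measurable_cst. Qed.

(** Dividends paid between [u] and [t] are an affine function of [X u] plus an integral of [beta]
    over [[u, t]], approximated by finite sums of increments before [t]. *)
Lemma past_limit_dividends u : 0 <= u -> u <= t ->
  past_limit (fun w => dd u w - dd t w).
Proof.
move=> u0 ut; pose q := q_smooth r kappa u t.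
pose c0 := theta * (\int[mu]_(v in `[u, t]) D v - q u).
pose J w := dd u w - dd t w - (q u * X u w + c0).
have pX := past_limit_X hbeta hX u0 ut.
suff pJ : past_limit J.
  rewrite (_ : (fun w => dd u w - dd t w) = (fun w => J w + (q u * X u w + c0))).
    apply: past_limitD => //; apply: past_limitD; last exact: past_limit_cst.
    exact: past_limitZ.
  by apply/funext => w; rewrite /J subrK.
split.
  apply: measurable_funB; first by apply: measurable_funB; exact: measurable_dd.
  by apply: measurable_funD => //; exact: measurable_funM.
pose tag n k := Num.min (grid u t n k) t.
exists (fun n w => psi * \sum_(k < n.+1) q (grid u t n k.+1) *
  (beta (tag n k.+1) w - beta (tag n k) w)); split.
  have mb n k : past_measurable beta t (beta (tag n k)).
    apply: brownian_sigma_measurable; last by rewrite ge_min lexx orbT.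
    by rewrite le_min t0 (le_trans u0)// grid_ge.
  move=> n; apply: measurable_funM => //; apply: measurable_sum => k.
  by apply: measurable_funM => //; apply: measurable_funB; exact: mb.
have h := discounted_dividends_split hr hpi hk hpsi hbeta hX u0 ut.
apply: filterS2 h (ou_ae_path hbeta hX) => w ddE [b0 cb sde].
have cX : {within `[0, +oo[, continuous (X ^~ w)} by exact: (ou_continuous hX).
have := ou_discounted_path hr u0 ut cX cb sde => pathE.
have -> : J w = psi * \int[mu]_(v in `[u, t])
    ((beta v w - beta u w) * (D v - kappa * q v)).
  by rewrite /J ddE pathE -/q /c0; ring.
have cb' : {within `[u, t], continuous (fun v => beta v w - beta u w)}.
  apply: within_continuous_sub; last exact: within_continuous_cst.
  exact: within_continuous_itvW cb.
have lim := stieltjes_by_parts_cvg ut (within_continuous_q hr u0 ut)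
  (within_continuous_dq hr u0 ut)
  (fun v h => @q_smooth_derive _ r kappa hr u t u0 v h) cb'
  (subrr _) (q_smooth_end _ _ _ _).
apply: cvgMr; apply: cvg_trans lim; apply: near_eq_cvg; apply: nearW => n.
by apply: eq_bigr => k _; rewrite /tag !min_l ?grid_le// 1?ltnW//; congr (_ * _); ring.
Qed.

Lemma past_limit_drift : past_limit drift.
Proof.
apply: past_limitD; first exact: past_limit_cst.
apply: past_limitZ; apply: past_limitD; last exact: past_limit_cst.
exact: (past_limit_X hbeta hX t0 (lexx t)).
Qed.

(* [(true, s)] stands for the information at time [s], [(false, s)] for the dividend. *)
Definition observation (i : bool * R) : Omega -> R :=
  if i.1 then information r sigma X B i.2 else X i.2.

Definition observed (i : bool * R) := 0 <= i.2 <= t.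

Let measurable_observation i : observed i -> measurable_fun setT (observation i).
Proof.
move=> /andP[i0 _]; rewrite /observation; case: ifP => _ //.
by apply: measurable_funD => //; apply: measurable_funM => //; exact: measurable_dd.
Qed.

(** In each information term the total [dd s] is split as [(dd s - dd t) + drift + noise]; the first
    two pieces belong to the past of [beta] and stay here, and the coefficients of [noise] are
    collected in [loading]. *)
Let past_part (S : seq ((bool * R) * R)) (w : Omega) : R := \sum_(x <- S)
  if x.1.1 then x.2 * (sigma * x.1.2) * (dd x.1.2 w - dd t w + drift w)
  else x.2 * X x.1.2 w.

Let loading (S : seq ((bool * R) * R)) : R :=
  \sum_(x <- S) if x.1.1 then x.2 * (sigma * x.1.2) else 0.

Let noise_times (S : seq ((bool * R) * R)) : seq (R * R) :=
  [seq (x.1.2, x.2) | x <- S & x.1.1].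

Let leT (x y : R * R) := x.1 <= y.1.

(** Observations come in any order and possibly repeated. Sorting leaves the sums unchanged and
    provides the ordered times required by the Brownian transform. *)
Let sorted_times S := sort leT (noise_times S).

Let past_limit_past_part S : all (fun x => observed x.1) S -> past_limit (past_part S).
Proof.
elim: S => [|[[b s] l] S IH] /=.
  move=> _; rewrite (_ : past_part _ = fun=> 0); first exact: past_limit_cst.
  by apply/funext => w; rewrite /past_part big_nil.
move=> /andP[/andP[/= s0 st] oS].
rewrite (_ : past_part _ = fun w => (if b then l * (sigma * s) *
  (dd s w - dd t w + drift w) else l * X s w) + past_part S w); last first.
  by apply/funext => w; rewrite /past_part big_cons.
apply: past_limitD; last exact: IH.
case: b; last by apply: past_limitZ; exact: (past_limit_X hbeta hX s0 st).
apply: past_limitZ; apply: past_limitD; first exact: past_limit_dividends.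
exact: past_limit_drift.
Qed.

Let phaseE S w : B 0 w = 0 -> \sum_(x <- S) x.2 * observation x.1 w =
  past_part S w + loading S * noise w + noise_sum B (sorted_times S) w.
Proof.
move=> B0.
have -> : noise_sum B (sorted_times S) w = noise_sum B (noise_times S) w.
  by apply: perm_big; rewrite perm_sort.
rewrite /noise_sum /noise_times big_map big_filter B0.
elim: S => [|[[b s] l] S IH].
  by rewrite /past_part /loading !big_nil mul0r !addr0.
rewrite big_cons IH /past_part /loading !big_cons/=.
by case: b; rewrite /observation/= /information /price_noise ?subr0; ring.
Qed.

Let times_path S : all (fun x => observed x.1) S ->
  path <=%O (0:R) (map fst (sorted_times S)) /\
  all (fun x : R * R => x.1 <= t) (sorted_times S).
Proof.
move=> oS.
have o : all (fun x : R * R => 0 <= x.1 <= t) (noise_times S).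
  rewrite /noise_times all_map; apply/allP => x; rewrite mem_filter => /andP[_ xS].
  exact: (allP oS).
have so : all (fun x : R * R => 0 <= x.1 <= t) (sorted_times S) by rewrite all_sort.
split; last by apply: sub_all so => x /andP[].
rewrite path_sortedE; last exact: le_trans.
rewrite all_map (sub_all _ so)/=; last by move=> x /andP[].
by rewrite sorted_map; apply: sort_sorted => x y; exact: le_total.
Qed.

Let times_sum S : loading S = sigma * \sum_(x <- sorted_times S) x.2 * (x.1 - 0).
Proof.
have -> : \sum_(x <- sorted_times S) x.2 * (x.1 - 0) =
    \sum_(x <- noise_times S) x.2 * (x.1 - 0) by apply: perm_big; rewrite perm_sort.
rewrite /noise_times big_map big_filter mulr_sumr big_mkcond /loading/=.
by apply: eq_bigr => x _; case: ifP => _ //; ring.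
Qed.

Local Notation z := (z_coef r kappa psi sigma t).

(* The coefficient of the observation that makes the residual orthogonal to all of them. *)
Let c := z / (sigma * t).

(** The pricing error [dd t - price_version]: expanding the information at [t], the drift cancels
    and [dd t] survives only through [noise]. *)
Definition residual (w : Omega) : R := (1 - z) * noise w - c * B t w.

Let v := price_var r kappa psi t.

Let v_ge0 : 0 <= v.
Proof.
rewrite /v /price_var mulr_ge0 ?sqr_ge0//.
by apply: Rintegral_ge0 => u _; exact: sqr_ge0.
Qed.

Let zE : z = (sigma ^+ 2 * t * v) / (1 + sigma ^+ 2 * t * v).
Proof. by rewrite /z_coef /= /v /price_var; congr (_ / (1 + _)); ring. Qed.

Let z_orthogonal : (1 - z) * v * sigma = c.
Proof.
have p : 0 < 1 + sigma ^+ 2 * t * v.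
  by rewrite ltr_wpDr// mulr_ge0// mulr_ge0// sqr_ge0.
rewrite /c zE; field.
by rewrite !gt_eqF// mulr_gt0.
Qed.

Let cos_residual S p e : all (fun x => observed x.1) S ->
  \int[Q]_w cos (\sum_(x <- S) x.2 * observation x.1 w + p + e * residual w) =
  expR (- ((loading S ^+ 2 + e ^+ 2 * (1 - z) ^+ 2) * v / 2)) *
  expR (- ((brownian_var 0 (sorted_times S) + e ^+ 2 * c ^+ 2 * t) / 2)) *
  \int[Q]_w cos (past_part S w + p).
Proof.
move=> oS; have [tp ta] := times_path oS.
have pV : past_limit (fun w => past_part S w + p).
  by apply: past_limitD; [exact: past_limit_past_part|exact: past_limit_cst].
(* The noise of [e * residual] enters as one more increment; appended last, it keeps the times
   sorted because every observation time is at most [t]. *)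
pose s := rcons (sorted_times S) (t, - (e * c)).
have s0 : nonneg_times s.
  rewrite /nonneg_times /s map_rcons rcons_path tp/=.
  elim/last_ind: (sorted_times S) ta => [//|s' x _]; rewrite all_rcons => /andP[xt _].
  by rewrite map_rcons last_rcons.
have mnoise : measurable_fun setT noise.
  exact: (measurable_price_noise hr hpi hk hpsi hbeta hX).
transitivity (\int[Q]_w cos ((past_part S w + p) + (loading S + e * (1 - z)) * noise w +
    noise_sum B s w)).
  apply: ae_eq_Rintegral_cos.
  - apply: measurable_funD; last first.
      apply: measurable_funM => //; apply: measurable_funB; exact: measurable_funM.
    apply: measurable_funD => //.
    elim: S oS {tp ta pV s s0} => [|x S IH] /=.
      by move=> _; under eq_fun do rewrite big_nil; exact: measurable_cst.
    move=> /andP[ox oS]; under eq_fun do rewrite big_cons.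
    apply: measurable_funD; last exact: IH.
    by apply: measurable_funM => //; exact: measurable_observation.
  - apply: measurable_funD; last exact: measurable_noise_sum.
    by apply: measurable_funD; [have [] := pV|exact: measurable_funM].
  - apply: filterS (bm_start hB) => w B0; rewrite phaseE//.
    rewrite {2}/noise_sum /s -cats1 big_cat big_seq1/= -/(noise_sum B _ w) B0 /residual.
    ring.
rewrite (cos_price_noise hr hpi hk hpsi hbeta hB hbetaB hX t0 _ pV s0) -/v.
congr (_ * _); rewrite -!expRD; congr expR.
rewrite /s brownian_var_rcons subr0.
have -> : \sum_(x <- sorted_times S) x.2 * (x.1 - 0) = loading S / sigma.
  by rewrite times_sum mulrC mulKf// gt_eqF.
(* The terms linear in [e] are [2 * e * loading S * ((1 - z) * v - c / sigma)], which is zero; [e]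
   survives only squared. *)
rewrite -z_orthogonal; field; rewrite gt_eqF//.
Qed.

Lemma integrable_price_drift : Q.-integrable setT (EFin \o drift).
Proof.
have iX := ou_integrable hk hpsi hbeta hX t0.
have ic (k : R) : Q.-integrable setT (EFin \o cst k) by exact: finite_measure_integrable_cst.
have iXc : Q.-integrable setT (EFin \o (fun w => X t w - theta)).
  exact: (integrableB measurableT iX (ic theta)).
have iq : Q.-integrable setT (EFin \o (fun w => q_coef r kappa t * (X t w - theta))).
  under [X in _.-integrable _ X]eq_fun do rewrite /= EFinM.
  exact: (integrableZl measurableT _ iXc).
exact: (integrableD measurableT (ic _) iq).
Qed.

Lemma integrable_brownian s : 0 <= s -> Q.-integrable setT (EFin \o B s).
Proof.
move=> s0; have i := brownian_increment_integrable hB (lexx 0) s0.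
apply/integrableP; split; first exact/measurable_EFinP.
rewrite (ae_eq_integral (fun w => `|B s w - B 0 w|%:E))//.
- by case/integrableP: i.
- by apply/measurable_EFinP; exact: measurableT_comp.
- by apply/measurable_EFinP; apply: measurableT_comp => //; exact: measurable_funB.
- by apply: filterS (bm_start hB) => w B0 _; rewrite /= B0 subr0.
Qed.

Lemma integrable_residual : Q.-integrable setT (EFin \o residual).
Proof.
have idd := integrable_discounted_dividends hr hpi hk hpsi hbeta hX t0.
have in_ : Q.-integrable setT (EFin \o noise).
  exact: (integrableB measurableT idd integrable_price_drift).
have i1 : Q.-integrable setT (EFin \o (fun w => (1 - z) * noise w)).
  under [X in _.-integrable _ X]eq_fun do rewrite /= EFinM.
  exact: (integrableZl measurableT _ in_).
have i2 : Q.-integrable setT (EFin \o (fun w => c * B t w)).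
  under [X in _.-integrable _ X]eq_fun do rewrite /= EFinM.
  exact: (integrableZl measurableT _ (integrable_brownian t0)).
exact: (integrableB measurableT i1 i2).
Qed.

Lemma residual_orthogonal S p : all (fun x => observed x.1) S ->
  \int[Q]_w (residual w * cos (\sum_(x <- S) x.2 * observation x.1 w + p)) = 0.
Proof.
move=> oS.
(* A shift by [pi / 2] puts the phase into the sine form of [symmetric_Rintegral_sin0]; phases being
   arbitrary, the transform formula still covers it. *)
transitivity (\int[Q]_w (residual w *
    sin (\sum_(x <- S) x.2 * observation x.1 w + (p + pi / 2)))).
  apply: eq_Rintegral => w _; congr (_ * _).
  by rewrite addrA sinD cos_pihalf sin_pihalf mulr0 add0r mulr1.
apply: symmetric_Rintegral_sin0.
- apply: measurable_funD => //; elim: S oS => [|x S IH] /=.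
    by move=> _; under eq_fun do rewrite big_nil; exact: measurable_cst.
  move=> /andP[ox oS]; under eq_fun do rewrite big_cons.
  apply: measurable_funD; last exact: IH.
  by apply: measurable_funM => //; exact: measurable_observation.
- exact: integrable_residual.
move=> e; under [in RHS]eq_Rintegral do rewrite -mulNr.
by rewrite !cos_residual// sqrrN.
Qed.

Definition price_version (w : Omega) : R :=
  (1 - z) * drift w + 1 / (sigma * t) * z * information r sigma X B t w.

Let residualE w : residual w = dd t w - price_version w.
Proof.
rewrite /residual /price_version /information /price_noise /c; field.
by rewrite !gt_eqF.
Qed.

(** The formula uses only [X t] and the information at [t], hence is measurable for the filtration.
    The generators of the filtration are preimages of the indexed [observation]s, so orthogonality
    to all phases gives a vanishing integral of [residual] over every event of the filtration. *)
Lemma is_cond_exp_price :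
  is_cond_exp Q (market_filtration r sigma X B t) (dd t) price_version.
Proof.
have idd := integrable_discounted_dividends hr hpi hk hpsi hbeta hX t0.
have iV : Q.-integrable setT (EFin \o price_version).
  rewrite (_ : price_version = fun w => dd t w - residual w).
    exact: (integrableB measurableT idd integrable_residual).
  by apply/funext => w; rewrite residualE; ring.
pose P := preimages_of `[0, t]%classic (information r sigma X B) `|`
  preimages_of `[0, t]%classic X.
have tt : `[0, t]%classic t by rewrite /= in_itv/= lexx t0.
have mXt : sigma_measurable P (X t).
  by apply: (@sigma_measurableW _ _ _ (preimages_of `[0, t]%classic X));
    [exact: subsetUr|exact: (sigma_measurable_preimages_of (Y := X))].
have mIt : sigma_measurable P (information r sigma X B t).
  by apply: (@sigma_measurableW _ _ _ (preimages_of `[0, t]%classic _));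
    [exact: subsetUl|exact: (sigma_measurable_preimages_of (Y := information r sigma X B))].
have Pm : P `<=` measurable.
  move=> A [[s + [U mU <-]]|[s + [U mU <-]]]; rewrite /= in_itv/= => os.
    exact: (@measurable_observation (true, s)).
  exact: (@measurable_observation (false, s)).
split => //.
  apply/sigma_measurableP; apply: measurable_funD.
    apply: measurable_funM => //; apply: measurable_funD => //.
    by apply: measurable_funM => //; exact: measurable_funB.
  exact: measurable_funM.
move=> A PA.
have mA : measurable A.
  by move: A PA; apply: smallest_sub => //; exact: sigma_algebra_measurable.
have iA (f : Omega -> R) : Q.-integrable setT (EFin \o f) ->
  Q.-integrable A (EFin \o f) by exact: integrableS.
have : \int[Q]_(w in A) residual w = 0.
  apply: (integral_sigma_eq0 (D := observed) (Y := observation) integrable_residual).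
  - exact: measurable_observation.
  - by move=> S p oS; exact: residual_orthogonal.
  apply: sub_smallest2r PA => [|B' [[s + [U mU <-]]|[s + [U mU <-]]]].
  - exact: smallest_sigma_algebra.
  - by rewrite /= in_itv/= => os; exists (true, s) => //; exists U => //; rewrite setTI.
  - by rewrite /= in_itv/= => os; exists (false, s) => //; exists U => //; rewrite setTI.
under eq_Rintegral do rewrite residualE.
rewrite RintegralB//; try exact: iA.
move=> /subr0_eq E; have eE := congr1 (fun x : R => x%:E) E.
move: eE; rewrite /Rintegral !fineK => [->//||];
  by apply: integrable_fin_num => //; exact: iA.
Qed.

End projection.

Theorem mainTheorem1 (d : measure_display) (Omega : measurableType d)
    (R : realType) (Q : probability Omega R)
    (r : R -> R) (kappa theta psi x0 sigma : R)
    (beta B X : R -> {RV Q >-> R})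
    (hr : forall t, 0 <= t ->
       lebesgue_measure.-integrable `[0, t] (EFin \o r))
    (hpi : (\int[lebesgue_measure]_(u in `[0%R, +oo[) (discount r u)%:E
            < +oo)%E)
    (hkappa : 0 < kappa) (hpsi : 0 < psi) (hsigma : 0 < sigma)
    (hbeta : is_brownian_motion beta) (hB : is_brownian_motion B)
    (hbetaB : independent_systems Q
       (sigma_of `[0, +oo[ beta) (sigma_of `[0, +oo[ B))
    (hX : is_ornstein_uhlenbeck kappa theta psi x0 beta X) :
  forall t : R, 0 < t ->
    {ae Q, forall w : Omega,
      discount r t * commodity_price r sigma X B t w =
      (1 - z_coef r kappa psi sigma t) *
        (theta * p_coef r t + q_coef r kappa t * (X t w - theta)) +
      1 / (sigma * t) * z_coef r kappa psi sigma t * information r sigma X B t w}.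
Proof.
move=> t t0.
have V := is_cond_exp_price hr hpi hkappa hpsi hsigma hbeta hB hbetaB hX t0.
apply: filterS (cond_exp_unique V) => w E.
by rewrite /commodity_price E mulVKf // gt_eqF// discount_gt0.
Qed.
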